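(* Let $A$ and $B$ be locally $C^*$-algebras. If $A$ and $B$ are strongly Morita equivalent, then there is a bijective correspondence between the unitary equivalence classes of non-degenerate representations of $A$ and the unitary equivalence classes of non-degenerate representations of $B$ which preserves direct sums and irreducibility.
   Context: A locally $C^*$-algebra is a complete Hausdorff complex topological $*$-algebra $A$ whose topology is determined by its continuous $C^*$-seminorms: a net $\{a_i\}$ converges to $0$ iff $\{p(a_i)\}$ converges to $0$ for every continuous $C^*$-seminorm $p$ on $A$. $S(A)$ denotes the set of all continuous $C^*$-seminorms on $A$. An isomorphism of locally $C^*$-algebras is a bijective continuous $*$-morphism with continuous inverse. A representation $(\varphi,H)$ of $A$ is a continuous $*$-morphism $\varphi:A\to L(H)$, with $L(H)$ the $C^*$-algebra of bounded linear operators on a Hilbert space $H$. It is non-degenerate if $\varphi(A)H$ is dense in $H$. Two representations $(\varphi_1,H_1)$, $(\varphi_2,H_2)$ of $A$ are unitarily equivalent if there is a unitary operator $U$ from $H_1$ onto $H_2$ with $U\varphi_1(a)=\varphi_2(a)U$ for all $a\in A$. A Hilbert $A$-module is a complex vector space $E$ which is a right $A$-module (compatibly with the complex algebra structure) with an $A$-valued inner product $\langle\cdot,\cdot\rangle$, $\mathbb{C}$- and $A$-linear in the second variable, such that $\langle\xi,\eta\rangle^*=\langle\eta,\xi\rangle$, $\langle\xi,\xi\rangle\ge 0$, and $\langle\xi,\xi\rangle=0$ iff $\xi=0$, and which is complete for the topology given by the seminorms $\|\xi\|_p=\sqrt{p(\langle\xi,\xi\rangle)}$, $p\in S(A)$.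 It is full if the ideal of $A$ generated by $\{\langle\xi,\eta\rangle:\xi,\eta\in E\}$ is dense in $A$. $L_A(E)$ is the locally $C^*$-algebra of adjointable linear operators on $E$ with topology given by the seminorms $\widetilde p(T)=\sup\{\|T\xi\|_p:\|\xi\|_p\le 1\}$, $p\in S(A)$, and $K_A(E)$ is the closed linear span in $L_A(E)$ of the operators $\theta_{\eta,\xi}(\zeta)=\eta\langle\xi,\zeta\rangle$, $\xi,\eta\in E$; it is a locally $C^*$-algebra. $A$ and $B$ are strongly Morita equivalent if there is a full Hilbert $A$-module $E$ such that the locally $C^*$-algebras $B$ and $K_A(E)$ are isomorphic. Preserving direct sums means: whenever a non-degenerate representation $(\varphi,H)$ of $A$ is a direct sum $\left(\bigoplus_{i\in I}\varphi_i,\bigoplus_{i\in I}H_i\right)$ of representations $(\varphi_i,H_i)$ of $A$, the class corresponding to that of $\varphi$ is the class of the direct sum of representations of $B$ whose classes correspond to those of the $\varphi_i$. Preserving irreducibility means that classes of irreducible non-degenerate representations of $A$ correspond to classes of irreducible representations of $B$. *)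

(* Defs.v *)
From HB Require Import structures.
From mathcomp Require Import all_boot all_order all_algebra.
From mathcomp Require Import sesquilinear.
From mathcomp Require Import complex.
From mathcomp Require Import all_classical all_reals all_analysis.

Set Implicit Arguments.
Unset Strict Implicit.
Unset Printing Implicit Defensive.

Import Order.TTheory GRing.Theory Num.Theory.
Import numFieldNormedType.Exports.

Local Open Scope classical_set_scope.
Local Open Scope complex_scope.
Local Open Scope ring_scope.

Definition subspace (K : numFieldType) (V : lmodType K) (M : set V) : Prop :=
  M 0 /\ forall (c : K) (x y : V), M x -> M y -> M (c *: x + y).

(* Algebras are not assumed to be unital, so MathComp's algebra structures,
   which all have a unit, do not apply. *)
HB.mixin Record isStarAlgebra (R : realType) A of GRing.Lmodule R[i] A := {
  amul : A -> A -> A;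
  star : A -> A;
  amulA : associative amul;
  amulDl : left_distributive amul +%R;
  amulDr : right_distributive amul +%R;
  amulZl : forall (c : R[i]) (a b : A), amul (c *: a) b = c *: amul a b;
  amulZr : forall (c : R[i]) (a b : A), amul a (c *: b) = c *: amul a b;
  starK : involutive star;
  starD : forall a b : A, star (a + b) = star a + star b;
  starZ : forall (c : R[i]) (a : A), star (c *: a) = Num.conj c *: star a;
  starM : forall a b : A, star (amul a b) = amul (star b) (star a)
}.

#[short(type="starAlgType")]
HB.structure Definition StarAlgebra (R : realType) :=
  {A of GRing.Lmodule R[i] A & isStarAlgebra R A}.

Definition Cstar_seminorm (R : realType) (A : starAlgType R) (p : A -> R)
    : Prop :=
  [/\ forall a b : A, p (a + b) <= p a + p b,
      forall (c : R[i]) (a : A), p (c *: a) = complex.Re `|c| * p a,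
      forall a b : A, p (amul a b) <= p a * p b &
      forall a : A, p (amul (star a) a) = p a ^+ 2].

#[short(type="topStarAlgType")]
HB.structure Definition TopStarAlgebra (R : realType) :=
  {A of StarAlgebra R A & Tvs R[i] A}.

(* The set written S(A) on paper. *)
Definition cont_Cstar_seminorms (R : realType) (A : topStarAlgType R)
    : set (A -> R) :=
  [set p | Cstar_seminorm p /\ continuous p].
Arguments cont_Cstar_seminorms {R A}.

(* Completeness refers to the uniform structure of the additive group. Since
   [Tvs] does not relate its uniform structure to the addition, this is forced
   by [locallyCstar_unif]. In [topology_Cstar_seminorms], proper filters play
   the role of nets; this axiom implies the local convexity contained in
   [Tvs]. *)
HB.mixin Record isLocallyCstar (R : realType) A of TopStarAlgebra R A := {
  amul_continuous : continuous (fun ab : A * A => amul ab.1 ab.2);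
  star_continuous : continuous (star : A -> A);
  locallyCstar_unif : unif_continuous (fun ab : A * A => ab.1 - ab.2);
  locallyCstar_complete : forall F : set_system A, ProperFilter F ->
    cauchy F -> exists a : A, F --> a;
  locallyCstar_hausdorff : hausdorff_space A;
  topology_Cstar_seminorms : forall F : set_system A, ProperFilter F ->
    (F --> (0 : A)) <->
    (forall p : A -> R, cont_Cstar_seminorms p ->
       p a @[a --> F] --> (0 : R))
}.

#[short(type="locallyCstarType")]
HB.structure Definition LocallyCstar (R : realType) :=
  {A of TopStarAlgebra R A & isLocallyCstar R A}.

Definition positive (R : realType) (A : starAlgType R) (a : A) : Prop :=
  exists b : A, a = amul (star b) b.

Definition two_sided_ideal (R : realType) (A : starAlgType R) (J : set A)
    : Prop :=
  subspace J /\ forall a x : A, J x -> J (amul a x) /\ J (amul x a).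

HB.mixin Record isPreHilbertModule (R : realType) (A : locallyCstarType R) E
    of GRing.Lmodule R[i] E := {
  act : E -> A -> E;
  inner : E -> E -> A;
  actDl : forall (x y : E) (a : A), act (x + y) a = act x a + act y a;
  actDr : forall (x : E) (a b : A), act x (a + b) = act x a + act x b;
  actA : forall (x : E) (a b : A), act x (amul a b) = act (act x a) b;
  actZl : forall (c : R[i]) (x : E) (a : A), act (c *: x) a = c *: act x a;
  actZr : forall (c : R[i]) (x : E) (a : A), act x (c *: a) = c *: act x a;
  innerDr : forall x y z : E, inner x (y + z) = inner x y + inner x z;
  innerZr : forall (c : R[i]) (x y : E), inner x (c *: y) = c *: inner x y;
  inner_act : forall (x y : E) (a : A), inner x (act y a) = amul (inner x y) a;
  star_inner : forall x y : E, star (inner x y) = inner y x;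
  inner_positive : forall x : E, positive (inner x x);
  inner_eq0 : forall x : E, inner x x = 0 <-> x = 0
}.

#[short(type="preHilbertModType")]
HB.structure Definition PreHilbertModule (R : realType)
    (A : locallyCstarType R) :=
  {E of GRing.Lmodule R[i] E & isPreHilbertModule R A E}.

Definition module_norm (R : realType) (A : locallyCstarType R)
    (E : preHilbertModType A) (p : A -> R) (x : E) : R :=
  Num.sqrt (p (inner x x)).

(* The topology carried by [E] is the one given by the seminorms
   [module_norm p], with the uniform structure of the additive group. *)
HB.mixin Record isHilbertModule (R : realType) (A : locallyCstarType R) E
    of PreHilbertModule R A E & Tvs R[i] E := {
  hilbertModule_unif : unif_continuous (fun xy : E * E => xy.1 - xy.2);
  hilbertModule_complete : forall F : set_system E, ProperFilter F ->
    cauchy F -> exists x : E, F --> x;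
  topology_module_norms : forall F : set_system E, ProperFilter F ->
    (F --> (0 : E)) <->
    (forall p : A -> R, cont_Cstar_seminorms p ->
       module_norm p x @[x --> F] --> (0 : R))
}.

#[short(type="hilbertModType")]
HB.structure Definition HilbertModule (R : realType)
    (A : locallyCstarType R) :=
  {E of PreHilbertModule R A E & Tvs R[i] E & isHilbertModule R A E}.

Section HilbertModuleOperators.
Context {R : realType} {A : locallyCstarType R} (E : hilbertModType A).

Definition full : Prop :=
  dense (smallest (@two_sided_ideal R A)
           [set a : A | exists x y : E, a = inner x y]).

Definition is_adjoint (T T' : E -> E) : Prop :=
  forall x y : E, inner (T x) y = inner x (T' y).

Definition adjointable : set (E -> E) :=
  [set T | linear T /\ exists T' : E -> E, is_adjoint T T'].

Definition op_seminorm (p : A -> R) (T : E -> E) : \bar R :=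
  ereal_sup [set (module_norm p (T x))%:E
            | x in [set x : E | module_norm p x <= 1]].

(* Convergence of [F] to [T] in the topology of L_A(E). *)
Definition op_cvg (F : set_system (E -> E)) (T : E -> E) : Prop :=
  forall p : A -> R, cont_Cstar_seminorms p ->
    op_seminorm p (S \- T) @[S --> F] --> 0%E.

Definition theta (y x : E) : E -> E := fun z => act y (inner x z).

Definition finite_rank : set (E -> E) :=
  smallest (@subspace _ (E -> E))
    [set T : E -> E | exists y x : E, T = theta y x].

(* [compact_op] is K_A(E): the limits in L_A(E) of nets of [finite_rank]. *)
Definition compact_op : set (E -> E) :=
  [set T | adjointable T /\
     exists F : set_system (E -> E),
       [/\ ProperFilter F, F finite_rank & op_cvg F T]].

(* An isomorphism of locally C*-algebras from [B] onto K_A(E). *)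
Definition iso_compact_op (B : locallyCstarType R) (f : B -> E -> E) : Prop :=
  [/\ set_bij [set: B] compact_op f,
      forall (c : R[i]) (b b' : B), f (c *: b + b') = c *: f b + f b',
      (forall b b' : B, f (amul b b') = f b \o f b') /\
      (forall b : B, is_adjoint (f b) (f (star b))),
      forall b : B, op_cvg (f @ b) (f b) &
      forall (F : set_system B) (b : B), ProperFilter F ->
        op_cvg (f @ F) (f b) -> F --> b].

End HilbertModuleOperators.

Definition strongly_Morita_equivalent (R : realType)
    (A B : locallyCstarType R) : Prop :=
  exists E : hilbertModType A,
    full E /\ exists f : B -> E -> E, iso_compact_op f.

(* As in [sesquilinear], [hdot] is linear in its first argument. *)
HB.mixin Record isHilbert (R : realType) H of CompleteNormedModule R[i] H := {
  hdot : {dot H for (@Num.conj R[i])};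
  hdot_norm : forall x : H, `|x| ^+ 2 = hdot x x
}.

#[short(type="hilbertType")]
HB.structure Definition Hilbert (R : realType) :=
  {H of CompleteNormedModule R[i] H & isHilbert R H}.

(* The norm of [H] takes its values in R[i]; this is the same real number
   in [R]. *)
Definition rnorm (R : realType) (H : hilbertType R) (x : H) : R :=
  complex.Re `|x|.

Definition opnorm (R : realType) (H : hilbertType R) (T : H -> H) : \bar R :=
  ereal_sup [set (rnorm (T x))%:E | x in [set x : H | rnorm x <= 1]].

Record representation (R : realType) (A : locallyCstarType R) := Rep {
  rep_space :> hilbertType R;
  rep_map : A -> {linear rep_space -> rep_space};
  rep_bounded : forall a : A, (opnorm (rep_map a) < +oo)%E;
  rep_linear : forall (c : R[i]) (a b : A) (x : rep_space),
    rep_map (c *: a + b) x = c *: rep_map a x + rep_map b x;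
  rep_mul : forall (a b : A) (x : rep_space),
    rep_map (amul a b) x = rep_map a (rep_map b x);
  rep_star : forall (a : A) (x y : rep_space),
    hdot (rep_map a x) y = hdot x (rep_map (star a) y);
  rep_continuous : forall a : A,
    opnorm (rep_map b \- rep_map a) @[b --> a] --> 0%E
}.

Section Representations.
Context {R : realType} {A : locallyCstarType R}.
Implicit Types phi : representation A.

Definition nondegenerate phi : Prop :=
  dense [set y : phi | exists (a : A) (x : phi), y = rep_map phi a x].

Definition unitary (H1 H2 : hilbertType R) (U : H1 -> H2) : Prop :=
  [/\ linear U, set_surj [set: H1] [set: H2] U &
      forall x y : H1, hdot (U x) (U y) = hdot x y].

Definition unitarily_equivalent phi1 phi2 : Prop :=
  exists U : phi1 -> phi2, unitary U /\
    forall (a : A) (x : phi1), U (rep_map phi1 a x) = rep_map phi2 a (U x).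

Definition irreducible phi : Prop :=
  (exists x : phi, x != 0) /\
  forall M : set phi, subspace M -> closed M ->
    (forall (a : A) (x : phi), M x -> M (rep_map phi a x)) ->
    M = [set 0] \/ M = setT.

(* [U] identifies the space of [phi] with the Hilbert direct sum of the spaces
   of the [phi_ i], i.e. the space of the families [y] such that the sum of the
   [|y i|^2] is finite, and [phi a] with the componentwise action. The direct
   sum of an arbitrary family of representations need not be continuous, hence
   a predicate rather than an operation. *)
Definition is_direct_sum (I : choiceType) phi (phi_ : I -> representation A)
    : Prop :=
  exists U : forall i : I, phi -> phi_ i,
    [/\ forall i : I, linear (U i),
        forall x : phi,
          (\esum_(i in [set: I]) (rnorm (U i x) ^+ 2)%:E = (rnorm x ^+ 2)%:E)%E,
        forall y : (forall i : I, phi_ i),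
          (\esum_(i in [set: I]) (rnorm (y i) ^+ 2)%:E < +oo)%E ->
          exists x : phi, forall i : I, U i x = y i &
        forall (a : A) (x : phi) (i : I),
          U i (rep_map phi a x) = rep_map (phi_ i) a (U i x)].

End Representations.

(* Classes are predicates rather than [set]s: [representation A], which ranges
   over all Hilbert spaces, does not fit in the universe of [set]. *)
Definition nondegenerate_class (R : realType) (A : locallyCstarType R) : Type :=
  {X : representation A -> Prop |
    exists phi : representation A,
      nondegenerate phi /\ X = unitarily_equivalent phi}.

Section Correspondences.
Context {R : realType} {A B : locallyCstarType R}.
Variable Phi : nondegenerate_class A -> nondegenerate_class B.

(* The summands of a non-degenerate representation are non-degenerate, so that
   the classes [X_ i] always exist. *)
Definition preserves_direct_sums : Prop :=
  forall (I : choiceType) (phi : representation A)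
      (phi_ : I -> representation A) (psi : representation B)
      (psi_ : I -> representation B)
      (X : nondegenerate_class A) (X_ : I -> nondegenerate_class A),
    sval X phi -> (forall i : I, sval (X_ i) (phi_ i)) ->
    sval (Phi X) psi -> (forall i : I, sval (Phi (X_ i)) (psi_ i)) ->
    is_direct_sum phi phi_ -> is_direct_sum psi psi_.

Definition preserves_irreducibility : Prop :=
  forall (X : nondegenerate_class A) (phi : representation A)
      (psi : representation B),
    sval X phi -> sval (Phi X) psi -> irreducible phi <-> irreducible psi.

End Correspondences.

(* Main.v *)
(** Let [E] be the full Hilbert [A]-module with [B = K_A(E)]. A representation
[phi] of [A] and a representation [psi] of [B] are linked when there are
operators [tau x : phi -> psi], for [x] in [E], with
[tau y ^* tau x = phi <y, x>] and [tau y tau x ^* = psi (theta y x)]. The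
vectors [tau x h] are then total, with a Gram matrix determined by [phi]
alone, and [tau x ^* u] are total with a Gram matrix determined by [psi]
alone, so each side determines the other up to unitary equivalence. Given
[phi], the space of [psi] is the Kolmogorov decomposition of the kernel
[<phi <y, x> h, g>]; given [psi], one uses the kernel [<psi (theta y x) u, v>]
instead. Closed invariant subspaces and direct sum decompositions are
transported along [tau].

The norm estimates behind positivity and boundedness avoid the functional
calculus: if [N (h^(n+1))^2 <= N (h^n) N (h^(n+2))] and [N (h^n)] grows at most
like [n M^n], then [N h <= M N 1]. *)

From HB Require Import structures.
From mathcomp Require Import all_boot all_order all_algebra.
From mathcomp Require Import sesquilinear complex.
From mathcomp Require Import all_classical all_reals all_analysis.
From mathcomp Require Import ring lra.
Require Import Defs.

Set Implicit Arguments.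
Unset Strict Implicit.
Unset Printing Implicit Defensive.

Import Order.TTheory GRing.Theory Num.Theory.
Import numFieldNormedType.Exports.

Local Open Scope classical_set_scope.
Local Open Scope complex_scope.
Local Open Scope ring_scope.

(** * Hilbert spaces *)

(** Nothing is reduced to the quotient C*-algebras [A / ker p], and neither spectra nor approximate
    units are used. Continuity of a representation gives a bound by a constant times one seminorm;
    log-convexity of the norms of the iterates of a self-adjoint operator then turns crude bounds
    into bounds with the expected constant. The Cauchy-Schwarz inequality for the seminorms of [E]
    depends on the order of the algebra, so positivity of [a^* a] is derived from norm inequalities
    alone, in a unitization. Nondegeneracy becomes triviality of the common kernel, by projecting
    onto the closure of a single orbit. The passages from [A] to [B] and back are two cases of one
    lemma on an algebra-valued form over an additive group. On the way back [E] serves as its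
    conjugate module, where scalars act through their conjugates; this is why the form lives on a
    group and not on a vector space. Using a kernel on pairs (module element, vector) in place of a
    tensor product turns linearity and well-definedness into equalities of Gram matrices. *)

Section ComplexModulus.
Context {R : realType}.
Implicit Types (c z : R[i]).

Definition cabs (c : R[i]) : R := complex.Re `|c|.

Lemma conjE c : Num.conj c = c^*%C.
Proof. by []. Qed.

Lemma cabsE c : `|c| = (cabs c)%:C.
Proof. by rewrite /cabs normc_def. Qed.

Lemma cabs_ge0 c : 0 <= cabs c.
Proof. by rewrite -ler0c -cabsE. Qed.

Lemma cabs2E c : (cabs c ^+ 2)%:C = c * c^*%C.
Proof. by rewrite rmorphXn /= -cabsE sqr_normc. Qed.

Lemma cabsM c z : cabs (c * z) = cabs c * cabs z.
Proof. by apply: complexI; rewrite rmorphM/= -!cabsE normrM. Qed.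

Lemma cabsD c z : cabs (c + z) <= cabs c + cabs z.
Proof. by rewrite -lecR rmorphD/= -!cabsE ler_normD. Qed.

Lemma cabsN c : cabs (- c) = cabs c.
Proof. by rewrite /cabs normrN. Qed.

Lemma cabs_conj c : cabs (c^*%C) = cabs c.
Proof. by rewrite /cabs normcJ. Qed.

Lemma cabs_real (x : R) : cabs x%:C = `|x|.
Proof. by rewrite /cabs normc_def /= expr0n /= addr0 sqrtr_sqr. Qed.

Lemma cabs0 : cabs 0 = 0. Proof. by rewrite /cabs normr0. Qed.
Lemma cabs1 : cabs 1 = 1. Proof. by rewrite /cabs normr1. Qed.
Lemma cabsi : cabs 'i%C = 1.
Proof. by rewrite /cabs normc_def/= expr0n expr1n add0r sqrtr1. Qed.

Lemma conj_i : ('i%C : R[i])^*%C = - 'i%C.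
Proof. by apply/eqP; rewrite eq_complex /= oppr0 !eqxx. Qed.

Lemma cabs_eq0 c : cabs c = 0 -> c = 0.
Proof. by move=> h; apply/eqP; rewrite -normr_eq0 cabsE h. Qed.

Lemma Re_le_cabs c : `|complex.Re c| <= cabs c.
Proof. by rewrite -lecR -cabsE; exact: normc_ge_Re. Qed.

Lemma Im_le_cabs c : `|complex.Im c| <= cabs c.
Proof.
have := Re_le_cabs (c * 'i%C).
by rewrite ReiNIm normrN cabsM cabsi mulr1.
Qed.

Lemma cabs_le_ReIm c : cabs c <= `|complex.Re c| + `|complex.Im c|.
Proof.
rewrite {1}(complexE c); apply: le_trans (cabsD _ _) _.
by rewrite cabsM cabsi mul1r !cabs_real.
Qed.

Lemma cabsB c z : cabs (c - z) = cabs (z - c).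
Proof. by rewrite -cabsN opprB. Qed.

Lemma ReD c z : complex.Re (c + z) = complex.Re c + complex.Re z.
Proof. by case: c z => [a b] [e f]. Qed.
Lemma ImD c z : complex.Im (c + z) = complex.Im c + complex.Im z.
Proof. by case: c z => [a b] [e f]. Qed.
Lemma ReN c : complex.Re (- c) = - complex.Re c. Proof. by case: c. Qed.
Lemma ImN c : complex.Im (- c) = - complex.Im c. Proof. by case: c. Qed.
Lemma ReB c z : complex.Re (c - z) = complex.Re c - complex.Re z.
Proof. by rewrite ReD ReN. Qed.
Lemma ReZ (x : R) c : complex.Re (x%:C * c) = x * complex.Re c.
Proof. by case: c => a b /=; rewrite mul0r subr0. Qed.
Lemma Re_conjc c : complex.Re (c^*%C) = complex.Re c. Proof. by case: c. Qed.
Lemma Re_sum (I : Type) (r : seq I) (F : I -> R[i]) :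
  complex.Re (\sum_(i <- r) F i) = \sum_(i <- r) complex.Re (F i).
Proof. by elim/big_rec2: _ => //= i x y _ <-; rewrite ReD. Qed.

Lemma cabs_sum (I : Type) (r : seq I) (F : I -> R[i]) :
  cabs (\sum_(i <- r) F i) <= \sum_(i <- r) cabs (F i).
Proof.
elim/big_rec2: _ => [|i x y _ h]; first by rewrite cabs0.
by apply: le_trans (cabsD _ _) _; rewrite lerD2l.
Qed.

Lemma cabs_le0_eq0 c : cabs c <= 0 -> c = 0.
Proof. by move=> h; apply: cabs_eq0; apply/le_anti; rewrite h cabs_ge0. Qed.

(* The discriminant argument behind every Cauchy-Schwarz inequality. *)
Lemma quad_ge0_discr (a b : R) z : 0 <= a -> 0 <= b ->
  (forall c, 0 <= a + 2 * complex.Re (c * z) + cabs c ^+ 2 * b) ->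
  cabs z ^+ 2 <= a * b.
Proof.
move=> a0 b0 h.
(* Testing with [c = - t z^*] makes [c z] real; [t = b^-1] is the minimum in [t]. *)
have key (t : R) : 0 <= a - 2 * t * cabs z ^+ 2 + t ^+ 2 * cabs z ^+ 2 * b.
  have := h (- (t%:C * z^*%C)); rewrite cabsN cabsM cabs_real cabs_conj.
  have -> : complex.Re (- (t%:C * z^*%C) * z) = - (t * cabs z ^+ 2).
    by rewrite mulNr ReN -mulrA ReZ [z^*%C * z]mulrC -cabs2E.
  rewrite exprMn real_normK ?num_real //; congr (0 <= _); ring.
have [b1|b1] := eqVneq b 0.
  rewrite b1 mulr0 leNgt; apply/negP => z0.
  (* For [b = 0] the expression is affine in [t], and this [t] gives it the value [-1]. *)
  have := key ((a + 1) / (2 * cabs z ^+ 2)); rewrite b1 mulr0 addr0.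
  have -> : 2 * ((a + 1) / (2 * cabs z ^+ 2)) * cabs z ^+ 2 = a + 1.
    by field; move: z0; rewrite exprn_even_gt0.
  by lra.
have bp : 0 < b by rewrite lt_def b1.
have := key b^-1; have -> : b^-1 ^+ 2 * cabs z ^+ 2 * b = b^-1 * cabs z ^+ 2.
  by field.
rewrite -(ler_pM2r bp) mul0r.
have -> : (a - 2 * b^-1 * cabs z ^+ 2 + b^-1 * cabs z ^+ 2) * b = a * b - cabs z ^+ 2.
  by field.
by rewrite subr_ge0.
Qed.

End ComplexModulus.

Section HilbertBasics.
Context {R : realType} (H : hilbertType R).
Implicit Types (x y z : H) (c : R[i]).

Lemma hdotDl x y z : hdot (x + y) z = hdot x z + hdot y z.
Proof. exact: linearDl. Qed.
Lemma hdotDr x y z : hdot z (x + y) = hdot z x + hdot z y.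
Proof. exact: linearDr. Qed.
Lemma hdotZl c x y : hdot (c *: x) y = c * hdot x y.
Proof. exact: linearZl_LR. Qed.
Lemma hdotZr c x y : hdot x (c *: y) = c^*%C * hdot x y.
Proof. exact: linearZr_LR. Qed.
Lemma hdot0l x : hdot 0 x = 0. Proof. exact: linear0l. Qed.
Lemma hdot0r x : hdot x 0 = 0. Proof. exact: linear0r. Qed.
Lemma hdotNl x y : hdot (- x) y = - hdot x y. Proof. exact: linearNl. Qed.
Lemma hdotNr x y : hdot x (- y) = - hdot x y. Proof. exact: linearNr. Qed.
Lemma hdotBl x y z : hdot (x - y) z = hdot x z - hdot y z.
Proof. by rewrite hdotDl hdotNl. Qed.
Lemma hdotBr x y z : hdot z (x - y) = hdot z x - hdot z y.
Proof. by rewrite hdotDr hdotNr. Qed.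
Lemma hdotC x y : hdot x y = (hdot y x)^*%C.
Proof. by rewrite [LHS]hermC expr0 mul1r. Qed.
Lemma hdot_suml (I : Type) (r : seq I) (F : I -> H) y :
  hdot (\sum_(i <- r) F i) y = \sum_(i <- r) hdot (F i) y.
Proof. by elim/big_rec2: _ => [|i u v _ <-]; rewrite ?hdot0l ?hdotDl. Qed.
Lemma hdot_sumr (I : Type) (r : seq I) (F : I -> H) y :
  hdot y (\sum_(i <- r) F i) = \sum_(i <- r) hdot y (F i).
Proof. by elim/big_rec2: _ => [|i u v _ <-]; rewrite ?hdot0r ?hdotDr. Qed.

Lemma normE x : `|x| = (rnorm x)%:C.
Proof.
rewrite /rnorm; have : 0 <= `|x| by [].
by rewrite lecE => /andP[/eqP h _]; case: `|x| h => a b /= ->.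
Qed.

Lemma rnorm_ge0 x : 0 <= rnorm x. Proof. by rewrite -ler0c -normE. Qed.
Lemma rnorm0 : rnorm (0 : H) = 0. Proof. by rewrite /rnorm normr0. Qed.
Lemma rnorm_eq0 x : rnorm x = 0 -> x = 0.
Proof. by move=> h; apply/eqP; rewrite -normr_eq0 normE h. Qed.
Lemma rnorm_le0 x : rnorm x <= 0 -> x = 0.
Proof. by move=> h; apply: rnorm_eq0; apply/le_anti; rewrite h rnorm_ge0. Qed.
Lemma rnormD x y : rnorm (x + y) <= rnorm x + rnorm y.
Proof. by rewrite -lecR rmorphD/= -!normE ler_normD. Qed.
Lemma rnormN x : rnorm (- x) = rnorm x.
Proof. by rewrite /rnorm normrN. Qed.
Lemma rnormB x y : rnorm (x - y) = rnorm (y - x).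
Proof. by rewrite -rnormN opprB. Qed.
Lemma rnormZ c x : rnorm (c *: x) = cabs c * rnorm x.
Proof. by apply: complexI; rewrite rmorphM/= -normE -cabsE normrZ -normE. Qed.

Lemma hdot_rnorm x : hdot x x = (rnorm x ^+ 2)%:C.
Proof. by rewrite -hdot_norm normE rmorphXn. Qed.

Lemma rnorm2E x : rnorm x ^+ 2 = complex.Re (hdot x x).
Proof. by rewrite hdot_rnorm. Qed.

Lemma rnorm2D x y :
  rnorm (x + y) ^+ 2 = rnorm x ^+ 2 + 2 * complex.Re (hdot x y) + rnorm y ^+ 2.
Proof.
rewrite !rnorm2E hdotDl !hdotDr !ReD (hdotC y x) Re_conjc; ring.
Qed.

Lemma rnorm2B x y :
  rnorm (x - y) ^+ 2 = rnorm x ^+ 2 - 2 * complex.Re (hdot x y) + rnorm y ^+ 2.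
Proof. by rewrite rnorm2D rnormN hdotNr ReN mulrN. Qed.

Lemma hdot_le x y : cabs (hdot x y) <= rnorm x * rnorm y.
Proof.
rewrite -(@ler_pXn2r _ 2) ?nnegrE ?mulr_ge0 ?cabs_ge0 ?rnorm_ge0 //.
rewrite exprMn; apply: quad_ge0_discr; rewrite ?sqr_ge0 // => c.
have := rnorm2D x (c^*%C *: y); rewrite hdotZr conjcK rnormZ cabs_conj exprMn => <-.
exact: sqr_ge0.
Qed.

Lemma Re_hdot_le x y : complex.Re (hdot x y) <= rnorm x * rnorm y.
Proof. exact: le_trans (ler_norm _) (le_trans (Re_le_cabs _) (hdot_le _ _)). Qed.

Lemma nbhs_rnormP x (S : set H) :
  nbhs x S <-> exists2 e : R, 0 < e & forall y, rnorm (x - y) < e -> S y.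
Proof.
split=> [/nbhs_ballP[e e0 h]|[e e0 h]].
  have er : e = (complex.Re e)%:C by rewrite RRe_real // gtr0_real.
  exists (complex.Re e); first by rewrite -ltcR -er.
  move=> y xy; apply: h; rewrite -ball_normE /= er normE ltcR; exact: xy.
apply/nbhs_ballP; exists e%:C; first by rewrite /= ltcR.
move=> y; rewrite -ball_normE /= normE ltcR; exact: h.
Qed.

Lemma eq_hdotr x y : (forall z, hdot z x = hdot z y) -> x = y.
Proof.
move=> h; apply/eqP; rewrite -subr_eq0; apply/eqP; apply: rnorm_eq0.
apply/eqP; rewrite -sqrf_eq0 rnorm2E hdotBr.
by rewrite h subrr.
Qed.

Lemma eq_hdotl x y : (forall z, hdot x z = hdot y z) -> x = y.
Proof. by move=> h; apply: eq_hdotr => z; rewrite hdotC h -hdotC. Qed.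

Lemma hilbert_complete (u : nat -> H) :
  (forall e : R, 0 < e -> exists N, forall n m, (N <= n)%N -> (N <= m)%N ->
     rnorm (u n - u m) < e) ->
  exists x, forall e : R, 0 < e -> exists N, forall n, (N <= n)%N -> rnorm (x - u n) < e.
Proof.
move=> h.
have : cauchy (u @ \oo).
  apply/cauchyP => e e0.
  have er : e = (complex.Re e)%:C by rewrite RRe_real // gtr0_real.
  have [|N hN] := h (complex.Re e); first by rewrite -ltcR -er.
  exists (u N); exists N => //= n /= Nn.
  by rewrite -ball_normE /= er normE ltcR; apply: hN.
move=> /cauchy_cvg /cvg_ex[x ux]; exists x => e e0.
have : nbhs x [set y | rnorm (x - y) < e] by apply/nbhs_rnormP; exists e.
by move=> /ux [N _ hN]; exists N => n Nn; exact: hN.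
Qed.

End HilbertBasics.

Lemma inv_succ_lt {R : realType} (e : R) : 0 < e ->
  exists N, forall n, (N <= n)%N -> n.+1%:R^-1 < e.
Proof.
move=> e0; exists (Num.bound e^-1) => n hn.
rewrite invf_plt ?posrE ?ltr0n //.
apply: lt_le_trans (archi_boundP _) _; first by rewrite invr_ge0 ltW.
by rewrite ler_nat (leq_trans hn).
Qed.

(** The sign of [C] is free, so error terms can be collected into one coefficient without checking
    that it is nonnegative. *)
Lemma le_eps {R : realType} (a b C : R) :
  (forall e : R, 0 < e -> a <= b + C * e) -> a <= b.
Proof.
move=> h; apply/ler_addgt0Pr => e e0.
have C0 : 0 < `|C| + 1 by rewrite ltr_pwDr.
apply: le_trans (h (e / (`|C| + 1)) _) _; first by rewrite divr_gt0.
rewrite lerD2l mulrA ler_pdivrMr // [e * _]mulrC ler_pM2r //.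
by apply: le_trans (ler_norm _) _; rewrite lerDl.
Qed.

(** * Orthogonal projection, total families and the Riesz representation *)

Section HilbertGeometry.
Context {R : realType} (H : hilbertType R).
Implicit Types (x y z u : H) (c : R[i]).

Lemma closed_rnormP (M : set H) :
  closed M <-> forall x, (forall e : R, 0 < e -> exists2 m, M m & rnorm (x - m) < e) -> M x.
Proof.
split=> h x hx.
  apply: h => B /nbhs_rnormP[e e0 hB].
  by have [m Mm xm] := hx e e0; exists m; split=> //; apply: hB.
apply: h => e e0.
have /hx [m [Mm xm]] : nbhs x [set y | rnorm (x - y) < e] by apply/nbhs_rnormP; exists e.
by exists m.
Qed.

Lemma parallelogram x y :
  rnorm (x + y) ^+ 2 + rnorm (x - y) ^+ 2 = 2 * (rnorm x ^+ 2 + rnorm y ^+ 2).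
Proof. by rewrite rnorm2D rnorm2B; ring. Qed.

Lemma subspaceB (M : set H) x y : subspace M -> M x -> M y -> M (x - y).
Proof.
move=> [_ h] Mx My; have := h (-1) y x My Mx.
by rewrite scaleN1r addrC.
Qed.

Lemma subspaceZ (M : set H) c x : subspace M -> M x -> M (c *: x).
Proof. by move=> [M0 h] Mx; rewrite -[_ *: _]addr0; exact: h. Qed.

Lemma orthogonal_projection (M : set H) x : subspace M -> closed M ->
  exists2 m, M m & forall y, M y -> hdot (x - m) y = 0.
Proof.
move=> Ms Mc; have [M0 MD] := Ms.
pose D := [set rnorm (x - m) ^+ 2 | m in M].
have D0 : lbound D 0 by move=> _ [m _ <-]; exact: sqr_ge0.
have Di : has_inf D by split; [exists (rnorm (x - 0) ^+ 2); exists 0|exists 0].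
set d := inf D.
have dle m : M m -> d <= rnorm (x - m) ^+ 2.
  by move=> Mm; apply: ge_inf; [exists 0|exists m].
have /choice[f hf] (n : nat) : exists m, M m /\ rnorm (x - m) ^+ 2 < d + n.+1%:R^-1.
  have n0 : 0 < n.+1%:R^-1 :> R by rewrite invr_gt0 ltr0n.
  by have [_ [m Mm <-] hm] := inf_adherent n0 Di; exists m.
have fC n k : rnorm (f n - f k) ^+ 2 <= 2 * (n.+1%:R^-1 + k.+1%:R^-1).
  have [[Mn hn] [Mk hk]] := (hf n, hf k).
  (* The midpoint of [f n] and [f k] lies in [M], so its squared distance to [x] is at least [d];
     the parallelogram law then makes the minimising sequence Cauchy. *)
  have := parallelogram (x - f n) (x - f k).
  have -> : x - f n + (x - f k) = 2%:C *: (x - 2%:C^-1 *: (f n + f k)).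
    rewrite scalerBr scalerA mulfV ?scale1r; last by rewrite eq_complex /= pnatr_eq0.
    rewrite (_ : 2%:C = 1 + 1) ?scalerDl ?scale1r; last by rewrite -[2]/(1 + 1) rmorphD.
    by rewrite opprD addrACA.
  have -> : x - f n - (x - f k) = f k - f n by rewrite opprB addrC addrA subrK.
  rewrite rnormZ cabs_real exprMn [rnorm (f k - f n)]rnormB.
  have : d <= rnorm (x - 2%:C^-1 *: (f n + f k)) ^+ 2.
    by apply: dle; rewrite scalerDr; apply: (MD) => //; exact: subspaceZ.
  rewrite ger0_norm // (_ : 2 ^+ 2 = 4 :> R); last by rewrite -natrX.
  by move: (n.+1%:R^-1) (k.+1%:R^-1) hn hk => a b; lra.
have [e e0|m hm] := hilbert_complete (u := f).
  have [|N hN] := @inv_succ_lt R (e ^+ 2 / 4); first by rewrite divr_gt0 ?exprn_gt0.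
  exists N => n k Nn Nk.
  rewrite -(@ltr_pXn2r _ 2) ?nnegrE ?rnorm_ge0 ?(ltW e0) //.
  apply: le_lt_trans (fC _ _) _; have := hN n Nn; have := hN k Nk.
  by move: (n.+1%:R^-1) (k.+1%:R^-1) => a b; lra.
have Mm : M m.
  apply: (closed_rnormP M).1 => // e e0.
  by have [N hN] := hm e e0; exists (f N); [case: (hf N)|exact: hN].
exists m => // y My.
have dm : rnorm (x - m) ^+ 2 <= d.
  (* The square is expanded around [f N]; [e1 <= 1] turns products of two errors into multiples of
     [e], and these add up to the coefficient. *)
  apply: (@le_eps _ _ _ (4 + 2 * rnorm (x - m))) => e e0.
  pose e1 := Num.min e 1.
  have e10 : 0 < e1 by rewrite lt_min e0 ltr01.
  have [N1 h1] := hm _ e10; have [N2 h2] := inv_succ_lt e10.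
  pose N := maxn N1 N2.
  have := h1 N (leq_maxl _ _); have := h2 N (leq_maxr _ _).
  have [_ hN] := hf N; move=> a1 a2.
  have e1e : e1 <= e by rewrite ge_min lexx.
  have e11 : e1 <= 1 by rewrite ge_min lexx orbT.
  have := rnorm2D (x - f N) (f N - m); rewrite addrA subrK.
  have b1 := Re_hdot_le (x - f N) (f N - m).
  rewrite (rnormB (f N)) in b1 *.
  have b2 : rnorm (x - f N) <= rnorm (x - m) + rnorm (m - f N).
    by apply: le_trans (rnormD _ _); rewrite addrA subrK.
  have b3 := rnorm_ge0 (m - f N); have b4 := rnorm_ge0 (x - m).
  have b5 := rnorm_ge0 (x - f N).
  have b6 : rnorm (x - f N) * rnorm (m - f N) <= (rnorm (x - m) + e1) * e1.
    by apply: ler_pM => //; [apply: le_trans b2 _; rewrite lerD2l ltW|rewrite ltW].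
  have b7 : rnorm (m - f N) ^+ 2 <= e1 * e1.
    by rewrite expr2; apply: ler_pM => //; exact: ltW.
  have b8 : e1 * e1 <= e1 by rewrite ler_piMr // ltW.
  have b9 : rnorm (x - m) * e1 <= rnorm (x - m) * e by rewrite ler_wpM2l.
  by move: (N.+1%:R^-1) a1 hN => a a1 hN; lra.
(* Minimality at [m + c^* y] is a quadratic inequality with zero constant term, so the discriminant
   bound makes the inner product vanish. *)
have key c : 0 <= 0 + 2 * complex.Re (c * - hdot (x - m) y) + cabs c ^+ 2 * rnorm y ^+ 2.
  have := dle (m + c^*%C *: y); rewrite addrC => /(_ (MD _ _ _ My Mm)).
  rewrite [_ + m]addrC opprD addrA => /(le_trans dm).
  rewrite [rnorm (x - m - _) ^+ 2]rnorm2B hdotZr conjcK rnormZ cabs_conj mulrN ReN exprMn; lra.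
have := quad_ge0_discr (lexx 0) (sqr_ge0 (rnorm y)) key.
rewrite mul0r cabsN => h; apply: cabs_eq0; apply/eqP; rewrite -sqrf_eq0.
by apply/eqP/le_anti; rewrite h sqr_ge0.
Qed.

Section Combinations.
Context {I : Type} (s : I -> H).

(** A formal combination is a list, possibly with repetitions, so that linear dependence among the
    [s i] never has to be resolved. *)
Definition comb (l : seq (R[i] * I)) : H := \sum_(p <- l) p.1 *: s p.2.

(** Encoded by a trivial orthogonal complement, the form in which it is checked below; [comb_dense]
    recovers density of the span. *)
Definition total : Prop := forall u, (forall i, hdot (s i) u = 0) -> u = 0.

Definition scale_seq c (l : seq (R[i] * I)) := [seq (c * p.1, p.2) | p <- l].

Lemma comb_cat l1 l2 : comb (l1 ++ l2) = comb l1 + comb l2.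
Proof. by rewrite /comb big_cat. Qed.

Lemma comb_scale c l : comb (scale_seq c l) = c *: comb l.
Proof.
rewrite /comb big_map scaler_sumr; apply: eq_bigr => p _.
by rewrite scalerA.
Qed.

Lemma comb1 i : comb [:: (1, i)] = s i.
Proof. by rewrite /comb big_seq1 scale1r. Qed.

(** The closure [M] of the span admits a projection, and [u] minus its projection is orthogonal to
    every [s i]. *)
Lemma comb_dense : total ->
  forall u (e : R), 0 < e -> exists l, rnorm (u - comb l) < e.
Proof.
move=> tot u.
pose M := [set x | forall e : R, 0 < e -> exists l, rnorm (x - comb l) < e].
have Ms : subspace M.
  split=> [e e0|c x y Mx My e e0].
    by exists [::]; rewrite /comb big_nil subr0 rnorm0.
  have C0 : 0 < cabs c + 1 by rewrite ltr_pwDr // cabs_ge0.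
  have [|l1 h1] := Mx (e / 2 / (cabs c + 1)); first by rewrite !divr_gt0.
  have [|l2 h2] := My (e / 2); first by rewrite divr_gt0.
  exists (scale_seq c l1 ++ l2); rewrite comb_cat comb_scale.
  rewrite opprD addrACA -scalerBr; apply: le_lt_trans (rnormD _ _) _.
  rewrite rnormZ; have := rnorm_ge0 (x - comb l1); have := cabs_ge0 c.
  by move: h1; rewrite ltr_pdivlMr // => h1 c0 r0; nra.
have Mc : closed M.
  apply/closed_rnormP => x hx e e0.
  have [|m Mm xm] := hx (e / 2); first by rewrite divr_gt0.
  have [|l ml] := Mm (e / 2); first by rewrite divr_gt0.
  exists l; have := rnormD (x - m) (m - comb l); rewrite addrA subrK; lra.
have [m Mm hm] := orthogonal_projection u Ms Mc.
suff /eqP : u - m = 0 by rewrite subr_eq0 => /eqP ->.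
apply: tot => i; rewrite hdotC hm ?conjc0 // => e e0.
by exists [:: (1, i)]; rewrite comb1 subrr rnorm0.
Qed.

End Combinations.

Lemma riesz (f : H -> R[i]) (C : R) :
  (forall c x y, f (c *: x + y) = c * f x + f y) ->
  (forall x, cabs (f x) <= C * rnorm x) -> exists v, forall x, f x = hdot x v.
Proof.
move=> fl fb.
have f0 : f 0 = 0.
  by have := fl (-1) 0 0; rewrite scaler0 addr0 mulN1r addrC subrr.
have fD x y : f (x + y) = f x + f y.
  by have := fl 1 x y; rewrite scale1r mul1r.
have fZ c x : f (c *: x) = c * f x.
  by have := fl c x 0; rewrite !addr0 f0 addr0.
have fB x y : f (x - y) = f x - f y by rewrite fD -scaleN1r fZ mulN1r.
have [fz|/existsNP[u0 /eqP u0n]] := pselect (forall x, f x = 0).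
  by exists 0 => x; rewrite hdot0r fz.
pose M := [set x | f x = 0].
have Ms : subspace M by split=> // c x y; rewrite /M /= => Mx My; rewrite fl Mx My mulr0 addr0.
have Mc : closed M.
  apply/closed_rnormP => x hx; apply: cabs_le0_eq0.
  apply: (@le_eps _ _ _ C) => e e0; rewrite add0r.
  have [m /= Mm xm] := hx e e0.
  have := fb (x - m); rewrite fB Mm subr0 => /le_trans; apply.
  have [C0|C0] := leP 0 C; first by rewrite ler_wpM2l // ltW.
  have := fb u0; have : 0 < cabs (f u0).
    rewrite lt_def cabs_ge0 andbT; apply: contra u0n => /eqP h.
    by apply/eqP; exact: cabs_eq0.
  have := rnorm_ge0 u0; nra.
have [m Mm hm] := orthogonal_projection u0 Ms Mc.
set z := u0 - m in hm.
have fz : f z != 0 by rewrite fB Mm subr0.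
have zz : hdot z z != 0.
  apply: contra fz => /eqP; rewrite hdot_rnorm => /(@complexI _ _ 0)/eqP.
  by rewrite sqrf_eq0 => /eqP/rnorm_eq0 ->; rewrite f0.
(* [x - (f x / f z) z] lies in the kernel of [f], to which [z] is orthogonal; evaluation at [z]
   fixes the scalar factor. *)
exists ((f z / hdot z z)^*%C *: z) => x.
rewrite hdotZr conjcK.
have : M (x - (f x / f z) *: z) by rewrite /M /= fB fZ divfK // subrr.
move=> /hm /(congr1 conjc); rewrite -hdotC hdotBl hdotZl conjc0 => /eqP.
rewrite subr_eq0 => /eqP ->; field; by rewrite fz zz.
Qed.

Lemma total_eq {I : Type} (s : I -> H) x y :
  total s -> (forall i, hdot (s i) x = hdot (s i) y) -> x = y.
Proof.
move=> tot h; apply/eqP; rewrite -subr_eq0; apply/eqP/tot => i.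
by rewrite hdotBr h subrr.
Qed.

End HilbertGeometry.

(** * Adjoints, and extension of operators from total families *)

Section Operators.
Context {R : realType}.

(** Linearity comes with the adjoint, which is why [linked] can be stated for plain functions. *)
Lemma linear_adj (H1 H2 : hilbertType R) (T : H1 -> H2) (T' : H2 -> H1) :
  (forall u v, hdot (T u) v = hdot u (T' v)) -> linear T.
Proof.
move=> h c x y; apply: eq_hdotl => v.
by rewrite h !hdotDl !hdotZl !h.
Qed.

Lemma hdot_adjC (H1 H2 : hilbertType R) (T : H1 -> H2) (T' : H2 -> H1) :
  (forall u v, hdot (T u) v = hdot u (T' v)) ->
  forall v u, hdot (T' v) u = hdot v (T u).
Proof. by move=> h v u; rewrite hdotC -h -hdotC. Qed.

Lemma bounded_adj (H1 H2 : hilbertType R) (T : H1 -> H2) (C : R) :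
  linear T -> (forall u, rnorm (T u) <= C * rnorm u) ->
  exists T' : H2 -> H1, forall u v, hdot (T u) v = hdot u (T' v).
Proof.
move=> Tl Tb.
have /choice[T' hT'] (v : H2) : exists w : H1, forall u, hdot (T u) v = hdot u w.
  apply: (@riesz _ _ _ (C * rnorm v)) => [c x y|x].
    by rewrite Tl hdotDl hdotZl.
  apply: le_trans (hdot_le _ _) _.
  by rewrite mulrAC ler_wpM2r ?rnorm_ge0.
by exists T' => u v.
Qed.

Section Extension.
Context {I : Type} (H1 H2 : hilbertType R) (s1 : I -> H1) (s2 : I -> H2) (M : R).
Hypothesis s1_total : total s1.
Hypothesis s2_bounded : forall l, rnorm (comb s2 l) <= M * rnorm (comb s1 l).

(** The closure of the relation between [comb s1 l] and [comb s2 l]. The bound makes it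
    single-valued and completeness makes it everywhere defined, with no span type and no choice of a
    basis. *)
Let graph u v := forall e : R, 0 < e ->
  exists l, rnorm (u - comb s1 l) < e /\ rnorm (v - comb s2 l) < e.

Let graph_comb l : graph (comb s1 l) (comb s2 l).
Proof. by move=> e e0; exists l; rewrite !subrr !rnorm0. Qed.

Let graph_bound u v : graph u v -> rnorm v <= `|M| * rnorm u.
Proof.
move=> h; apply: (@le_eps _ _ _ (`|M| + 1)) => e e0.
have [l [h1 h2]] := h e e0.
have h3 := rnormD (v - comb s2 l) (comb s2 l).
have h4 := rnormD (- (u - comb s1 l)) u.
rewrite subrK in h3; rewrite rnormN opprB subrK in h4.
have h5 := s2_bounded l; have h6 := ler_norm M; have h7 := rnorm_ge0 (comb s1 l).
have : M * rnorm (comb s1 l) <= `|M| * rnorm (comb s1 l) by rewrite ler_wpM2r.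
have : `|M| * rnorm (comb s1 l) <= `|M| * (e + rnorm u).
  by rewrite ler_wpM2l // (le_trans h4) // lerD2r ltW.
lra.
Qed.

Let graph_linear c u v u' v' :
  graph u v -> graph u' v' -> graph (c *: u + u') (c *: v + v').
Proof.
move=> h h' e e0.
have C0 : 0 < cabs c + 1 by rewrite ltr_pwDr // cabs_ge0.
have [|l [h1 h2]] := h (e / 2 / (cabs c + 1)); first by rewrite !divr_gt0.
have [|l' [h1' h2']] := h' (e / 2); first by rewrite divr_gt0.
exists (scale_seq c l ++ l'); rewrite !comb_cat !comb_scale !opprD.
move: h1 h2; rewrite !ltr_pdivlMr // => h1 h2.
split; rewrite addrACA -scalerBr; apply: le_lt_trans (rnormD _ _) _; rewrite rnormZ.
  have := rnorm_ge0 (u - comb s1 l); have := cabs_ge0 c; nra.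
have := rnorm_ge0 (v - comb s2 l); have := cabs_ge0 c; nra.
Qed.

Let graph_uniq u v v' : graph u v -> graph u v' -> v = v'.
Proof.
move=> h h'; have := graph_linear (-1) h' h; rewrite !scaleN1r => /graph_bound.
rewrite addNr rnorm0 mulr0 => /rnorm_le0 /eqP.
by rewrite addrC subr_eq0 => /eqP.
Qed.

Let graph_ex u : exists v, graph u v.
Proof.
have /choice[f hf] (n : nat) : exists l, rnorm (u - comb s1 l) < n.+1%:R^-1.
  by apply: comb_dense => //; rewrite invr_gt0 ltr0n.
have fC n k : rnorm (comb s2 (f n) - comb s2 (f k)) <= `|M| * (n.+1%:R^-1 + k.+1%:R^-1).
  have := @graph_linear (-1) _ _ _ _ (@graph_comb (f k)) (@graph_comb (f n)).
  rewrite !scaleN1r ![- _ + _]addrC => /graph_bound /le_trans; apply.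
  rewrite ler_wpM2l //; have := hf n; have := hf k.
  move: (n.+1%:R^-1) (k.+1%:R^-1) => a b.
  have := rnormD (- (u - comb s1 (f n))) (u - comb s1 (f k)).
  by rewrite rnormN opprB addrA subrK; lra.
have [e e0|v hv] := hilbert_complete (u := fun n => comb s2 (f n)).
  have C0 : 0 < 2 * (`|M| + 1) by rewrite mulr_gt0 // ltr_pwDr.
  have [|N hN] := @inv_succ_lt R (e / (2 * (`|M| + 1))); first by rewrite divr_gt0.
  exists N => n k Nn Nk; apply: le_lt_trans (fC n k) _.
  have := hN n Nn; have := hN k Nk; rewrite !ltr_pdivlMr //.
  have : 0 <= `|M| by []. have : 0 < n.+1%:R^-1 :> R by rewrite invr_gt0 ltr0n.
  have : 0 < k.+1%:R^-1 :> R by rewrite invr_gt0 ltr0n.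
  move: (n.+1%:R^-1) (k.+1%:R^-1) => a b.
  nra.
exists v => e e0; have [N1 h1] := inv_succ_lt e0; have [N2 h2] := hv e e0.
exists (f (maxn N1 N2)); split; last by apply: h2; exact: leq_maxr.
by apply: lt_trans (hf _) (h1 _ _); exact: leq_maxl.
Qed.

Lemma total_extension : exists T : H1 -> H2,
  [/\ linear T, forall i, T (s1 i) = s2 i & forall u, rnorm (T u) <= M * rnorm u].
Proof.
have /choice[T hT] := graph_ex.
exists T; split.
- move=> c x y; apply: (graph_uniq (hT _)); exact: graph_linear.
- by move=> i; apply: (graph_uniq (hT _)); rewrite -(comb1 s1) -(comb1 s2).
- move=> u; apply: (@le_eps _ _ _ (`|M| + 1)) => e e0.
  have [l [h1 h2]] := hT u e e0.
  have h3 := rnormD (T u - comb s2 l) (comb s2 l); rewrite subrK in h3.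
  have h4 := s2_bounded l.
  (* [M] may be negative, so replacing [comb s1 l] by [u] is estimated with its absolute value. *)
  have h5 : M * (rnorm (comb s1 l) - rnorm u) <= `|M| * e.
    apply: le_trans (ler_norm _) _; rewrite normrM ler_wpM2l //.
    have a1 := rnormD (u - comb s1 l) (comb s1 l).
    have a2 := rnormD (- (u - comb s1 l)) u.
    rewrite subrK in a1; rewrite rnormN opprB subrK in a2.
    by rewrite ler_norml; apply/andP; split; lra.
  lra.
Qed.

End Extension.

End Operators.

Lemma complex_complete {R : realType} (u : nat -> R[i]) :
  (forall e : R, 0 < e -> exists N, forall n m, (N <= n)%N -> (N <= m)%N ->
     cabs (u n - u m) < e) ->
  exists z, forall e : R, 0 < e -> exists N, forall n, (N <= n)%N -> cabs (z - u n) < e.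
Proof.
move=> h.
have real_lim (f : R[i] -> R) : (forall a b, `|f a - f b| <= cabs (a - b)) ->
    exists x : R, forall e : R, 0 < e -> exists N, forall n, (N <= n)%N -> `|x - f (u n)| < e.
  move=> fP; have : cauchy ((f \o u) @ \oo).
    apply/cauchyP => e e0; have [N hN] := h e e0.
    exists (f (u N)); exists N => //= n /= Nn; apply: le_lt_trans (fP _ _) _.
    exact: hN.
  move=> /cauchy_cvg /cvg_ex[x /cvgrPdist_lt ux]; exists x => e e0.
  by have [N _ hN] := ux e e0; exists N => n Nn; exact: hN.
have [x hx] : exists x : R, forall e : R, 0 < e ->
    exists N, forall n, (N <= n)%N -> `|x - complex.Re (u n)| < e.
  by apply: real_lim => a b; rewrite -ReB; exact: Re_le_cabs.
have [y hy] : exists y : R, forall e : R, 0 < e ->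
    exists N, forall n, (N <= n)%N -> `|y - complex.Im (u n)| < e.
  by apply: real_lim => a b; rewrite -ImN -ImD; exact: Im_le_cabs.
exists (x +i* y) => e e0.
have [|N1 h1] := hx (e / 2); first by rewrite divr_gt0.
have [|N2 h2] := hy (e / 2); first by rewrite divr_gt0.
exists (maxn N1 N2) => n; rewrite geq_max => /andP[n1 n2].
apply: le_lt_trans (cabs_le_ReIm _) _; rewrite ReD ReN ImD ImN /=.
have := h1 n n1; have := h2 n n2; lra.
Qed.

(** * Kolmogorov decomposition of positive semi-definite kernels *)

Section KernelForm.
Context {R : realType} {S : Type}.
Implicit Types (l m : seq (R[i] * S)).

(** The inner product of two formal combinations of generators with Gram matrix [k]. *)
Definition kform (k : S -> S -> R[i]) l m : R[i] :=
  \sum_(p <- l) \sum_(q <- m) p.1 * (q.1)^*%C * k p.2 q.2.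

Record psd_kernel := PsdKernel {
  kernel_fun :> S -> S -> R[i];
  kernel_herm : forall s t, kernel_fun s t = (kernel_fun t s)^*%C;
  kernel_pos : forall l, 0 <= complex.Re (kform kernel_fun l l)
}.

Lemma kform_scalel (k : S -> S -> R[i]) c l m : kform k (scale_seq c l) m = c * kform k l m.
Proof.
rewrite /kform big_map mulr_sumr; apply: eq_bigr => p _.
by rewrite mulr_sumr; apply: eq_bigr => q _ /=; rewrite !mulrA.
Qed.

Lemma kform_catl (k : S -> S -> R[i]) l l' m : kform k (l ++ l') m = kform k l m + kform k l' m.
Proof. by rewrite /kform big_cat. Qed.

Variable k : psd_kernel.
Implicit Types (F G : S -> R[i]).

Local Notation form := (kform k).

Lemma kformC l m : form l m = (form m l)^*%C.
Proof.
rewrite /kform rmorph_sum exchange_big; apply: eq_bigr => q _ /=.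
rewrite rmorph_sum; apply: eq_bigr => p _ /=.
by rewrite !rmorphM /= conjcK -kernel_herm [_^*%C * _]mulrC.
Qed.

Lemma kform_catr l m m' : form l (m ++ m') = form l m + form l m'.
Proof. by rewrite kformC kform_catl rmorphD /= -!kformC. Qed.

Lemma kform_scaler c l m : form l (scale_seq c m) = c^*%C * form l m.
Proof. by rewrite kformC kform_scalel rmorphM /= -kformC. Qed.

Definition kdiff l m := l ++ scale_seq (-1) m.

Lemma kform_diffl l l' m : form (kdiff l l') m = form l m - form l' m.
Proof. by rewrite kform_catl kform_scalel mulN1r. Qed.

Lemma kform_diffr l m m' : form l (kdiff m m') = form l m - form l m'.
Proof. by rewrite kform_catr kform_scaler rmorphN rmorph1 mulN1r. Qed.

Definition knorm l : R := Num.sqrt (complex.Re (form l l)).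

Lemma knorm_ge0 l : 0 <= knorm l. Proof. exact: sqrtr_ge0. Qed.

Lemma knorm2 l : knorm l ^+ 2 = complex.Re (form l l).
Proof. by rewrite sqr_sqrtr // kernel_pos. Qed.

Lemma kform_real l : form l l = (knorm l ^+ 2)%:C.
Proof.
rewrite knorm2 {1}(complexE (form l l)).
suff -> : complex.Im (form l l) = 0 by rewrite mulr0 addr0.
have := congr1 (@complex.Im R) (kformC l l); case: (form l l) => a b /= h; lra.
Qed.

Lemma knorm2D l m : knorm (l ++ m) ^+ 2 =
  knorm l ^+ 2 + 2 * complex.Re (form l m) + knorm m ^+ 2.
Proof.
rewrite !knorm2 kform_catl !kform_catr !ReD (kformC m l) Re_conjc; ring.
Qed.

Lemma knorm_scale c l : knorm (scale_seq c l) = cabs c * knorm l.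
Proof.
apply/eqP; rewrite -(@eqrXn2 _ 2) ?mulr_ge0 ?knorm_ge0 ?cabs_ge0 //.
rewrite exprMn !knorm2 kform_scalel kform_scaler mulrA -cabs2E.
by rewrite ReZ.
Qed.

Lemma kform_le l m : cabs (form l m) <= knorm l * knorm m.
Proof.
rewrite -(@ler_pXn2r _ 2) ?nnegrE ?mulr_ge0 ?cabs_ge0 ?knorm_ge0 //.
rewrite exprMn; apply: quad_ge0_discr; rewrite ?sqr_ge0 // => c.
have := knorm2D l (scale_seq (c^*%C) m).
rewrite kform_scaler conjcK knorm_scale cabs_conj exprMn => <-; exact: sqr_ge0.
Qed.

(** If [F s] is read as the inner product of a vector with the generator [s], this is its inner
    product with the combination [m]. *)
Definition kpair F m : R[i] := \sum_(q <- m) (q.1)^*%C * F q.2.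

(** Distance at most [e] from [l] in the norm of functionals; it makes sense before any Hilbert
    space is built. *)
Definition kapprox F l (e : R) := forall m, cabs (kpair F m - form l m) <= e * knorm m.

Definition kapproximable F := forall e : R, 0 < e -> exists l, kapprox F l e.

Lemma kpair_lin c F G m : kpair (c *: F + G) m = c * kpair F m + kpair G m.
Proof.
rewrite /kpair mulr_sumr -big_split; apply: eq_bigr => q _ /=.
rewrite !fctE /=; rewrite mulrDr; congr (_ + _); exact: mulrCA.
Qed.

Lemma kapprox_le F l (d e : R) : d <= e -> kapprox F l d -> kapprox F l e.
Proof.
move=> de h m; apply: le_trans (h m) _.
by rewrite ler_wpM2r // knorm_ge0.
Qed.

Lemma kapprox_lin c F G l l' (d : R) : kapprox F l d -> kapprox G l' d ->
  kapprox (c *: F + G) (scale_seq c l ++ l') ((cabs c + 1) * d).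
Proof.
move=> h h' m; rewrite kpair_lin kform_catl kform_scalel opprD addrACA -mulrBr.
apply: le_trans (cabsD _ _) _; rewrite cabsM -mulrA mulrDl mul1r lerD //.
by rewrite ler_wpM2l ?cabs_ge0.
Qed.

Lemma le_sqr_factor (x y : R) : 0 <= x -> 0 <= y -> x ^+ 2 <= y * x -> x <= y.
Proof.
rewrite le0r => /orP[/eqP -> //|x0] y0.
by rewrite expr2 ler_pM2r.
Qed.

(** Testing both approximations against [m = l - l'] bounds [knorm m ^+ 2] by
    [(d + d') * knorm m]. *)
Lemma kapprox_diff F l l' (d d' : R) : 0 <= d -> 0 <= d' ->
  kapprox F l d -> kapprox F l' d' -> knorm (kdiff l l') <= d + d'.
Proof.
move=> d0 d0' h h'; set m := kdiff l l'.
apply: le_sqr_factor; rewrite ?knorm_ge0 ?addr_ge0 //.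
have : form m m = (kpair F m - form l' m) - (kpair F m - form l m).
  by rewrite {1}/m kform_diffl; ring.
rewrite kform_real => /(congr1 cabs); rewrite cabs_real ger0_norm ?sqr_ge0 // => ->.
apply: le_trans (cabsD _ _) _; rewrite cabsN mulrDl addrC.
by apply: lerD; [exact: h|exact: h'].
Qed.

Lemma knorm_diff l l' : knorm l <= knorm l' + knorm (kdiff l l').
Proof.
have [l0|] := eqVneq (knorm l) 0; first by rewrite l0 addr_ge0 ?knorm_ge0.
move=> l0; apply: le_sqr_factor; rewrite ?knorm_ge0 ?addr_ge0 ?knorm_ge0 //.
have : form l l = form l' l + form (kdiff l l') l by rewrite kform_diffl; ring.
rewrite kform_real => /(congr1 cabs); rewrite cabs_real ger0_norm ?sqr_ge0 // => ->.
apply: le_trans (cabsD _ _) _; rewrite mulrDl.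
by apply: lerD; exact: kform_le.
Qed.

(** Makes the values of the form on approximants a Cauchy family. Only the norms of [l] and [m]
    enter, that of [l'] being controlled by [kapprox_diff]. *)
Lemma kapprox_form F G l l' m m' (d d' : R) : 0 <= d -> 0 <= d' ->
  kapprox F l d -> kapprox F l' d' -> kapprox G m d -> kapprox G m' d' ->
  cabs (form l m - form l' m') <= (d + d') * (knorm l + knorm m + d + d').
Proof.
move=> d0 d0' hl hl' hm hm'.
have -> : form l m - form l' m' = form (kdiff l l') m + form l' (kdiff m m').
  by rewrite kform_diffl kform_diffr; ring.
apply: le_trans (cabsD _ _) _.
apply: le_trans (lerD (kform_le _ _) (kform_le _ _)) _.
have h1 := kapprox_diff d0 d0' hl hl'; have h2 := kapprox_diff d0 d0' hm hm'.
have h3 : knorm l' <= knorm l + (d + d').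
  apply: le_trans (knorm_diff l' l) _; rewrite lerD2l addrC.
  exact: (kapprox_diff d0' d0 hl' hl).
have h4 := knorm_ge0 m; have h5 := knorm_ge0 l'.
have h6 : knorm (kdiff l l') * knorm m <= (d + d') * knorm m by rewrite ler_wpM2r.
have h7 : knorm l' * knorm (kdiff m m') <= (knorm l + (d + d')) * (d + d').
  by apply: ler_pM; rewrite ?knorm_ge0.
lra.
Qed.

Definition kpred : {pred (S -> R[i])} := fun F => `[< kapproximable F >].

Fact kpred_submod_closed : submod_closed kpred.
Proof.
split=> [|c F G].
  apply/asboolP => e e0; exists [::] => m.
  rewrite /kform big_nil subr0 /kpair big1 ?cabs0 ?mulr_ge0 ?knorm_ge0 ?(ltW e0) //.
  by move=> q _; exact: mulr0.
move=> /asboolP hF /asboolP hG; apply/asboolP => e e0.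
have C0 : 0 < cabs c + 1 by rewrite ltr_pwDr // cabs_ge0.
have [|l hl] := hF (e / (cabs c + 1)); first by rewrite divr_gt0.
have [|m hm] := hG (e / (cabs c + 1)); first by rewrite divr_gt0.
exists (scale_seq c l ++ m); have := kapprox_lin c hl hm.
by rewrite mulrCA divff ?mulr1 // gt_eqF.
Qed.

HB.instance Definition _ :=
  GRing.isSubmodClosed.Build R[i] (S -> R[i]) kpred kpred_submod_closed.

(** The reproducing kernel space of [k], with functions in place of classes of Cauchy sequences.
    Null combinations give the zero function, so no quotient and no abstract completion is
    formed. *)
Record kspace := KSpace { kval : S -> R[i]; kvalP : kval \in kpred }.

HB.instance Definition _ := [isSub for kval].
HB.instance Definition _ := gen_eqMixin kspace.
HB.instance Definition _ := gen_choiceMixin kspace.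
HB.instance Definition _ := [SubChoice_isSubLmodule of kspace by <:].

Implicit Types (f g h : kspace).

Lemma kval_lin c f g : kval (c *: f + g) = c *: kval f + kval g.
Proof. by []. Qed.

Lemma kapproxP f (e : R) : 0 < e -> exists l, kapprox (kval f) l e.
Proof. by have /asboolP := kvalP f; apply. Qed.

Fact kdot_subproof f g : exists z, forall e : R, 0 < e ->
  exists2 d : R, 0 < d & forall l m, kapprox (kval f) l d -> kapprox (kval g) m d ->
    cabs (z - form l m) < e.
Proof.
have n0 n : 0 < n.+1%:R^-1 :> R by rewrite invr_gt0 ltr0n.
have n1 n : n.+1%:R^-1 <= 1 :> R by rewrite invf_le1 ?ltr0n // ler1n.
have /choice[l hl] (n : nat) := kapproxP f (n0 n).
have /choice[m hm] (n : nat) := kapproxP g (n0 n).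
(* Approximants within [1] exceed the norms of [l 0] and [m 0] by at most [2]; two such excesses and
   [d + d' <= 2] add up to [6]. *)
pose C := knorm (l 0%N) + knorm (m 0%N) + 6%:R.
have C0 : 0 < C by rewrite ltr_wpDl ?addr_ge0 ?knorm_ge0 // ltr0n.
have bnd F (a b : seq (R[i] * S)) (d : R) : 0 < d -> d <= 1 ->
    kapprox F a d -> kapprox F b 1 -> knorm a <= knorm b + 2.
  move=> d0 d1 ha hb; apply: le_trans (knorm_diff a b) _; rewrite lerD2l.
  by have := kapprox_diff (ltW d0) ler01 ha hb; lra.
have hl0 : kapprox (kval f) (l 0%N) 1 by have := hl 0%N; rewrite invr1.
have hm0 : kapprox (kval g) (m 0%N) 1 by have := hm 0%N; rewrite invr1.
have est (d d' : R) a a' b b' : 0 < d -> d <= 1 -> 0 < d' -> d' <= 1 ->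
   kapprox (kval f) a d -> kapprox (kval f) a' d' ->
   kapprox (kval g) b d -> kapprox (kval g) b' d' ->
   cabs (form a b - form a' b') <= (d + d') * C.
  move=> d0 d1 d0' d1' ha ha' hb hb'.
  apply: le_trans (kapprox_form (ltW d0) (ltW d0') ha ha' hb hb') _.
  rewrite ler_pM2l ?addr_gt0 // /C.
  by have := bnd _ _ _ _ d0 d1 ha hl0; have := bnd _ _ _ _ d0 d1 hb hm0; lra.
have [e e0|z hz] := complex_complete (u := fun n => form (l n) (m n)).
  have [|N hN] := @inv_succ_lt R (e / (2 * C)); first by rewrite divr_gt0 ?mulr_gt0.
  exists N => n i Nn Ni.
  apply: le_lt_trans (est _ _ _ _ _ _ (n0 n) (n1 n) (n0 i) (n1 i) _ _ _ _) _ => //.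
  have := hN n Nn; have := hN i Ni; rewrite !ltr_pdivlMr ?mulr_gt0 //.
  by move: (n.+1%:R^-1) (i.+1%:R^-1) => a b; lra.
(* Half of [e] is spent on the distance from [z] to the [n]-th term, a quarter each on [d * C] and
   on [C / (n + 1)]. *)
exists z => e e0; pose d := Num.min 1 (e / (4 * C)).
have d0 : 0 < d by rewrite lt_min ltr01 divr_gt0 ?mulr_gt0.
have d1 : d <= 1 by rewrite ge_min lexx.
have de : d <= e / (4 * C) by rewrite ge_min lexx orbT.
exists d => // a b ha hb.
have [|N1 h1] := @inv_succ_lt R (e / (4 * C)); first by rewrite divr_gt0 ?mulr_gt0.
have [|N2 h2] := hz (e / 2); first by rewrite divr_gt0.
pose n := maxn N1 N2.
have a1 := h1 n (leq_maxl _ _); have a2 := h2 n (leq_maxr _ _).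
have a3 := est _ _ _ _ _ _ d0 d1 (n0 n) (n1 n) ha (hl n) hb (hm n).
have := cabsD (z - form (l n) (m n)) (form (l n) (m n) - form a b).
rewrite addrA subrK [cabs (form (l n) _ - _)]cabsB => /le_lt_trans; apply.
move: de a1; rewrite ler_pdivlMr ?ltr_pdivlMr ?mulr_gt0 //.
by move: (n.+1%:R^-1) a3 => x; lra.
Qed.

Definition kdot f g : R[i] := projT1 (cid (kdot_subproof f g)).

Lemma kdotP f g (e : R) : 0 < e -> exists2 d : R, 0 < d & forall l m,
  kapprox (kval f) l d -> kapprox (kval g) m d -> cabs (kdot f g - form l m) < e.
Proof. by rewrite /kdot; case: cid => z /= hz; exact: hz. Qed.

Lemma cabs_small_eq0 (z : R[i]) (C : R) : (forall e : R, 0 < e -> cabs z <= C * e) -> z = 0.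
Proof.
by move=> h; apply: cabs_le0_eq0; apply: (@le_eps _ _ _ C) => e e0; rewrite add0r h.
Qed.

Lemma kdot_linl c f f' g : kdot (c *: f + f') g = c * kdot f g + kdot f' g.
Proof.
apply/eqP; rewrite -subr_eq0; apply/eqP; apply: (@cabs_small_eq0 _ (cabs c + 2)) => e e0.
have [d1 d10 h1] := kdotP (c *: f + f') g e0.
have [d2 d20 h2] := kdotP f g e0; have [d3 d30 h3] := kdotP f' g e0.
have C0 : 0 < cabs c + 1 by rewrite ltr_pwDr // cabs_ge0.
(* The combination approximates [c f + f'] only within [(cabs c + 1) * d], hence the last entry of
   the minimum. *)
pose d := Num.min (Num.min d2 d3) (Num.min d1 (d1 / (cabs c + 1))).
have d0 : 0 < d by rewrite !lt_min d10 d20 d30 divr_gt0.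
have [l hl] := kapproxP f d0; have [l' hl'] := kapproxP f' d0; have [m hm] := kapproxP g d0.
have /h1 : kapprox (kval (c *: f + f')) (scale_seq c l ++ l') d1.
  apply: kapprox_le (kapprox_lin c hl hl'); rewrite mulrC -ler_pdivlMr //.
  by rewrite !ge_min lexx !orbT.
move=> /(_ m) H1.
have {}H1 := H1 (kapprox_le _ hm).
have {}h2 := h2 _ _ (kapprox_le _ hl) (kapprox_le _ hm).
have {}h3 := h3 _ _ (kapprox_le _ hl') (kapprox_le _ hm).
have {}H1 : cabs (kdot (c *: f + f') g - form (scale_seq c l ++ l') m) < e.
  by apply: H1; rewrite !ge_min lexx !orbT.
have {}h2 : cabs (kdot f g - form l m) < e by apply: h2; rewrite !ge_min lexx ?orbT.
have {}h3 : cabs (kdot f' g - form l' m) < e by apply: h3; rewrite !ge_min lexx ?orbT.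
move: H1; rewrite kform_catl kform_scalel.
set X := kdot _ g; set Y := kdot f g; set Z := kdot f' g => H1.
have -> : X - (c * Y + Z) = (X - (c * form l m + form l' m))
   + (- (c * (Y - form l m)) + - (Z - form l' m)) by ring.
apply: le_trans (cabsD _ _) _; apply: le_trans (lerD (lexx _) (cabsD _ _)) _.
rewrite !cabsN cabsM; have := cabs_ge0 c.
have : cabs c * cabs (Y - form l m) <= cabs c * e by rewrite ler_wpM2l ?cabs_ge0 // ltW.
lra.
Qed.

Lemma kdotC f g : kdot f g = (kdot g f)^*%C.
Proof.
apply/eqP; rewrite -subr_eq0; apply/eqP; apply: (@cabs_small_eq0 _ 2) => e e0.
have [d1 d10 h1] := kdotP f g e0; have [d2 d20 h2] := kdotP g f e0.
pose d := Num.min d1 d2; have d0 : 0 < d by rewrite lt_min d10.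
have [l hl] := kapproxP f d0; have [m hm] := kapproxP g d0.
have {}h1 : cabs (kdot f g - form l m) < e.
  by apply: h1; [apply: kapprox_le hl|apply: kapprox_le hm]; rewrite ge_min lexx.
have {}h2 : cabs (kdot g f - form m l) < e.
  by apply: h2; [apply: kapprox_le hm|apply: kapprox_le hl]; rewrite ge_min lexx orbT.
have -> : kdot f g - (kdot g f)^*%C = (kdot f g - form l m) - (kdot g f - form m l)^*%C.
  by rewrite rmorphB /= -kformC; ring.
by apply: le_trans (cabsD _ _) _; rewrite cabsN cabs_conj; lra.
Qed.

Lemma kdot_linr c f f' g : kdot g (c *: f + f') = c^*%C * kdot g f + kdot g f'.
Proof. by rewrite kdotC kdot_linl rmorphD rmorphM /= -!kdotC. Qed.

Lemma kdot_ge0 f : 0 <= complex.Re (kdot f f).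
Proof.
apply: (@le_eps _ _ _ 1) => e e0; have [d d0 h] := kdotP f f e0.
have [l hl] := kapproxP f d0.
have := le_lt_trans (Re_le_cabs _) (h l l hl hl).
rewrite kform_real ReB /= ltr_norml => /andP[]; have := sqr_ge0 (knorm l); lra.
Qed.

Lemma kdot_real f : kdot f f = (complex.Re (kdot f f))%:C.
Proof.
have := congr1 (@complex.Im R) (kdotC f f); case: (kdot f f) => a b /= h.
by congr (_ +i* _); lra.
Qed.

Definition rnk f : R := Num.sqrt (complex.Re (kdot f f)).

Lemma rnk2 f : rnk f ^+ 2 = complex.Re (kdot f f).
Proof. by rewrite sqr_sqrtr // kdot_ge0. Qed.

Lemma rnk_ge0 f : 0 <= rnk f. Proof. exact: sqrtr_ge0. Qed.

Lemma rnk2_lin c f g : rnk (c *: f + g) ^+ 2 =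
  rnk g ^+ 2 + 2 * complex.Re (c * kdot f g) + cabs c ^+ 2 * rnk f ^+ 2.
Proof.
rewrite !rnk2 kdot_linl !kdot_linr mulrDr !ReD mulrA -cabs2E ReZ.
have -> : complex.Re (c^*%C * kdot g f) = complex.Re (c * kdot f g).
  by rewrite -Re_conjc rmorphM /= conjcK -kdotC.
ring.
Qed.

Lemma kdot_le f g : cabs (kdot f g) <= rnk g * rnk f.
Proof.
rewrite -(@ler_pXn2r _ 2) ?nnegrE ?mulr_ge0 ?cabs_ge0 ?rnk_ge0 //.
rewrite exprMn; apply: quad_ge0_discr; rewrite ?sqr_ge0 // => c.
by rewrite -rnk2_lin sqr_ge0.
Qed.

Lemma rnkZ c f : rnk (c *: f) = cabs c * rnk f.
Proof.
have k0 g : kdot 0 g = 0.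
  by have := kdot_linl (-1) 0 0 g; rewrite scaler0 addr0 mulN1r addrC subrr.
apply/eqP; rewrite -(@eqrXn2 _ 2) ?mulr_ge0 ?rnk_ge0 ?cabs_ge0 //.
rewrite exprMn -[c *: f]addr0 rnk2_lin (kdotC f 0) [rnk 0 ^+ 2]rnk2 !k0 conjc0 mulr0.
by rewrite /= mulr0 !add0r.
Qed.

Lemma rnkD f g : rnk (f + g) <= rnk f + rnk g.
Proof.
rewrite -(@ler_pXn2r _ 2) ?nnegrE ?addr_ge0 ?rnk_ge0 //.
rewrite -[f]scale1r rnk2_lin scale1r mul1r cabs1 expr1n mul1r.
have := le_trans (ler_norm _) (le_trans (Re_le_cabs _) (kdot_le f g)).
by rewrite sqrrD; lra.
Qed.

Fact kpoint_subproof s : (fun t => k s t) \in kpred.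
Proof.
apply/asboolP => e e0; exists [:: (1, s)] => m.
rewrite /kform big_seq1 (_ : kpair _ _ = \sum_(q <- m) 1 * (q.1)^*%C * k s q.2).
  by rewrite subrr cabs0 mulr_ge0 ?knorm_ge0 ?(ltW e0).
by apply: eq_bigr => q _; rewrite mul1r.
Qed.

Definition kpoint s : kspace := KSpace (kpoint_subproof s).

(** The reproducing property: [kpoint s] is approximated exactly by the one-term combination
    [(1, s)]. It makes [kdot] definite. *)
Lemma kdot_point f s : kdot f (kpoint s) = kval f s.
Proof.
pose m := [:: (1 : R[i], s)].
have pm : kpair (kval f) m = kval f s by rewrite /kpair big_seq1 conjc1 mul1r.
apply/eqP; rewrite -subr_eq0; apply/eqP; apply: (@cabs_small_eq0 _ (1 + knorm m)) => e e0.
have [d1 d10 h] := kdotP f (kpoint s) e0.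
pose d := Num.min d1 e; have d0 : 0 < d by rewrite lt_min d10.
have [l hl] := kapproxP f d0.
have := cabsD (kdot f (kpoint s) - form l m) (- (kpair (kval f) m - form l m)).
rewrite pm (_ : _ - _ - (_ - _) = kdot f (kpoint s) - kval f s); last by ring.
move=> /le_trans; apply; rewrite cabsN mulrDl mul1r; apply: lerD.
  apply/ltW/h; first by apply: kapprox_le hl; rewrite ge_min lexx.
  move=> q; rewrite /kform big_seq1 (_ : kpair _ _ = \sum_(p <- q) 1 * (p.1)^*%C * k s p.2).
    by rewrite subrr cabs0 mulr_ge0 ?knorm_ge0 ?(ltW d10).
  by apply: eq_bigr => p _; rewrite mul1r.
rewrite -pm; apply: le_trans (hl m) _; rewrite [leRHS]mulrC.
by rewrite ler_wpM2r ?knorm_ge0 // ge_min lexx orbT.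
Qed.

Lemma rnk_eq0 f : rnk f = 0 -> f = 0.
Proof.
move=> h; apply: val_inj; apply/funext => s /=; rewrite -kdot_point.
by apply: cabs_le0_eq0; apply: le_trans (kdot_le _ _) _; rewrite h mulr0.
Qed.

(** With [rnk_bound] this identifies [rnk f] with the norm of the functional [kpair (kval f)], which
    reduces completeness to convergence of values on combinations. *)
Lemma kpair_le f m : cabs (kpair (kval f) m) <= rnk f * knorm m.
Proof.
apply: (@le_eps _ _ _ (1 + 2 * knorm m)) => e e0.
have e20 : 0 < e ^+ 2 by rewrite exprn_gt0.
(* The tolerance is [e ^+ 2] because [knorm l ^+ 2 <= rnk f ^+ 2 + e ^+ 2] yields
   [knorm l <= rnk f + e]. *)
have [d1 d10 h] := kdotP f f e20.
pose d := Num.min d1 e; have d0 : 0 < d by rewrite lt_min d10.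
have [l hl] := kapproxP f d0.
have {}h : cabs (kdot f f - form l l) < e ^+ 2.
  by apply: h; apply: kapprox_le hl; rewrite ge_min lexx.
have h2 : knorm l <= rnk f + e.
  rewrite -(@ler_pXn2r _ 2) ?nnegrE ?addr_ge0 ?knorm_ge0 ?rnk_ge0 ?(ltW e0) //.
  have := le_lt_trans (Re_le_cabs _) h.
  rewrite ReB -rnk2 -knorm2 ltr_norml => /andP[h1 _]; rewrite sqrrD.
  have : 0 <= rnk f * e by rewrite mulr_ge0 ?rnk_ge0 // ltW.
  lra.
have := cabsD (kpair (kval f) m - form l m) (form l m); rewrite subrK => /le_trans; apply.
apply: le_trans (lerD (hl m) (kform_le _ _)) _.
have h3 : knorm l * knorm m <= (rnk f + e) * knorm m by rewrite ler_wpM2r ?knorm_ge0.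
have h4 : d * knorm m <= e * knorm m by rewrite ler_wpM2r ?knorm_ge0 // ge_min lexx orbT.
lra.
Qed.

Lemma rnk_bound f (C : R) : 0 <= C ->
  (forall m, cabs (kpair (kval f) m) <= C * knorm m) -> rnk f <= C.
Proof.
move=> C0 h; apply: (@le_eps _ _ _ 1) => e e0; rewrite mul1r.
have e20 : 0 < e ^+ 2 / 2 by rewrite divr_gt0 ?exprn_gt0.
have [d1 d10 h1] := kdotP f f e20.
pose d := Num.min d1 (e / 2); have d0 : 0 < d by rewrite lt_min d10 divr_gt0.
have de : d <= e / 2 by rewrite ge_min lexx orbT.
have [l hl] := kapproxP f d0.
have {}h1 : cabs (kdot f f - form l l) < e ^+ 2 / 2.
  by apply: h1; apply: kapprox_le hl; rewrite ge_min lexx.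
have h2 : knorm l <= C + d.
  apply: le_sqr_factor; rewrite ?knorm_ge0 ?addr_ge0 ?(ltW d0) //.
  rewrite -[knorm l ^+ 2]ger0_norm ?sqr_ge0 // -cabs_real -kform_real.
  rewrite (_ : form l l = kpair (kval f) l - (kpair (kval f) l - form l l)); last by ring.
  apply: le_trans (cabsD _ _) _; rewrite cabsN mulrDl; exact: lerD (h l) (hl l).
rewrite -(@ler_pXn2r _ 2) ?nnegrE ?addr_ge0 ?rnk_ge0 ?(ltW e0) // rnk2.
have := le_lt_trans (Re_le_cabs _) h1; rewrite ReB -knorm2 ltr_norml => /andP[_ h3].
have h4 : knorm l ^+ 2 <= (C + e / 2) ^+ 2.
  rewrite ler_pXn2r ?nnegrE ?knorm_ge0 ?addr_ge0 ?divr_ge0 ?(ltW e0) //.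
  by apply: le_trans h2 _; rewrite lerD2l.
have : 0 <= C * e by rewrite mulr_ge0 // ltW.
have := sqr_ge0 e; nra.
Qed.

Definition knrm f : R[i] := (rnk f)%:C.

Fact knrmD f g : knrm (f + g) <= knrm f + knrm g.
Proof. by rewrite -rmorphD lecR rnkD. Qed.

Fact knrmZ c f : knrm (c *: f) = `|c| * knrm f.
Proof. by rewrite cabsE -rmorphM /knrm rnkZ. Qed.

Fact knrm_eq0 f : knrm f = 0 -> f = 0.
Proof. by move=> /(@complexI _ _ 0) /rnk_eq0. Qed.

HB.instance Definition _ := Lmodule_isNormed.Build R[i] kspace knrmD knrmZ knrm_eq0.

Lemma knormrE f : `|f| = (rnk f)%:C.
Proof. by []. Qed.

Fact kspace_complete (F : set_system kspace) : ProperFilter F -> cauchy F -> cvg F.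
Proof.
move=> FF /cauchyP Fc.
have n0 n : 0 < n.+1%:R^-1 :> R by rewrite invr_gt0 ltr0n.
have /choice[x hx] (n : nat) : exists x : kspace, F (ball x (n.+1%:R^-1)%:C).
  by apply: Fc; rewrite ltcR.
have ballE y (e : R) : ball y e%:C = [set z | rnk (y - z) < e].
  by apply/funext => z; rewrite -ball_normE /= knormrE ltcR.
have rnkB f g : rnk (f - g) = rnk (g - f).
  by rewrite -opprB -scaleN1r rnkZ cabsN cabs1 mul1r.
have xC n i : rnk (x n - x i) <= n.+1%:R^-1 + i.+1%:R^-1.
  have [z [/=]] := filter_ex (filterI (hx n) (hx i)); rewrite !ballE /= => h1 h2.
  have := rnkD (x n - z) (z - x i); rewrite addrA subrK [rnk (z - _)]rnkB => h3.
  exact: le_trans h3 (ltW (ltrD h1 h2)).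
have kpB f g m : kpair (kval (f - g)) m = kpair (kval f) m - kpair (kval g) m.
  by rewrite addrC -scaleN1r kval_lin kpair_lin mulN1r addrC.
have inv_small (C e : R) : 0 <= C -> 0 < e -> exists N, forall n, (N <= n)%N -> n.+1%:R^-1 * C < e.
  move=> C0 e0; have C1 : 0 < C + 1 by rewrite ltr_wpDl.
  have [|N hN] := @inv_succ_lt R (e / (C + 1)); first by rewrite divr_gt0.
  exists N => n /hN; rewrite ltr_pdivlMr //; have := n0 n.
  by move: (n.+1%:R^-1) => a; nra.
(* Limits are taken on all combinations, so that the rate [zest] is uniform relative to [knorm m];
   [Gz] then shows that they come from the limit function [G] on points. *)
have /choice[z hz] (m : seq (R[i] * S)) : exists z, forall e : R, 0 < e ->
    exists N, forall n, (N <= n)%N -> cabs (z - kpair (kval (x n)) m) < e.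
  apply: complex_complete => e e0.
  have [||N hN] := inv_small (2 * knorm m) e => //; first by rewrite mulr_ge0 ?knorm_ge0.
  exists N => n i Nn Ni; rewrite -kpB; apply: le_lt_trans (kpair_le _ _) _.
  apply: le_lt_trans (ler_wpM2r (knorm_ge0 _) (xC _ _)) _.
  have := hN n Nn; have := hN i Ni; move: (n.+1%:R^-1) (i.+1%:R^-1) => a b; lra.
pose G s := z [:: (1, s)].
have zest m n : cabs (z m - kpair (kval (x n)) m) <= n.+1%:R^-1 * knorm m.
  apply: (@le_eps _ _ _ 2) => e e0.
  have [N1 h1] := hz m e e0; have [N2 h2] := inv_small _ e (knorm_ge0 m) e0.
  pose i := maxn N1 N2; have a1 := h1 i (leq_maxl _ _); have a2 := h2 i (leq_maxr _ _).
  have := cabsD (z m - kpair (kval (x i)) m) (kpair (kval (x i - x n)) m).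
  rewrite kpB addrA subrK -kpB => /le_trans; apply.
  have a3 := le_trans (kpair_le (x i - x n) m) (ler_wpM2r (knorm_ge0 _) (xC i n)).
  by move: (n.+1%:R^-1) (i.+1%:R^-1) a2 a3 => a b; lra.
have Gz m : kpair G m = z m.
  apply/eqP; rewrite -subr_eq0; apply/eqP.
  pose C := \sum_(q <- m) cabs (q.1) * knorm [:: (1, q.2)] + knorm m.
  have C0 : 0 <= C.
    rewrite addr_ge0 ?knorm_ge0 // sumr_ge0 // => q _.
    by rewrite mulr_ge0 ?cabs_ge0 ?knorm_ge0.
  apply: (@cabs_small_eq0 _ 1) => e e0; rewrite mul1r.
  have [N hN] := inv_small _ _ C0 e0; have {}hN := hN N (leqnn _).
  apply: le_trans (ltW hN); rewrite mulrDr.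
  have -> : kpair G m - z m = (kpair G m - kpair (kval (x N)) m) - (z m - kpair (kval (x N)) m).
    ring.
  apply: le_trans (cabsD _ _) _; rewrite cabsN; apply: lerD; last exact: zest.
  rewrite /kpair -sumrB mulr_sumr; apply: le_trans (cabs_sum _ _) _.
  apply: ler_sum => q _; rewrite -mulrBr cabsM cabs_conj mulrCA ler_wpM2l ?cabs_ge0 //.
  by have := zest [:: (1, q.2)] N; rewrite /kpair big_seq1 conjc1 mul1r.
have GP : G \in kpred.
  apply/asboolP => e e0; have [|N hN] := @inv_succ_lt R (e / 2); first by rewrite divr_gt0.
  have [|l hl] := @kapproxP (x N) (e / 2); first by rewrite divr_gt0.
  exists l => m; rewrite Gz.
  have := cabsD (z m - kpair (kval (x N)) m) (kpair (kval (x N)) m - form l m).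
  rewrite addrA subrK => /le_trans; apply; apply: le_trans (lerD (zest _ _) (hl m)) _.
  rewrite -mulrDl ler_wpM2r ?knorm_ge0 //; have := hN N (leqnn _).
  by move: (N.+1%:R^-1) => a; lra.
pose g := KSpace GP.
have gx n : rnk (g - x n) <= n.+1%:R^-1.
  by apply: rnk_bound; rewrite ?(ltW (n0 n)) // => m; rewrite kpB Gz.
apply/cvg_ex; exists g => B /nbhs_ballP[e e0 hB].
have er : e = (complex.Re e)%:C by rewrite RRe_real // gtr0_real.
have e0' : 0 < complex.Re e by rewrite -ltcR -er.
have [|N hN] := @inv_succ_lt R (complex.Re e / 2); first by rewrite divr_gt0.
apply: filterS (hx N) => y; rewrite ballE /= => xy; apply: hB; rewrite er ballE /=.
have := rnkD (g - x N) (x N - y); rewrite addrA subrK => /le_lt_trans; apply.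
have := gx N; have := hN N (leqnn _).
by move: (N.+1%:R^-1) xy => a; lra.
Qed.

HB.instance Definition _ := Uniform_isComplete.Build kspace kspace_complete.

HB.instance Definition _ := bilinear_isBilinear.Build R[i] kspace kspace R[i]
  ( *%R) (@Num.conj R[i] \; *%R) kdot
  (conj (fun u c x y => kdot_linl c x y u) (fun u c x y => kdot_linr c x y u)).

HB.instance Definition _ := @isHermitianSesquilinear.Build R[i] kspace false
  (@Num.conj R[i]) kdot (fun f g => etrans (kdotC f g) (esym (mul1r _))).

Fact kdot_gt0 f : f != 0 -> 0 < kdot f f.
Proof.
move=> f0; rewrite kdot_real ltcR lt_def kdot_ge0 andbT -rnk2 sqrf_eq0.
by apply: contra f0 => /eqP /rnk_eq0 ->.
Qed.

HB.instance Definition _ := @isDotProduct.Build R[i] kspace kdot kdot_gt0.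

Fact kdot_norm f : `|f| ^+ 2 = (kdot : {dot kspace for (@Num.conj R[i])}) f f.
Proof. by rewrite knormrE -rmorphXn rnk2 /= -kdot_real. Qed.

HB.instance Definition _ := @isHilbert.Build R kspace kdot kdot_norm.

Lemma kolmogorov_decomposition : exists (H : hilbertType R) (j : S -> H),
  (forall s t, hdot (j s) (j t) = k s t) /\ total j.
Proof.
exists kspace, kpoint; split=> [s t|u hu]; first exact: kdot_point.
apply: val_inj; apply/funext => s /=; rewrite -kdot_point.
by rewrite -[kdot _ _]/(hdot u (kpoint s)) hdotC hu conjc0.
Qed.

End KernelForm.

(** * Norm estimates in C*-algebras *)

(** If [r > 1] then [r >= (1 + d)^2] for some [d > 0], and Bernoulli's inequality makes [r ^+ n] at
    least [(n d)^2], which outgrows every linear bound. *)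
Lemma subexp_le1 {R : realType} (r C : R) : 0 <= r ->
  (forall n, r ^+ n <= C * n.+1%:R) -> r <= 1.
Proof.
move=> r0 h; rewrite leNgt; apply/negP => r1.
(* [d <= 1] and [3 d <= r - 1] give [(1 + d)^2 <= 1 + 3 d <= r]. *)
pose d := Num.min 1 ((r - 1) / 3).
have d0 : 0 < d by rewrite lt_min ltr01 divr_gt0 // subr_gt0.
have d1 : d <= 1 by rewrite ge_min lexx.
have dr : d <= (r - 1) / 3 by rewrite ge_min lexx orbT.
have dr2 : (1 + d) ^+ 2 <= r by move: dr; nra.
have bern n : 1 + n%:R * d <= (1 + d) ^+ n.
  elim: n => [|n IH]; first by rewrite mul0r addr0 expr0.
  rewrite exprS -natr1.
  have : (1 + d) * (1 + n%:R * d) <= (1 + d) * (1 + d) ^+ n.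
    by rewrite ler_wpM2l // addr_ge0 // ltW.
  have : 0 <= n%:R * (d * d) by rewrite !mulr_ge0 // ltW.
  lra.
have key n : (n%:R * d) ^+ 2 <= C * n.+1%:R.
  apply: le_trans (h n); apply: le_trans (_ : ((1 + d) ^+ 2) ^+ n <= _); last first.
    by apply: lerXn2r; rewrite ?nnegrE ?sqr_ge0.
  rewrite -exprM mulnC exprM ler_pXn2r ?nnegrE ?mulr_ge0 ?exprn_ge0 ?addr_ge0 ?(ltW d0) //.
  by apply: le_trans (bern n); rewrite lerDr.
have C0 : 0 <= C by have := h 0%N; rewrite mulr1 expr0 => /(le_trans _) ->.
(* [n >= 1] and [n > 2 C / d^2] give [(n d)^2 > 2 C n >= C (n + 1)]. *)
pose n := (Num.bound (2 * C / d ^+ 2)).+1.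
have hn : 2 * C / d ^+ 2 < n%:R.
  apply: lt_trans (archi_boundP _) _; rewrite ?ltr_nat // divr_ge0 ?sqr_ge0 //.
  by rewrite mulr_ge0.
move: hn; rewrite ltr_pdivrMr ?exprn_gt0 // => hn.
have := key n; rewrite -[n.+1%:R]natr1 exprMn.
have : 1 <= n%:R :> R by rewrite ler1n.
move: (n%:R) (d ^+ 2) hn => x e h1 x1 h2.
have : x * (2 * C) < x * (x * e) by rewrite ltr_pM2l // (lt_le_trans ltr01).
have : C * (x + 1) <= C * (2 * x) by rewrite ler_wpM2l //; lra.
lra.
Qed.

(** The quotients of successive terms do not decrease, so [a n >= r ^+ n * a 0] with
    [r = a 1 / a 0], and [subexp_le1] applies to [r / M]. This stands in for the spectral radius
    formula. *)
Lemma logconvex_growth {R : realType} (a : nat -> R) (C M : R) : 0 <= M ->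
  (forall n, 0 <= a n) -> (forall n, a n.+1 ^+ 2 <= a n * a n.+2) ->
  (forall n, a n <= C * n.+1%:R * M ^+ n) -> a 1%N <= M * a 0%N.
Proof.
move=> M0 a0 lc gr.
have [z|nz] := eqVneq (a 0%N) 0.
  have := lc 0%N; rewrite z mul0r mulr0 => h.
  suff /eqP -> : a 1%N == 0 by [].
  by rewrite -sqrf_eq0; apply/eqP/le_anti; rewrite h sqr_ge0.
have p0 : 0 < a 0%N by rewrite lt_def nz a0.
have [->|nz1] := eqVneq (a 1%N) 0; first by rewrite mulr_ge0.
have p1 : 0 < a 1%N by rewrite lt_def nz1 a0.
have Mp : 0 < M.
  rewrite lt_def M0 andbT; apply: contraTneq p1 => Mz.
  by have := gr 1%N; rewrite Mz expr1 mulr0 leNgt.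
pose r := a 1%N / a 0%N; have r0 : 0 < r by rewrite divr_gt0.
have step n : 0 < a n /\ r * a n <= a n.+1.
  elim: n => [|n [an rn]]; first by rewrite /r divfK.
  have an1 : 0 < a n.+1 by apply: lt_le_trans rn; rewrite mulr_gt0.
  split=> //; rewrite -(ler_pM2l an); apply: le_trans (lc n).
  by rewrite mulrCA mulrA expr2 ler_pM2r.
have low n : r ^+ n * a 0%N <= a n.
  elim: n => [|n IH]; first by rewrite mul1r.
  apply: le_trans (step n).2; rewrite exprS -mulrA ler_pM2l //.
suff : r / M <= 1 by rewrite /r ler_pdivrMr // mul1r ler_pdivrMr.
apply: (@subexp_le1 _ _ (C / a 0%N)) => [|n]; first by rewrite divr_ge0 ?ltW.
rewrite expr_div_n ler_pdivrMr ?exprn_gt0 //.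
rewrite [C / _ * _]mulrAC [_ / _ * _]mulrAC ler_pdivlMr //.
exact: le_trans (low n) (gr n).
Qed.

(** * Order and positivity in a unital algebra with a C*-seminorm *)

Section CstarOrder.
Context {R : realType} {U : algType R[i]}.
Variables (us : U -> U) (N : U -> R).
Hypothesis usD : forall a b, us (a + b) = us a + us b.
Hypothesis usZ : forall (c : R[i]) a, us (c *: a) = c^*%C *: us a.
Hypothesis usM : forall a b, us (a * b) = us b * us a.
Hypothesis usK : involutive us.
Hypothesis ND : forall a b, N (a + b) <= N a + N b.
Hypothesis NZ : forall (c : R[i]) a, N (c *: a) = cabs c * N a.
Hypothesis NM : forall a b, N (a * b) <= N a * N b.
Hypothesis NC : forall a, N (us a * a) = N a ^+ 2.
Implicit Types (a b g h y z w : U) (c : R[i]) (r s t u v e : R).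

Local Notation "s %:U" := ((s%:C)%:A : U) (at level 2, format "s %:U").

Let N0 : N 0 = 0.
Proof. by have := NZ 0 0; rewrite scale0r cabs0 mul0r. Qed.

Let NN a : N (- a) = N a.
Proof. by rewrite -scaleN1r NZ cabsN cabs1 mul1r. Qed.

Let NB a b : N (a - b) <= N a + N b.
Proof. by rewrite -(NN b); exact: ND. Qed.

Let N_ge0 a : 0 <= N a.
Proof. by have := NB a a; rewrite subrr N0; lra. Qed.

Let us1 : us 1 = 1.
Proof. by rewrite -[LHS]mulr1 -{2}(usK 1) -usM mulr1 usK. Qed.

Let usN a : us (- a) = - us a.
Proof. by rewrite -scaleN1r usZ rmorphN rmorph1 scaleN1r. Qed.

Let usB a b : us (a - b) = us a - us b. Proof. by rewrite usD usN. Qed.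

Let usX a n : us (a ^+ n) = us a ^+ n.
Proof. by elim: n => [|n IH]; rewrite ?us1 // exprS usM IH exprSr. Qed.

Let usR r : us r%:U = r%:U.
Proof. by rewrite usZ us1 conjc_real. Qed.

Let NR r : 0 <= r -> N r%:U = r * N 1.
Proof. by move=> r0; rewrite NZ cabs_real ger0_norm. Qed.

Let N1 : N 1 <= 1.
Proof.
have := NC 1; rewrite us1 mul1r; have := N_ge0 1; nra.
Qed.

Let NRle r : 0 <= r -> N r%:U <= r.
Proof. by move=> r0; rewrite NR // ler_piMr. Qed.

Let Nus a : N (us a) = N a.
Proof.
have le b : N b <= N (us b).
  have := NC b; have := NM (us b) b; have := N_ge0 b; have := N_ge0 (us b) => h1 h2 h3 h4.
  have [->//|b0] := eqVneq (N b) 0.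
  have bp : 0 < N b by rewrite lt_def b0.
  by rewrite -(ler_pM2r bp) -expr2 -h4.
by apply/le_anti; rewrite le andbT -{2}(usK a) le.
Qed.

Let Nsq h : us h = h -> N (h ^+ 2) = N h ^+ 2.
Proof. by move=> hs; rewrite -NC hs expr2. Qed.

Let Nlc h n : us h = h -> N (h ^+ n.+1) ^+ 2 <= N (h ^+ n) * N (h ^+ n.+2).
Proof.
move=> hs; rewrite -Nsq; last by rewrite usX hs.
by rewrite -exprM mulnC mul2n -addnn -addSnnS addnC exprD.
Qed.

Let Npow_subexp h C M : 0 <= M -> us h = h ->
  (forall n, N (h ^+ n) <= C * n.+1%:R * M ^+ n) -> N h <= M.
Proof.
move=> M0 hs gr.
have := logconvex_growth M0 (fun n => N_ge0 (h ^+ n)) (fun n => @Nlc h n hs) gr.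
by rewrite expr1 expr0 => /le_trans; apply; rewrite ler_piMr.
Qed.

(* [c ^+ i] is split by parity of [i]; averaging over [c] and [- c] isolates each
   half. *)
Let coef_extract j (f : nat -> U) B :
  (forall c, cabs c = 1 -> N (\sum_(i < 2 ^ j) c ^+ i *: f i) <= B) ->
  forall k, (k < 2 ^ j)%N -> N (f k) <= B.
Proof.
elim: j f => [|j IH] f h k.
  rewrite expn0 ltnS leqn0 => /eqP ->.
  by have := h 1 cabs1; rewrite expn0 big_ord1 expr0 scale1r.
move=> hk.
have split_sum c : \sum_(i < 2 ^ j.+1) c ^+ i *: f i =
    \sum_(i < 2 ^ j) (c ^+ 2) ^+ i *: f i.*2 + c *: \sum_(i < 2 ^ j) (c ^+ 2) ^+ i *: f i.*2.+1.
  rewrite expnS mul2n -(big_mkord xpredT (fun i => c ^+ i *: f i)).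
  elim: (2 ^ j)%N => [|n IHn]; first by rewrite big_geq // !big_ord0 scaler0 addr0.
  rewrite doubleS !big_nat_recr //= IHn !big_ord_recr /= scalerDr scalerA.
  by rewrite -exprM mul2n -exprS -!addrA; congr (_ + _); rewrite addrCA.
have half (c : R[i]) : cabs c = 1 ->
    N (\sum_(i < 2 ^ j) c ^+ i *: f i.*2) <= B /\ N (\sum_(i < 2 ^ j) c ^+ i *: f i.*2.+1) <= B.
  move=> c1; pose d := sqrtc c; have dc : d ^+ 2 = c by exact: sqr_sqrtc.
  have d1 : cabs d = 1.
    apply/eqP; rewrite -(@eqrXn2 _ 2) ?cabs_ge0 // expr1n.
    by rewrite expr2 -cabsM -expr2 dc c1.
  have := h d d1; have := h (- d); rewrite cabsN => /(_ d1).
  rewrite !split_sum sqrrN dc; set X := \sum_(i < _) _; set Y := \sum_(i < _) _.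
  rewrite scaleNr => h1 h2.
  have two (a : U) : N (a + a) = 2 * N a.
    by rewrite -mulr2n -scaler_nat NZ (_ : 2%:R = (2 : R)%:C) ?cabs_real ?ger0_norm // rmorph_nat.
  split.
    have := ND (X - d *: Y) (X + d *: Y); rewrite addrACA [- _ + _]addrC subrr addr0 two; lra.
  have -> : N Y = N (d *: Y) by rewrite NZ d1 mul1r.
  have := NB (X + d *: Y) (X - d *: Y).
  rewrite opprB addrC addrA subrK two; lra.
have e2 : ((2 ^ j).*2 = 2 ^ j.+1)%N by rewrite expnS mul2n.
have [hodd|heven] := boolP (odd k).
  have -> : k = (k./2).*2.+1 by rewrite -[LHS]odd_double_half hodd.
  apply: (IH (fun i => f i.*2.+1)); first by move=> c /half[].
  by rewrite -ltn_double e2 (leq_ltn_trans _ hk) // -{2}[k]odd_double_half leq_addl.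
have -> : k = (k./2).*2 by rewrite -[LHS]odd_double_half (negbTE heven).
apply: (IH (fun i => f i.*2)); first by move=> c /half[].
by rewrite -ltn_double e2 (leq_ltn_trans _ hk) // -{2}[k]odd_double_half leq_addl.
Qed.

Let quadE (p q p' q' : R[i]) y :
  (p%:A + q *: y) * (p'%:A + q' *: y) =
  (p * p')%:A + (p * q' + q * p') *: y + (q * q') *: y ^+ 2.
Proof.
rewrite mulrDl !mulrDr -!scalerAl -!scalerAr !scalerA !mul1r mulr1 expr2.
by rewrite scalerDl !addrA.
Qed.

(** By the C*-identity the squared norm is that of [s^2 + 2 s x y + y^2] with [x = Re c], the convex
    combination of [(s + y)^2] and [(s - y)^2] with weights [(1 + x) / 2] and [(1 - x) / 2]. *)
Let rotated (s : R) y c : 0 <= s -> us y = y ->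
  N (s%:U + y) <= s + 1 -> N (s%:U - y) <= s + 1 -> cabs c = 1 ->
  N (s%:U + c *: y) <= s + 1.
Proof.
move=> s0 ys h1 h2 c1.
rewrite -(@ler_pXn2r _ 2) ?nnegrE ?N_ge0 ?addr_ge0 // -NC usD usR usZ ys quadE.
pose x := complex.Re c.
have cc : c^*%C * c = 1 by rewrite mulrC -cabs2E c1 expr1n.
have cx : c + c^*%C = (2 * x)%:C by rewrite rmorphM /= rmorph_nat -addcJ.
have -> : (s%:C * s%:C)%:A + (s%:C * c + c^*%C * s%:C) *: y + (c^*%C * c) *: y ^+ 2 =
   ((1 + x) / 2)%:C *: (s%:U + y) ^+ 2 + ((1 - x) / 2)%:C *: (s%:U - y) ^+ 2.
  have -> : (s%:U + y) ^+ 2 = (s%:C * s%:C)%:A + (s%:C + s%:C) *: y + y ^+ 2.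
    by rewrite [LHS]expr2; have := quadE s%:C 1 s%:C 1 y; rewrite scale1r !mul1r mulr1 scale1r.
  have -> : (s%:U - y) ^+ 2 = (s%:C * s%:C)%:A + (- s%:C - s%:C) *: y + y ^+ 2.
    rewrite [LHS]expr2; have := quadE s%:C (-1) s%:C (-1) y.
    by rewrite scaleN1r mulrNN mul1r scale1r mulrN1 mulN1r.
  rewrite !scalerDr !scalerA [RHS]addrACA [X in _ = X + _]addrACA -!scalerDl.
  set p := ((1 + x) / 2)%:C; set p' := ((1 - x) / 2)%:C.
  have pp : p + p' = 1 by rewrite -rmorphD -(rmorph1 (real_complex R)); congr (_%:C); field.
  have pm : p - p' = x%:C by rewrite -rmorphB; congr (_%:C); field.
  have x2 : (2 * x)%:C = x%:C + x%:C by rewrite mulrDl mul1r rmorphD.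
  congr (_ *: _ + _ *: _ + _ *: _).
  - by rewrite -mulrDl pp mul1r.
  - have -> : p * (s%:C + s%:C) + p' * (- s%:C - s%:C) = (p - p') * (s%:C + s%:C) by ring.
    by rewrite [c^*%C * _]mulrC -mulrDr cx x2 pm; ring.
  - by rewrite pp cc.
have x1 : `|x| <= 1 by rewrite -c1; exact: Re_le_cabs.
move: x1; rewrite ler_norml => /andP[xa xb].
have b1 : N ((s%:U + y) ^+ 2) <= (s + 1) ^+ 2.
  by rewrite Nsq ?usD ?usR ?ys // ler_pXn2r ?nnegrE ?addr_ge0 ?N_ge0.
have b2 : N ((s%:U - y) ^+ 2) <= (s + 1) ^+ 2.
  by rewrite Nsq ?usB ?usR ?ys // ler_pXn2r ?nnegrE ?addr_ge0 ?N_ge0.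
apply: le_trans (ND _ _) _; rewrite !NZ !cabs_real !ger0_norm; try lra.
by move: ((s + 1) ^+ 2) b1 b2 => B b1 b2; nra.
Qed.

(* The coefficients of [(m + c y)^n], [|c| = 1], bound [N (y^k)] by
   [(m + 1)^n / (m^(n-k) 'C(n, k))]; summing over [k] bounds [(m + N y)^n]. *)
Let two_sided (m : nat) y : us y = y ->
  N (m%:R%:U + y) <= m%:R + 1 -> N (m%:R%:U - y) <= m%:R + 1 -> N y <= 1.
Proof.
move=> ys h1 h2.
have coef n k : (k <= n)%N -> N (y ^+ k) * (m ^ (n - k) * 'C(n, k))%:R <= (m%:R + 1) ^+ n.
  move=> kn; pose f i := (m ^ (n - i) * 'C(n, i))%:R *: y ^+ i : U.
  have nlt : (n < 2 ^ n)%N by exact: ltn_expl.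
  (* [coef_extract] treats sums of [2 ^ n] terms; those of index above [n] vanish with the binomial
     coefficient. *)
  have := @coef_extract n f ((m%:R + 1) ^+ n) _ k (leq_ltn_trans kn nlt).
  rewrite /f NZ mulrC -(rmorph_nat (real_complex R)) cabs_real ger0_norm //; apply => c c1.
  have r0 := rotated (ler0n _ _) ys h1 h2 c1.
  have -> : \sum_(i < 2 ^ n) c ^+ i *: f i = (m%:R%:U + c *: y) ^+ n.
    rewrite exprDn_comm; last by rewrite /GRing.comm -scalerAl mul1r -scalerAr mulr1.
    rewrite -(big_mkord xpredT (fun i => c ^+ i *: f i)) (big_cat_nat _ (n := n.+1)) //=.
    rewrite [X in _ + X]big_nat_cond [X in _ + X]big1 ?addr0; last first.
      move=> i /andP[/andP[ni _] _]; rewrite /f bin_small // muln0 scale0r scaler0 //.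
    rewrite big_mkord; apply: eq_bigr => i _; rewrite /f scalerA.
    rewrite !exprZn expr1n -scalerAl mul1r scalerA -[RHS]scaler_nat scalerA.
    by congr (_ *: _); rewrite natrM natrX rmorph_nat; ring.
  elim: (n) => [|d IH]; first by rewrite !expr0.
  rewrite !exprS; apply: le_trans (NM _ _) _.
  by apply: ler_pM; rewrite ?N_ge0.
set r := N y.
have [r0|rn0] := eqVneq r 0; first by rewrite r0.
have rp : 0 < r by rewrite lt_def rn0 N_ge0.
have step n : 0 < N (y ^+ n) /\ r * N (y ^+ n) <= N (y ^+ n.+1).
  elim: n => [|n [an rn]].
    rewrite expr0 expr1; split; last by rewrite ler_piMr // ltW.
    by rewrite lt_def N_ge0 andbT; apply: contra rn0 => /eqP z;
      rewrite /r -[y]mul1r; apply/eqP/le_anti; rewrite N_ge0 (le_trans (NM _ _)) // z mul0r.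
  have an1 : 0 < N (y ^+ n.+1) by apply: lt_le_trans rn; rewrite mulr_gt0.
  split=> //; rewrite -(ler_pM2l an); apply: le_trans (Nlc n ys).
  by rewrite mulrCA mulrA expr2 ler_pM2r.
have low n : r ^+ n.+1 <= N (y ^+ n.+1).
  elim: n => [|n IH]; first by rewrite !expr1.
  by apply: le_trans (step _).2; rewrite exprS ler_pM2l.
have m1 : 0 < m%:R + 1 :> R by rewrite ltr_wpDl.
suff : (m%:R + r) / (m%:R + 1) <= 1 by rewrite ler_pdivrMr // mul1r lerD2l.
apply: (@subexp_le1 _ _ 1) => [|n]; first by rewrite divr_ge0 ?addr_ge0 ?N_ge0 ?(ltW m1).
rewrite mul1r expr_div_n ler_pdivrMr ?exprn_gt0 // exprDn.
apply: le_trans (_ : \sum_(i < n.+1) (m%:R + 1) ^+ n <= _); last first.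
  by rewrite sumr_const card_ord mulr_natl.
apply: ler_sum => i _.
(* Index [0] is handled apart, since [low] covers positive exponents only. *)
have := @coef n i; rewrite -ltnS ltn_ord => /(_ isT); case: (val i) => [|j].
  rewrite subn0 bin0 muln1 expr0 mulr1 mulr1n natrX => _.
  by apply: lerXn2r; rewrite ?nnegrE ?ler0n ?(ltW m1) // lerDl.
apply: le_trans; rewrite -mulr_natr mulrAC -natrX -natrM mulrC ler_wpM2r //.
Qed.

(* [ule y u] expresses that the spectrum of [y] lies below [u]. *)
Definition ule y u := forall e, 0 < e -> exists2 s, 0 <= s & N (s%:U + y) <= s + u + e.

Let UD r t : (r + t)%:U = r%:U + t%:U.
Proof. by rewrite rmorphD scalerDl. Qed.

Let ule_shift s t y v : s <= t -> N (s%:U + y) <= s + v -> N (t%:U + y) <= t + v.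
Proof.
move=> st h; have -> : t = (t - s) + s by rewrite subrK.
rewrite UD -addrA; apply: le_trans (ND _ _) _; rewrite -addrA lerD // NRle // subr_ge0 //.
Qed.

Let uleD y z u v : ule y u -> ule z v -> ule (y + z) (u + v).
Proof.
move=> hy hz e e0; have e2 : 0 < e / 2 by rewrite divr_gt0.
have [s s0 hs] := hy _ e2; have [t t0 ht] := hz _ e2.
exists (s + t); first by rewrite addr_ge0.
rewrite UD addrACA; apply: le_trans (ND _ _) _; lra.
Qed.

Let ule_norm y : ule y (N y).
Proof.
by move=> e e0; exists 0 => //; rewrite scale0r !add0r lerDl ltW.
Qed.

Let uleZ r y u : 0 <= r -> ule y u -> ule (r%:C *: y) (r * u).
Proof.
rewrite le0r => /orP[/eqP -> _ e e0|r0 h e e0].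
  by exists 0 => //; rewrite !scale0r mul0r !add0r N0 ltW.
have [|s s0 hs] := h (e / r); first by rewrite divr_gt0.
exists (r * s); first by rewrite mulr_ge0 // ltW.
rewrite rmorphM -scalerA -scalerDr NZ cabs_real ger0_norm ?(ltW r0) //.
rewrite (_ : _ + _ + e = r * (s + u + e / r)); first by rewrite ler_pM2l.
by field; rewrite gt_eqF.
Qed.

Let ule_lim y u C : (forall e, 0 < e -> ule y (u + C * e)) -> ule y u.
Proof.
move=> h e e0; have C0 : 0 < `|C| + 1 by rewrite ltr_pwDr.
have d0 : 0 < e / 2 / (`|C| + 1) by rewrite !divr_gt0.
have [|s s0 hs] := h _ d0 (e / 2); first by rewrite divr_gt0.
exists s => //; suff : C * (e / 2 / (`|C| + 1)) <= e / 2 by lra.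
rewrite mulrA ler_pdivrMr // [C * _]mulrC ler_pM2l ?divr_gt0 //.
by apply: le_trans (ler_norm _) _; rewrite lerDl.
Qed.

Let sum_sqr a b : a * b = b * a -> (a - 'i%C *: b) * (a + 'i%C *: b) = a ^+ 2 + b ^+ 2.
Proof.
move=> ab; have ii : 'i%C * 'i%C = -1 :> R[i] by rewrite -expr2 sqr_i.
rewrite mulrBl !mulrDr -!scalerAl -!scalerAr scalerA ii -ab.
by rewrite opprD scaleN1r opprK addrA addrK !expr2.
Qed.

(* [1 - h^2 / s] is the real part of [w = a + i b], where [b = sqrt (2 / s) h] is
   chosen so that [w^* w = 1 + h^4 / s^2]. *)
Let ule_sqr h : us h = h -> ule (- h ^+ 2) 0.
Proof.
move=> hs e e0; pose K := N h ^+ 4 / 4; have K0 : 0 <= K by rewrite divr_ge0 ?exprn_ge0.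
pose s := (4 * K + 1) / e; have s0 : 0 < s by rewrite divr_gt0 // ltr_wpDl ?mulr_ge0.
exists s; rewrite ?(ltW s0) //.
pose a := 1%:U + (- s^-1)%:C *: h ^+ 2.
pose t := Num.sqrt (2 / s); have t2 : t ^+ 2 = 2 / s by rewrite sqr_sqrtr // divr_ge0 // ltW.
pose b := t%:C *: h.
have us_h2 : us (h ^+ 2) = h ^+ 2 by rewrite usX hs.
have as_ : us a = a by rewrite usD usR usZ us_h2 conjc_real.
have bs : us b = b by rewrite usZ hs conjc_real.
have ab : a * b = b * a.
  rewrite /a /b -scalerAr -scalerAl mulrDl mulrDr -!scalerAl -!scalerAr.
  by rewrite -exprS -exprSr mul1r mulr1.
pose w := a + 'i%C *: b.
have usw : us w = a - 'i%C *: b.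
  by rewrite usD usZ as_ bs conj_i scaleNr.
have ww : us w * w = 1%:U + (s ^- 2)%:C *: (h ^+ 2) ^+ 2.
  rewrite usw sum_sqr // [a ^+ 2]expr2 [b ^+ 2]expr2.
  rewrite /a (quadE 1%:C (- s^-1)%:C 1%:C (- s^-1)%:C) /b -scalerAl -scalerAr scalerA -expr2.
  rewrite rmorph1 !mul1r mulr1 addrAC; congr (_ + _); last first.
    by rewrite -rmorphM mulrNN -expr2 exprVn.
  rewrite expr1n -expr2 -addrA -scalerDl.
  have -> : (- s^-1)%:C + (- s^-1)%:C + t%:C * t%:C = 0.
    rewrite -!rmorphM -!rmorphD -expr2 t2 -(rmorph0 (real_complex R)); congr (_%:C).
    by field; rewrite gt_eqF.
  by rewrite scale0r addr0.
have Nw : N w ^+ 2 <= 1 + s ^- 2 * N h ^+ 4.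
  rewrite -NC ww; apply: le_trans (ND _ _) _; rewrite lerD ?NRle // NZ cabs_real.
  by rewrite ger0_norm ?invr_ge0 ?sqr_ge0 // Nsq ?us_h2 // Nsq // -exprM.
have Na : N a <= N w.
  have : N (w + us w) <= 2 * N w by apply: le_trans (ND _ _) _; rewrite Nus; lra.
  rewrite usw /w addrACA subrr addr0 -mulr2n -scaler_nat NZ.
  by rewrite -(rmorph_nat (real_complex R)) cabs_real ger0_norm // ler_pM2l.
have -> : s%:U - h ^+ 2 = s%:C *: a.
  rewrite /a scalerDr !scalerA -!rmorphM mulr1 mulrN divff ?gt_eqF //.
  by rewrite rmorphN rmorph1 scaleN1r.
rewrite NZ cabs_real ger0_norm ?(ltW s0) //.
(* The square root is removed through [1 + t <= (1 + t)^2] for [t >= 0]. *)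
have h1 : N a <= 1 + s ^- 2 * N h ^+ 4.
  have x0 : 0 <= s ^- 2 * N h ^+ 4 by rewrite mulr_ge0 ?invr_ge0 ?sqr_ge0 ?exprn_ge0.
  rewrite -(@ler_pXn2r _ 2) ?nnegrE ?N_ge0 ?addr_ge0 //.
  apply: le_trans (_ : N w ^+ 2 <= _); first by rewrite ler_pXn2r ?nnegrE ?N_ge0.
  by apply: le_trans Nw _; nra.
apply: le_trans (ler_wpM2l (ltW s0) h1) _.
rewrite addr0 mulrDr mulr1 lerD2l.
have -> : s * (s ^- 2 * N h ^+ 4) = (4 * K) / s by rewrite /K; field; rewrite gt_eqF.
rewrite ler_pdivrMr // /s [e * _]mulrC divfK ?gt_eqF //.
by rewrite lerDl.
Qed.

(** After division by [u + e], [ule_shift] moves both witnesses to a common integer [m], which is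
    the situation of [two_sided]. *)
Let ule_two y u : us y = y -> 0 <= u -> ule y u -> ule (- y) u -> N y <= u.
Proof.
move=> ys u0 h1 h2; apply: (@le_eps _ _ _ 1) => e e0; rewrite mul1r.
have [s s0 hs] := h1 e e0; have [t t0 ht] := h2 e e0.
have v0 : 0 < u + e by rewrite ltr_wpDl.
pose m := Num.bound ((s + t) / (u + e)).
have hm : (s + t) / (u + e) < m%:R by apply: archi_boundP; rewrite divr_ge0 ?addr_ge0 // ltW.
rewrite ltr_pdivrMr // in hm.
pose y' := (u + e)^-1%:C *: y.
have ys' : us y' = y' by rewrite usZ ys conjc_real.
have key z : N ((m%:R * (u + e))%:U + z) <= m%:R * (u + e) + (u + e) ->
    N (m%:R%:U + (u + e)^-1%:C *: z) <= m%:R + 1.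
  move=> hz; have -> : m%:R%:U + (u + e)^-1%:C *: z =
      (u + e)^-1%:C *: ((m%:R * (u + e))%:U + z).
    by rewrite scalerDr scalerA -rmorphM mulrC mulfK ?gt_eqF.
  rewrite NZ cabs_real ger0_norm ?invr_ge0 ?(ltW v0) // mulrC ler_pdivrMr //.
  by rewrite mulrDl mul1r.
have := @two_sided m y' ys'; rewrite NZ cabs_real ger0_norm ?invr_ge0 ?(ltW v0) //.
rewrite -scalerN mulrC ler_pdivrMr // mul1r; apply.
  by apply: key; apply: ule_shift (_ : N (s%:U + y) <= s + (u + e)); [lra|rewrite addrA].
by apply: key; apply: ule_shift (_ : N (t%:U - y) <= t + (u + e)); [lra|rewrite addrA].
Qed.

(* Iterates [1 - x = (1 - x)^2 / 2 + (1 - x^2) / 2] with [x = g^(2^k)]. *)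
Let ule_one_sub g z : us g = g -> N g <= 1 ->
  (forall j, ule (- (us z * (1 - g ^+ (2 ^ j)) ^+ 2 * z)) 0) ->
  ule (- (us z * (1 - g) * z)) 0.
Proof.
move=> gs g1 h.
have Ng k : N (g ^+ k) <= 1.
  elim: k => [|k IH]; first by rewrite expr0.
  by rewrite exprS; apply: le_trans (NM _ _) _; rewrite mulr_ile1.
have half x : 1 - x = (2^-1)%:C *: (1 - x) ^+ 2 + (2^-1)%:C *: (1 - x ^+ 2) :> U.
  have e2 : 2^-1%:C + 2^-1%:C = 1 :> R[i].
    by rewrite -rmorphD -(rmorph1 (real_complex R)); congr (_%:C); field.
  rewrite -scalerDr expr2 mulrBr mulr1 mulrBl mul1r -expr2 opprB -addrA.
  by rewrite [x ^+ 2 - x + _]addrC subrKA scalerDr -scalerDl e2 scale1r.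
(* After [n] halvings the remaining term has weight [2 ^- n] and is bounded crudely through
   [N (1 - x) <= 2]; the other terms are the squares covered by [h]. *)
have key n k : ule (- (us z * (1 - g ^+ (2 ^ k)) * z)) (2 ^- n * (2 * N z ^+ 2)).
  elim: n k => [|n IH] k.
    rewrite expr0 invr1 mul1r.
    have hN : N (- (us z * (1 - g ^+ (2 ^ k)) * z)) <= 2 * N z ^+ 2.
      rewrite NN; apply: le_trans (NM _ _) _; rewrite expr2 mulrA ler_wpM2r //.
      apply: le_trans (NM _ _) _; rewrite Nus mulrC ler_wpM2r //.
      by apply: le_trans (NB _ _) _; have := Ng (2 ^ k)%N; have := N1; lra.
    move=> e e0; have [s s0 hs] := ule_norm (- (us z * (1 - g ^+ (2 ^ k)) * z)) e0.
    by exists s => //; apply: le_trans hs _; rewrite lerD2r lerD2l.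
  have -> : - (us z * (1 - g ^+ (2 ^ k)) * z) =
      (2^-1)%:C *: - (us z * (1 - g ^+ (2 ^ k)) ^+ 2 * z) +
      (2^-1)%:C *: - (us z * (1 - g ^+ (2 ^ k.+1)) * z).
    rewrite {1}(half (g ^+ _)) -exprM -expnSr mulrDr mulrDl opprD.
    by rewrite -!scalerAr -!scalerAl -!scalerN.
  have -> : 2 ^- n.+1 * (2 * N z ^+ 2) = 2^-1 * 0 + 2^-1 * (2 ^- n * (2 * N z ^+ 2)).
    by rewrite mulr0 add0r exprS invfM mulrA.
  by apply: uleD; apply: uleZ; rewrite ?invr_ge0 //.
apply: (@ule_lim _ _ (2 * N z ^+ 2)) => e e0; rewrite add0r.
have [n hn] := inv_succ_lt e0; have {}hn := hn n (leqnn _).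
have hn2 : 2 ^- n <= e.
  apply: le_trans (ltW hn); rewrite lef_pV2 ?posrE ?ltr0n ?exprn_gt0 // -natrX ler_nat.
  exact: ltn_expl.
move=> d d0; have [s s0 hs] := key n 0%N d d0; exists s; rewrite // expr1 in hs *.
apply: le_trans hs _; rewrite lerD2r lerD2l [leRHS]mulrC ler_wpM2r // mulr_ge0 ?sqr_ge0 //.
Qed.

(** With [z = g (1 - g)^n], passing from [n] to [n + 1] subtracts [z^2] and [z (1 - g) z]; the
    former is a square and the latter reduces to squares by [ule_one_sub]. The estimate is thus
    available before [g] is known to be positive. *)
Let ule_damped g n : us g = g -> N g <= 1 -> ule (g * ((1 - g) ^+ n) ^+ 2) 1.
Proof.
move=> gs g1.
have Cg x : GRing.comm g x -> GRing.comm x g by move=> h; rewrite /GRing.comm h.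
have c1 : GRing.comm g (1 - g) by apply: commrB => //; exact: commr1.
elim: n => [|n IH].
  rewrite expr0 expr1n mulr1 => e e0; have [s s0 hs] := ule_norm g e0.
  by exists s => //; apply: le_trans hs _; rewrite lerD2r lerD2l.
pose z := g * (1 - g) ^+ n.
have zs : us z = z by rewrite usM usX usB us1 gs; exact/esym/commrX.
have zg k : GRing.comm z (g ^+ k).
  apply: commrX; apply: commr_sym; apply: commrM => //; exact: commrX.
have -> : g * ((1 - g) ^+ n.+1) ^+ 2 =
    g * ((1 - g) ^+ n) ^+ 2 + - z ^+ 2 + - (us z * (1 - g) * z).
  rewrite zs /z.
  (* The identity involves only powers of [g], so it is checked in the commutative ring of
     polynomials. *)
  have : horner_alg g ('X * ((1 - 'X) ^+ n.+1) ^+ 2) = horner_alg g ('X * ((1 - 'X) ^+ n) ^+ 2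
     - ('X * (1 - 'X) ^+ n) ^+ 2 - ('X * (1 - 'X) ^+ n) * (1 - 'X) * ('X * (1 - 'X) ^+ n)).
    by congr (horner_alg g _); rewrite (exprS (1 - 'X) n); move: ((1 - 'X) ^+ n) => P; ring.
  by rewrite !(rmorphD, rmorphM, rmorphN, rmorphXn, rmorph1) /= !horner_algX.
suff h : ule (- (us z * (1 - g) * z)) 0.
  by have := uleD (uleD IH (ule_sqr zs)) h; rewrite !addr0.
apply: ule_one_sub => // j; set w := 1 - g ^+ _.
have ws : us w = w by rewrite usB us1 usX gs.
have zw : GRing.comm z w by apply: commrB; [exact: commr1|exact: zg].
have -> : us z * w ^+ 2 * z = (z * w) ^+ 2.
  by rewrite zs expr2 [RHS]expr2 [X in _ = _ * X]zw !mulrA.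
by apply: ule_sqr; rewrite usM ws zs zw.
Qed.

Let ule_sum_adj b : ule (- (us b * b + b * us b)) 0.
Proof.
pose x := b + us b; pose y := 'i%C *: (b - us b).
have xs : us x = x by rewrite usD usK addrC.
have ys : us y = y by rewrite usZ usB usK conj_i scaleNr -scalerN opprB.
have -> : - (us b * b + b * us b) = (2^-1)%:C *: (- x ^+ 2 + - y ^+ 2).
  have -> : y ^+ 2 = - (b - us b) ^+ 2.
    by rewrite /y exprZn sqr_i scaleN1r.
  rewrite opprK /x.
  have -> : - (b + us b) ^+ 2 + (b - us b) ^+ 2 =
      - (us b * b + b * us b) - (us b * b + b * us b).
    have e1 : (b + us b) ^+ 2 = b * b + b * us b + (us b * b + us b * us b).
      by rewrite expr2 mulrDl !mulrDr.
    have e2 : (b - us b) ^+ 2 = b * b - b * us b - (us b * b - us b * us b).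
      by rewrite expr2 mulrBl !mulrBr.
    rewrite {}e1 {}e2; move: (b * b) (b * us b) (us b * b) (us b * us b) => p q r t.
    rewrite opprB [r + t]addrC [p + q + _]addrACA [p - q + _]addrACA -[- q - r]opprD [q + r]addrC.
    by rewrite opprD addrACA addNr add0r.
  rewrite scalerDr -scalerDl -rmorphD (_ : 2^-1 + 2^-1 = 1 :> R); last by field.
  by rewrite rmorph1 scale1r.
have h : 0 <= 2^-1 :> R by rewrite invr_ge0.
by have := uleZ h (uleD (ule_sqr xs) (ule_sqr ys)); rewrite addr0 mulr0.
Qed.

(* Kelley-Vaught: the elements [us a * a] have no negative spectrum.  The
   negative part of [g = us a * a] is amplified by [(1 - g) ^+ n], and
   [us b * b + b * us b] is a sum of squares of self-adjoint elements. *)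
Let norm_one_sub_coadj a : N (us a * a) <= 1 -> N (1 - a * us a) <= 1.
Proof.
set g := us a * a; set c := a * us a => g1.
have gs : us g = g by rewrite usM usK.
have cs : us c = c by rewrite usM usK.
have Nc1 : N c <= 1 by have := NC (us a); rewrite usK Nus -NC => ->.
have N1c : N (1 - c) <= 2 by apply: le_trans (NB _ _) _; have := N1; lra.
have cg : GRing.comm g (1 - g) by apply: commrB => //; exact: commr1.
have cc : GRing.comm c (1 - c) by apply: commrB => //; exact: commr1.
have comm_pow n : a * (1 - g) ^+ n = (1 - c) ^+ n * a.
  elim: n => [|n IH]; first by rewrite !expr0 mulr1 mul1r.
  rewrite exprSr mulrA IH exprSr -!mulrA; congr (_ * _).
  by rewrite mulrBr mulrBl mulr1 mul1r /g /c !mulrA.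
(* [b^* b] and [b b^*] are the damped forms of [g] and [c]. Both are at most [1], and [- b b^*] is
   at most [b^* b] because their sum is positive; this bounds [b b^*] from both sides. *)
have Cn n : N (c * ((1 - c) ^+ n) ^+ 2) <= 1.
  pose b := a * (1 - g) ^+ n.
  have usb : us b = (1 - g) ^+ n * us a by rewrite usM usX usB us1 gs.
  have bb : us b * b = g * ((1 - g) ^+ n) ^+ 2.
    by rewrite usb /b -mulrA [us a * _]mulrA -/g mulrA -(commrX n cg) -mulrA -expr2.
  have bb' : b * us b = c * ((1 - c) ^+ n) ^+ 2.
    rewrite usb /b -mulrA [_ ^+ n * (_ * _)]mulrA -expr2 -exprM.
    rewrite mulrA comm_pow -mulrA -/c -exprM.
    by rewrite -(commrX _ cc).
  have Cs : us (c * ((1 - c) ^+ n) ^+ 2) = c * ((1 - c) ^+ n) ^+ 2.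
    by rewrite -bb' usM usK.
  apply: ule_two => //; first exact: ule_damped.
  have := uleD (ule_sum_adj b) (ule_damped n gs g1).
  rewrite bb bb' add0r => h e e0; have [s s0 hs] := h e e0; exists s => //.
  by move: hs; rewrite opprD addrAC addNr add0r.
apply: (@Npow_subexp _ 2 1) => //; first by rewrite usB us1 cs.
(* An odd exponent costs one more factor [1 - c], of norm at most [2]. *)
have Ck n : N (c * (1 - c) ^+ n) <= 2.
  rewrite -[n]odd_double_half addnC exprD -muln2 exprM mulrA.
  have h := Cn n./2; case: (odd n); last by rewrite expr0 mulr1; apply: le_trans h _; rewrite ler1n.
  rewrite expr1; apply: le_trans (NM _ _) _; rewrite -[2]mul1r.
  by apply: ler_pM.
(* [(1 - c)^(n+1) = (1 - c)^n - c (1 - c)^n] adds at most [2] per step, the linear growth that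
   [Npow_subexp] allows. *)
elim=> [|n IH]; first by rewrite expr0 !mulr1; apply: le_trans N1 _; rewrite ler1n.
rewrite exprS mulrBl mul1r; apply: le_trans (NB _ _) _.
have := Ck n; move: IH; rewrite !expr1n !mulr1 -!natr1; lra.
Qed.

Lemma norm_one_sub_adj a : N (us a * a) <= 1 -> N (1 - us a * a) <= 1.
Proof.
by move=> h; have := @norm_one_sub_coadj (us a); rewrite NC usK Nus -NC => /(_ h).
Qed.

(** Monotonicity of the seminorm on positive elements, in the shape obtained by expanding
    [<w - z k, w - z k>] with [k = <z, w>], [l = <w, w>] and [us b * b = <z, z>]. The term with
    [1 - us b * b] is nonnegative, so [us k * k] lies below [l]. *)
Lemma norm_adj_mono k l b d : N (us b * b) <= 1 ->
  l - (us k * (1 - us b * b) * k + us k * k) = us d * d -> N k ^+ 2 <= N l.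
Proof.
(* Division by [N a + 1] brings [a] into the unit ball, where [norm_one_sub_adj] applies; the [1]
   covers [N a = 0]. *)
have pos a : ule (- (us a * a)) 0.
  have d0 : 0 < N a + 1 by rewrite ltr_wpDl.
  pose t := (N a + 1)^-1; have t0 : 0 < t by rewrite invr_gt0.
  have := @norm_one_sub_adj (t%:C *: a); rewrite usZ conjc_real -scalerAl -scalerAr scalerA.
  rewrite -rmorphM NZ cabs_real ger0_norm ?mulr_ge0 ?(ltW t0) // NC => h e e0.
  exists ((N a + 1) ^+ 2); rewrite ?sqr_ge0 // addr0.
  have tt : (N a + 1) ^+ 2 * (t * t) = 1 by rewrite /t; field; rewrite gt_eqF.
  have -> : ((N a + 1) ^+ 2)%:U - us a * a =
      ((N a + 1) ^+ 2)%:C *: (1 - (t * t)%:C *: (us a * a)).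
    by rewrite scalerBr scalerA -rmorphM tt rmorph1 scale1r.
  rewrite NZ cabs_real ger0_norm ?sqr_ge0 //.
  apply: (@le_trans _ _ ((N a + 1) ^+ 2)); last by rewrite lerDl ltW.
  rewrite ler_piMr ?sqr_ge0 //; apply: h.
  rewrite -(@ler_pM2l _ ((N a + 1) ^+ 2)) ?exprn_gt0 // mulrA tt mul1r mulr1.
  by rewrite ler_pXn2r ?nnegrE ?(ltW d0) ?N_ge0 // lerDl.
set g := us b * b => g1 hl.
have gs : us g = g by rewrite usM usK.
have h1 : ule (- (us k * (1 - g) * k)) 0.
  apply: ule_one_sub => // j; set w := 1 - g ^+ _.
  have -> : us k * w ^+ 2 * k = us (w * k) * (w * k).
    by rewrite usM {1}/w usB us1 usX gs -/w expr2 !mulrA.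
  exact: pos.
rewrite -NC; apply: ule_two => //; first by rewrite usM usK.
  have := uleD (uleD (ule_norm l) (pos d)) h1; rewrite -hl !addr0.
  by rewrite subKr [us k * _ * k + _]addrC addrK.
by move=> e e0; have [s s0 hs] := pos k e e0; exists s => //; have := N_ge0 l; lra.
Qed.

End CstarOrder.

(** * Continuous C*-seminorms *)

Section StarAlgebraFacts.
Context {R : realType} {A : starAlgType R}.
Implicit Types (a b x : A) (c : R[i]).

Lemma amul0l a : amul 0 a = 0.
Proof. by have := amulZl 0 (0 : A) a; rewrite !scale0r. Qed.
Lemma amul0r a : amul a 0 = 0.
Proof. by have := amulZr 0 a (0 : A); rewrite !scale0r. Qed.
Lemma amulNl a b : amul (- a) b = - amul a b.
Proof. by rewrite -scaleN1r amulZl scaleN1r. Qed.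
Lemma amulNr a b : amul a (- b) = - amul a b.
Proof. by rewrite -scaleN1r amulZr scaleN1r. Qed.
Lemma amulBl a b x : amul (a - b) x = amul a x - amul b x.
Proof. by rewrite amulDl amulNl. Qed.
Lemma amulBr a b x : amul x (a - b) = amul x a - amul x b.
Proof. by rewrite amulDr amulNr. Qed.
Lemma star0 : star (0 : A) = 0.
Proof. by have := starZ 0 (0 : A); rewrite conjE conjc0 !scale0r. Qed.
Lemma starN a : star (- a) = - star a.
Proof. by rewrite -scaleN1r starZ conjE rmorphN rmorph1 scaleN1r. Qed.
Lemma starB a b : star (a - b) = star a - star b.
Proof. by rewrite starD starN. Qed.

Variable (p : A -> R).
Hypothesis pC : Cstar_seminorm p.

Lemma cseminormD a b : p (a + b) <= p a + p b. Proof. by case: pC. Qed.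
Lemma cseminormZ c a : p (c *: a) = cabs c * p a. Proof. by case: pC. Qed.
Lemma cseminormM a b : p (amul a b) <= p a * p b. Proof. by case: pC. Qed.
Lemma cseminormC a : p (amul (star a) a) = p a ^+ 2. Proof. by case: pC. Qed.
Lemma cseminorm0 : p 0 = 0.
Proof. by have := cseminormZ 0 0; rewrite scale0r cabs0 mul0r. Qed.
Lemma cseminormN a : p (- a) = p a.
Proof. by rewrite -scaleN1r cseminormZ cabsN cabs1 mul1r. Qed.
Lemma cseminorm_ge0 a : 0 <= p a.
Proof.
by have := cseminormD a (- a); rewrite subrr cseminorm0 cseminormN; lra.
Qed.
Lemma cseminorm_star a : p (star a) = p a.
Proof.
have le b : p b <= p (star b).
  have h1 := cseminormC b; have h2 := cseminormM (star b) b.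
  have [->|b0] := eqVneq (p b) 0; first exact: cseminorm_ge0.
  have bp : 0 < p b by rewrite lt_def b0 cseminorm_ge0.
  by rewrite -(ler_pM2r bp) -expr2 -h1.
by apply/le_anti; rewrite le andbT -{2}(starK a) le.
Qed.
Lemma cseminormCr a : p (amul a (star a)) = p a ^+ 2.
Proof. by rewrite -{1}(starK a) cseminormC cseminorm_star. Qed.

End StarAlgebraFacts.

(** * Unitization of an algebra with a C*-seminorm *)

Section Unitization.
Context {R : realType}.

Definition unitization (A : starAlgType R) : Type := (R[i] * A)%type.

Variable A : starAlgType R.
Implicit Types (v w : unitization A) (a b x : A) (c : R[i]).

HB.instance Definition _ := GRing.Lmodule.copy (unitization A) (R[i] * A)%type.

Definition umul v w : unitization A := (v.1 * w.1, v.1 *: w.2 + w.1 *: v.2 + amul v.2 w.2).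
Definition uone : unitization A := (1, 0).
Definition ustar v : unitization A := ((v.1)^*%C, star v.2).
Definition uact v x : A := v.1 *: x + amul v.2 x.

Lemma unitization_eq v w : v.1 = w.1 -> v.2 = w.2 -> v = w.
Proof. by case: v w => [c a] [d b] /= -> ->. Qed.

Fact umulA : associative umul.
Proof.
move=> u v w; apply: unitization_eq; rewrite /umul /= ?mulrA //.
rewrite !scalerDr !scalerA !amulDl !amulDr !amulZl !amulZr amulA !addrA.
rewrite [w.1 * u.1]mulrC [w.1 * v.1]mulrC.
by rewrite [LHS](ACl (1*2*4*6*3*5*7)).
Qed.

Fact umul1l : left_id uone umul.
Proof.
by move=> v; apply: unitization_eq; rewrite /umul /= ?mul1r // scale1r scaler0 amul0l !addr0.
Qed.

Fact umul1r : right_id uone umul.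
Proof.
by move=> v; apply: unitization_eq; rewrite /umul /= ?mulr1 // scale1r scaler0 amul0r add0r addr0.
Qed.

Fact umulDl : left_distributive umul +%R.
Proof.
move=> u v w; apply: unitization_eq; rewrite /umul /= ?mulrDl //.
rewrite !scalerDl !scalerDr amulDl !addrA.
by rewrite [LHS](ACl (1*3*5*2*4*6)).
Qed.

Fact umulDr : right_distributive umul +%R.
Proof.
move=> u v w; apply: unitization_eq; rewrite /umul /= ?mulrDr //.
rewrite !scalerDl !scalerDr amulDr !addrA.
by rewrite [LHS](ACl (1*3*5*2*4*6)).
Qed.

Fact uone_neq0 : uone != 0.
Proof. by apply/eqP => /(congr1 fst) /eqP; rewrite oner_eq0. Qed.

HB.instance Definition _ := GRing.Zmodule_isNzRing.Build (unitization A)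
  umulA umul1l umul1r umulDl umulDr uone_neq0.

Lemma umul1E v w : (v * w).1 = v.1 * w.1. Proof. by []. Qed.
Lemma umul2E v w : (v * w).2 = v.1 *: w.2 + w.1 *: v.2 + amul v.2 w.2.
Proof. by []. Qed.
Lemma uscale1E c v : (c *: v).1 = c * v.1. Proof. by []. Qed.
Lemma uscale2E c v : (c *: v).2 = c *: v.2. Proof. by []. Qed.
Definition uE := (umul1E, umul2E, uscale1E, uscale2E).

Fact uscaleAl c (v w : unitization A) : c *: (v * w) = (c *: v) * w.
Proof.
apply: unitization_eq; rewrite !uE ?mulrA // !scalerDr amulZl !scalerA.
by rewrite [w.1 * c]mulrC.
Qed.

HB.instance Definition _ := GRing.Lmodule_isLalgebra.Build R[i] (unitization A) uscaleAl.

Fact uscaleAr c (v w : unitization A) : c *: (v * w) = v * (c *: w).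
Proof.
apply: unitization_eq; rewrite !uE 1?mulrCA // !scalerDr amulZr !scalerA.
by rewrite [v.1 * c]mulrC.
Qed.

HB.instance Definition _ := GRing.Lalgebra_isAlgebra.Build R[i] (unitization A) uscaleAr.

Lemma uactM v w x : uact (v * w) x = uact v (uact w x).
Proof.
by rewrite /uact !uE !scalerDr !amulDl !amulDr !scalerA !amulZl !amulZr amulA !addrA.
Qed.

Variable (p : A -> R).
Hypothesis pC : Cstar_seminorm p.

Let p0 := cseminorm0 pC.
Let pge0 := cseminorm_ge0 pC.
Let pD := cseminormD pC.
Let pZ := cseminormZ pC.
Let pM := cseminormM pC.
Let pCC := cseminormC pC.

Let crude v x : p (uact v x) <= (cabs v.1 + p v.2) * p x.
Proof. by apply: le_trans (pD _ _) _; rewrite pZ mulrDl lerD2l pM. Qed.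

(** The seminorm of left multiplication on [A]. The sum of [|c|] and [p a] only bounds it; this one
    satisfies the C*-identity and restricts to [p]. *)
Definition unorm v : R := sup [set p (uact v x) | x in [set x | p x <= 1]].

Let unorm_has_sup v : has_sup [set p (uact v x) | x in [set x | p x <= 1]].
Proof.
split; first by exists (p (uact v 0)); exists 0 => //=; rewrite p0.
exists (cabs v.1 + p v.2) => _ [x /= x1 <-].
by apply: le_trans (crude _ _) _; rewrite ler_piMr // addr_ge0 ?cabs_ge0.
Qed.

Let uactZ v c x : uact v (c *: x) = c *: uact v x.
Proof. by rewrite /uact scalerDr amulZr !scalerA mulrC. Qed.

Let unorm_ge v x : p (uact v x) <= unorm v * p x.
Proof.
have h y : p y <= 1 -> p (uact v y) <= unorm v.
  by move=> y1; apply: sup_upper_bound => //; exists y.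
have [x0|x0] := eqVneq (p x) 0.
  by apply: le_trans (crude _ _) _; rewrite x0 !mulr0.
have xp : 0 < p x by rewrite lt_def x0 pge0.
have := h ((p x)^-1%:C *: x); rewrite uactZ !pZ cabs_real ger0_norm ?invr_ge0 //.
by rewrite mulVf // mulrC ler_pdivrMr //; apply.
Qed.

Let unorm_ge0 v : 0 <= unorm v.
Proof.
apply: (@le_trans _ _ (p (uact v 0))) => //.
by apply: sup_upper_bound => //; exists 0 => //=; rewrite p0.
Qed.

Let unorm_le v (M : R) : 0 <= M -> (forall x, p (uact v x) <= M * p x) -> unorm v <= M.
Proof.
move=> M0 h; apply: ge_sup; first by case: (unorm_has_sup v).
by move=> _ [x /= x1 <-]; apply: le_trans (h x) _; rewrite ler_piMr.
Qed.

Let unormD v w : unorm (v + w) <= unorm v + unorm w.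
Proof.
apply: unorm_le; first by rewrite addr_ge0.
move=> x; rewrite mulrDl; apply: le_trans (lerD (unorm_ge _ _) (unorm_ge _ _)).
by rewrite /uact /= scalerDl amulDl addrACA pD.
Qed.

Let unormZle c v : unorm (c *: v) <= cabs c * unorm v.
Proof.
apply: unorm_le; first by rewrite mulr_ge0 ?cabs_ge0.
move=> x; rewrite /uact /= -scalerA amulZl -scalerDr pZ -mulrA.
by rewrite ler_wpM2l ?cabs_ge0 // unorm_ge.
Qed.

Let unormZ c v : unorm (c *: v) = cabs c * unorm v.
Proof.
apply/le_anti; rewrite unormZle /=.
have [->|c0] := eqVneq c 0; first by rewrite cabs0 mul0r.
have cp : 0 < cabs c.
  by rewrite lt_def cabs_ge0 andbT; apply: contra c0 => /eqP /cabs_eq0 ->.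
rewrite mulrC -ler_pdivlMr // mulrC.
have := unormZle c^-1 (c *: v); rewrite scalerA mulVf // scale1r.
suff -> : cabs c^-1 = (cabs c)^-1 by [].
by apply: (mulfI (lt0r_neq0 cp)); rewrite -cabsM !divff ?cabs1 // gt_eqF.
Qed.

Let unormM v w : unorm (v * w) <= unorm v * unorm w.
Proof.
apply: unorm_le; first by rewrite mulr_ge0.
move=> x; rewrite uactM; apply: le_trans (unorm_ge _ _) _.
by rewrite -mulrA ler_wpM2l // unorm_ge.
Qed.

Let star_uact v x y : amul (star (uact v x)) y = amul (star x) (uact (ustar v) y).
Proof.
by rewrite /uact /= starD starZ starM amulDl amulDr amulZl amulZr amulA.
Qed.

(** The C*-identity of [p] at [uact v x] moves the adjoint of [v] to the right-hand factor, where
    [ustar v * v] acts on [x]. *)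
Let unormC_ge v : unorm v ^+ 2 <= unorm (ustar v * v).
Proof.
have h x : p (uact v x) ^+ 2 <= unorm (ustar v * v) * p x ^+ 2.
  rewrite -pCC star_uact -uactM; apply: le_trans (pM _ _) _.
  rewrite (cseminorm_star pC); apply: le_trans (ler_wpM2l (pge0 _) (unorm_ge _ _)) _.
  by rewrite expr2 mulrCA.
have s0 : 0 <= unorm (ustar v * v) by [].
rewrite -[leRHS]sqr_sqrtr // ler_pXn2r ?nnegrE ?sqrtr_ge0 //.
apply: unorm_le; rewrite ?sqrtr_ge0 // => x.
by rewrite -(@ler_pXn2r _ 2) ?nnegrE ?mulr_ge0 ?sqrtr_ge0 // exprMn sqr_sqrtr.
Qed.

Let ustarK : involutive ustar.
Proof. by move=> v; apply: unitization_eq; rewrite /= ?conjcK ?starK. Qed.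

Let unormC v : unorm (ustar v * v) = unorm v ^+ 2.
Proof.
have le w : unorm w <= unorm (ustar w).
  have [->//|w0] := eqVneq (unorm w) 0.
  have wp : 0 < unorm w by rewrite lt_def w0 unorm_ge0.
  by rewrite -(ler_pM2r wp) -expr2; apply: le_trans (unormC_ge w) (unormM _ _).
apply/le_anti; rewrite unormC_ge andbT; apply: le_trans (unormM _ _) _.
by rewrite expr2 ler_wpM2r // -{2}(ustarK v) le.
Qed.

Let ustarD v w : ustar (v + w) = ustar v + ustar w.
Proof. by apply: unitization_eq; rewrite /= ?starD ?rmorphD. Qed.

Let ustarZ c v : ustar (c *: v) = c^*%C *: ustar v.
Proof. by apply: unitization_eq; rewrite /= ?starZ ?rmorphM. Qed.

Let ustarM v w : ustar (v * w) = ustar w * ustar v.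
Proof.
apply: unitization_eq; rewrite /= ?rmorphM /= 1?mulrC //.
by rewrite !starD !starZ starM [_ *: star w.2 + _]addrC.
Qed.

Definition uinj a : unitization A := (0, a).

Let uinjM a b : uinj (amul a b) = uinj a * uinj b.
Proof. by apply: unitization_eq; rewrite /= ?mulr0 // !scale0r !add0r. Qed.

Let uinjD a b : uinj (a + b) = uinj a + uinj b.
Proof. by apply: unitization_eq; rewrite /= ?addr0. Qed.

Let uinjN a : uinj (- a) = - uinj a.
Proof. by apply: unitization_eq; rewrite /= ?oppr0. Qed.

Let uinj_star a : uinj (star a) = ustar (uinj a).
Proof. by apply: unitization_eq; rewrite /= ?oppr0. Qed.

Let unorm_inj a : unorm (uinj a) = p a.
Proof.
have actE x : uact (uinj a) x = amul a x by rewrite /uact scale0r add0r.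
apply/le_anti/andP; split; first by apply: unorm_le => // x; rewrite actE.
have [->//|a0] := eqVneq (p a) 0.
have ap : 0 < p a by rewrite lt_def a0 pge0.
have := unorm_ge (uinj a) (star a).
by rewrite actE (cseminormCr pC) (cseminorm_star pC) expr2 ler_pM2r.
Qed.

(** [norm_one_sub_adj] in a form without unit, obtained by letting [1 - a^* a] act on [x]. *)
Lemma cseminorm_one_sub a : p (amul (star a) a) <= 1 ->
  forall x, p (x - amul (amul (star a) a) x) <= p x.
Proof.
move=> a1 x.
have := norm_one_sub_adj ustarD ustarZ ustarM ustarK unormD unormZ unormM unormC (a := uinj a).
rewrite -uinj_star -uinjM unorm_inj => /(_ a1) h.
have := unorm_ge (1 - uinj (amul (star a) a)) x.
rewrite {1}/uact /= subr0 scale1r add0r amulNl => /le_trans; apply.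
by rewrite ler_piMl.
Qed.

Lemma cseminorm_adj_mono k l b d : p (amul (star b) b) <= 1 ->
  l - (amul (star k) k + amul (star k) k - amul (amul (star k) (amul (star b) b)) k) =
    amul (star d) d -> p k ^+ 2 <= p l.
Proof.
move=> b1 e.
have := norm_adj_mono ustarD ustarZ ustarM ustarK unormD unormZ unormM unormC
  (k := uinj k) (l := uinj l) (b := uinj b) (d := uinj d).
rewrite -!uinj_star -!uinjM !unorm_inj => /(_ b1); apply; rewrite -e.
rewrite mulrBr mulr1 mulrBl -!uinjM -!uinjN -!uinjD -!uinjN -!uinjD.
by rewrite [in RHS]addrAC.
Qed.

End Unitization.

Lemma ereal_cvg0P {R : realType} {T : Type} (F : set_system T) (g : T -> \bar R) :
  Filter F -> (forall x, (0 <= g x)%E) ->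
  (g x @[x --> F] --> 0%E) <-> (forall e : R, 0 < e -> \forall x \near F, (g x <= e%:E)%E).
Proof.
move=> FF g0; split=> [/fine_cvgP[fin cv] e e0|h].
  have := cv => /cvgrPdist_le /(_ e e0) h.
  near=> x.
  have gf : g x \is a fin_num by near: x.
  rewrite -(fineK gf) lee_fin.
  have : `|0 - (fine \o g) x| <= e by near: x.
  rewrite sub0r normrN /=; exact: le_trans (ler_norm _).
apply/fine_cvgP; split.
  near=> x; have h1 : (g x <= 1%:E)%E by near: x; exact: h.
  by rewrite ge0_fin_numE // (le_lt_trans h1) // ltry.
apply/cvgrPdist_le => e e0; near=> x.
have h1 : (g x <= e%:E)%E by near: x; exact: h.
have gf : g x \is a fin_num by rewrite ge0_fin_numE // (le_lt_trans h1) // ltry.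
rewrite sub0r normrN /= ger0_norm; last by rewrite fine_ge0.
by rewrite -lee_fin fineK.
Unshelve. all: by end_near. Qed.

(** * Seminorms on Hilbert modules and on their operators *)

Section HilbertModuleFacts.
Context {R : realType} {A : locallyCstarType R} {E : hilbertModType A}.
Implicit Types (x y z : E) (a b : A) (c : R[i]) (p q : A -> R) (T S : E -> E).

Lemma innerBr x y z : inner x (y - z) = inner x y - inner x z.
Proof. by rewrite innerDr -scaleN1r innerZr scaleN1r. Qed.
Lemma inner0r x : inner x 0 = 0.
Proof. by have := innerZr 0 x (0 : E); rewrite !scale0r. Qed.
Lemma innerDl x y z : inner (x + y) z = inner x z + inner y z.
Proof. by rewrite -star_inner innerDr starD !star_inner. Qed.
Lemma innerZl c x y : inner (c *: x) y = c^*%C *: inner x y.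
Proof. by rewrite -star_inner innerZr starZ star_inner. Qed.
Lemma innerBl x y z : inner (x - y) z = inner x z - inner y z.
Proof. by rewrite -star_inner innerBr starB !star_inner. Qed.
Lemma inner_actl x y a : inner (act x a) y = amul (star a) (inner x y).
Proof. by rewrite -star_inner inner_act starM star_inner. Qed.
Lemma actNl x a : act (- x) a = - act x a.
Proof. by rewrite -scaleN1r actZl scaleN1r. Qed.
Lemma actBl x y a : act (x - y) a = act x a - act y a.
Proof. by rewrite actDl actNl. Qed.

Lemma eq_innerr x y : (forall z, inner z x = inner z y) -> x = y.
Proof.
move=> h; apply/eqP; rewrite -subr_eq0; apply/eqP/inner_eq0.
by rewrite innerBr h subrr.
Qed.

Section OneSeminorm.
Variable p : A -> R.
Hypothesis pC : Cstar_seminorm p.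

Lemma module_norm_ge0 x : 0 <= module_norm p x. Proof. exact: sqrtr_ge0. Qed.

Lemma module_norm2 x : module_norm p x ^+ 2 = p (inner x x).
Proof. by rewrite sqr_sqrtr // cseminorm_ge0. Qed.

Lemma module_normZ c x : module_norm p (c *: x) = cabs c * module_norm p x.
Proof.
apply/eqP; rewrite -(@eqrXn2 _ 2) ?mulr_ge0 ?module_norm_ge0 ?cabs_ge0 //.
rewrite exprMn !module_norm2 innerZl innerZr !(cseminormZ pC) mulrA.
by rewrite cabs_conj -expr2.
Qed.

(** For [z] in the unit ball, positivity of [<w - z <z, w>, w - z <z, w>>] is the hypothesis of
    [cseminorm_adj_mono]. The general case divides by the seminorm of [x] plus [e], as the former
    may vanish. *)
Lemma inner_le x y : p (inner x y) <= module_norm p x * module_norm p y.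
Proof.
have unit_case z w : module_norm p z <= 1 -> p (inner z w) <= module_norm p w.
  move=> z1; have [b hb] := inner_positive z.
  have [d hd] := inner_positive (w - act z (inner z w)).
  rewrite -(@ler_pXn2r _ 2) ?nnegrE ?module_norm_ge0 ?(cseminorm_ge0 pC) //.
  rewrite module_norm2; apply: (cseminorm_adj_mono pC (b := b) (d := d)).
    by rewrite -hb -module_norm2 expr_le1 // module_norm_ge0.
  rewrite -hd -hb innerBl !innerBr !inner_act !inner_actl star_inner.
  by rewrite !opprD !opprK !addrA.
apply: (@le_eps _ _ _ (module_norm p y)) => e e0.
have t0 : 0 < module_norm p x + e by rewrite ltr_wpDl // module_norm_ge0.
have := unit_case ((module_norm p x + e)^-1%:C *: x) y.
rewrite module_normZ innerZl (cseminormZ pC) cabs_conj !cabs_real.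
rewrite ger0_norm ?invr_ge0 ?(ltW t0) // ![_^-1 * _]mulrC !ler_pdivrMr // mul1r.
by rewrite lerDl (ltW e0) => /(_ isT); rewrite mulrDr [module_norm p x * _]mulrC.
Qed.

Lemma module_normD x y : module_norm p (x + y) <= module_norm p x + module_norm p y.
Proof.
rewrite -(@ler_pXn2r _ 2) ?nnegrE ?addr_ge0 ?module_norm_ge0 //.
rewrite module_norm2 innerDl !innerDr sqrrD.
apply: le_trans (cseminormD pC _ _) _.
apply: le_trans (lerD (cseminormD pC _ _) (cseminormD pC _ _)) _.
rewrite -!module_norm2; have := inner_le x y; have := inner_le y x; lra.
Qed.

Lemma module_norm_act x a : module_norm p (act x a) <= module_norm p x * p a.
Proof.
rewrite -(@ler_pXn2r _ 2) ?nnegrE ?mulr_ge0 ?module_norm_ge0 ?(cseminorm_ge0 pC) //.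
rewrite module_norm2 inner_act inner_actl exprMn module_norm2.
apply: le_trans (cseminormM pC _ _) _; rewrite expr2 mulrA.
rewrite ler_wpM2r ?(cseminorm_ge0 pC) // mulrC.
by apply: le_trans (cseminormM pC _ _) _; rewrite (cseminorm_star pC) mulrC.
Qed.

(** A bound by a real number keeps the extended reals of [op_seminorm] out of the estimates;
    [op_seminorm_leP] translates. *)
Definition op_le (T : E -> E) (M : R) := forall x, module_norm p (T x) <= M * module_norm p x.

Lemma op_le_theta y x : op_le (theta y x) (module_norm p y * module_norm p x).
Proof.
move=> z; apply: le_trans (module_norm_act _ _) _.
by rewrite -mulrA ler_wpM2l ?module_norm_ge0 // inner_le.
Qed.

Lemma op_leD T S (M K : R) : op_le T M -> op_le S K -> op_le (T \+ S) (M + K).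
Proof.
move=> h1 h2 x; apply: le_trans (module_normD _ _) _.
by rewrite mulrDl lerD.
Qed.

Lemma op_leZ c T (M : R) : op_le T M -> op_le (c *: T) (cabs c * M).
Proof.
move=> h x; rewrite -[(c *: T) x]/(c *: T x) module_normZ -mulrA.
by rewrite ler_wpM2l ?cabs_ge0.
Qed.

Lemma op_le_comp T S (M K : R) : 0 <= M -> op_le T M -> op_le S K -> op_le (T \o S) (M * K).
Proof.
move=> M0 h1 h2 x; apply: le_trans (h1 _) _.
by rewrite -mulrA ler_wpM2l.
Qed.

Lemma op_seminorm_ge0 T : (0 <= op_seminorm p T)%E.
Proof.
apply: (@le_trans _ _ (module_norm p (T 0))%:E); first by rewrite lee_fin module_norm_ge0.
apply: ereal_sup_ubound; exists 0 => //=.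
by rewrite /module_norm inner0r (cseminorm0 pC) sqrtr0.
Qed.

Lemma op_seminorm_leP T (M : R) : 0 <= M -> (forall c x, T (c *: x) = c *: T x) ->
  (op_seminorm p T <= M%:E)%E <-> op_le T M.
Proof.
move=> M0 TZ; split=> [h x|h].
  have h1 y : module_norm p y <= 1 -> module_norm p (T y) <= M.
    move=> y1; rewrite -lee_fin; apply: le_trans h; apply: ereal_sup_ubound; by exists y.
  apply: (@le_eps _ _ _ M) => e e0.
  have t0 : 0 < module_norm p x + e by rewrite ltr_wpDl // module_norm_ge0.
  have := h1 ((module_norm p x + e)^-1%:C *: x).
  rewrite TZ !module_normZ cabs_real ger0_norm ?invr_ge0 ?(ltW t0) //.
  by rewrite ![_^-1 * _]mulrC !ler_pdivrMr // mul1r lerDl (ltW e0) => /(_ isT); rewrite mulrDr.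
apply: ge_ereal_sup => _ [x /= x1 <-]; rewrite lee_fin.
by apply: le_trans (h x) _; rewrite ler_piMr.
Qed.

Lemma op_le_adj T T' (M : R) : 0 <= M -> is_adjoint T T' -> op_le T M -> op_le T' M.
Proof.
move=> M0 TT h x; apply: le_sqr_factor; rewrite ?mulr_ge0 ?module_norm_ge0 //.
rewrite module_norm2 -TT; apply: le_trans (inner_le _ _) _.
by rewrite mulrAC ler_wpM2r ?module_norm_ge0.
Qed.

End OneSeminorm.

Lemma adjointC T T' : is_adjoint T T' -> is_adjoint T' T.
Proof. by move=> h x y; rewrite -star_inner -h star_inner. Qed.

(* Plays the role of the contractivity of morphisms of C*-algebras. *)
Lemma op_le_mono p q T T' (M : R) : Cstar_seminorm p -> Cstar_seminorm q ->
  (forall a, p a <= q a) -> 0 <= M -> is_adjoint T T' -> op_le q T M -> op_le p T M.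
Proof.
move=> pC qC pq M0 TT h x.
have TT' := adjointC TT.
pose W z := T' (T z).
have Wadj : is_adjoint W W by move=> y z; rewrite /W TT' TT.
have Wq : op_le q W (M * M) by apply: op_le_comp => //; exact: (op_le_adj qC M0 TT).
have iterq n z : module_norm q (iter n W z) <= (M * M) ^+ n * module_norm q z.
  elim: n => [|n IH]; first by rewrite mul1r.
  rewrite iterS exprS -mulrA; apply: le_trans (Wq _) _.
  by rewrite ler_wpM2l // mulr_ge0.
(* Log-convexity comes from self-adjointness of [W = T' T]. The seminorm [q] only enters the
   constant [module_norm q x], which does not affect the rate [M * M]. *)
have := @logconvex_growth R (fun n => module_norm p (iter n W x)) (module_norm q x) (M * M).
rewrite mulr_ge0 // => /(_ isT (fun n => module_norm_ge0 p _)) h1.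
have {}h1 : module_norm p (W x) <= M * M * module_norm p x.
  apply: h1 => n.
    rewrite module_norm2 // iterS Wadj -!iterS; exact: inner_le.
  apply: (@le_trans _ _ (module_norm q (iter n W x))).
    by rewrite ler_sqrt ?pq // (cseminorm_ge0 qC).
  apply: le_trans (iterq n x) _; rewrite mulrC ler_wpM2r ?exprn_ge0 ?mulr_ge0 //.
  by rewrite ler_peMr ?module_norm_ge0 // ler1n.
rewrite -(@ler_pXn2r _ 2) ?nnegrE ?mulr_ge0 ?module_norm_ge0 //.
rewrite module_norm2 // TT; apply: le_trans (inner_le pC _ _) _.
apply: le_trans (ler_wpM2l (module_norm_ge0 p x) h1) _.
by rewrite exprMn !expr2 mulrCA mulrA.
Qed.

(** Continuous C*-seminorms are directed, so their balls form a filter base. *)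
Lemma cseminorm_max p q : cont_Cstar_seminorms p -> cont_Cstar_seminorms q ->
  cont_Cstar_seminorms (fun a => Num.max (p a) (q a)).
Proof.
move=> [pC pc] [qC qc]; have p0 := cseminorm_ge0 pC; have q0 := cseminorm_ge0 qC.
split; last first.
  by move=> a; apply: continuous_max; [exact: pc|exact: qc].
split.
- move=> a b; rewrite ge_max; apply/andP; split.
    by apply: le_trans (cseminormD pC _ _) _; rewrite lerD // le_max lexx.
  by apply: le_trans (cseminormD qC _ _) _; rewrite lerD // le_max lexx orbT.
- by move=> c a; rewrite (cseminormZ pC) (cseminormZ qC) maxr_pMr // cabs_ge0.
- move=> a b; rewrite ge_max; apply/andP; split.
    by apply: le_trans (cseminormM pC _ _) _; rewrite ler_pM // le_max lexx.
  by apply: le_trans (cseminormM qC _ _) _; rewrite ler_pM // le_max lexx orbT.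
- move=> a; rewrite (cseminormC pC) (cseminormC qC).
  have [pq|/ltW pq] := leP (p a) (q a).
    by apply/max_idPr; rewrite ler_pXn2r ?nnegrE.
  by apply/max_idPl; rewrite ler_pXn2r ?nnegrE.
Qed.

Lemma cseminorm_zero : cont_Cstar_seminorms (fun _ : A => 0 : R).
Proof.
split; last by move=> a; exact: cvg_cst.
by split=> *; rewrite ?addr0 ?mulr0 ?expr0n.
Qed.

Lemma finite_rank_bounded p T : Cstar_seminorm p -> finite_rank T ->
  linear T /\ exists2 M : R, 0 <= M & op_le p T M.
Proof.
move=> pC; pose P := [set T : E -> E | linear T /\ exists2 M : R, 0 <= M & op_le p T M].
suff h : @finite_rank _ _ E `<=` P by exact: h.
apply: smallest_sub => /=.
  split=> [|c S1 S2 [l1 [M1 M10 h1]] [l2 [M2 M20 h2]]].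
    split; first by move=> c x y; rewrite scaler0 addr0.
    exists 0 => // x; rewrite mul0r /= -[(0 : E -> E) x]/(0 : E).
    by rewrite /module_norm inner0r (cseminorm0 pC) sqrtr0.
  split=> [d x y|].
    rewrite -[LHS]/(c *: S1 (d *: x + y) + S2 (d *: x + y)) l1 l2.
    rewrite -[RHS]/(d *: (c *: S1 x + S2 x) + (c *: S1 y + S2 y)).
    by rewrite !scalerDr !scalerA addrACA [c * d]mulrC.
  exists (cabs c * M1 + M2); first by rewrite addr_ge0 ?mulr_ge0 ?cabs_ge0.
  by apply: op_leD => //; exact: op_leZ.
move=> _ [y [x ->]]; split.
  by move=> c z w; rewrite /theta innerDr innerZr actDr actZr.
exists (module_norm p y * module_norm p x); first by rewrite mulr_ge0 ?module_norm_ge0.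
exact: op_le_theta.
Qed.

Lemma compact_approx p T (e : R) : cont_Cstar_seminorms p -> compact_op T -> 0 < e ->
  exists2 S, finite_rank S & op_le p (S \- T) e.
Proof.
move=> pS [[Tl _] [F [FF Ffr FT]]] e0; have [pC _] := pS.
have h : \forall S \near F, (op_seminorm p (S \- T)%R <= e%:E)%E.
  exact: (ereal_cvg0P _ (fun S => op_seminorm_ge0 pC (S \- T))).1 (FT p pS) e e0.
have [S [Sf hS]] := filter_ex (filterI Ffr h).
exists S => //; apply/(op_seminorm_leP pC) => //; first exact: ltW.
move=> c x /=; have [Sl _] := finite_rank_bounded pC Sf.
have lZ (L : E -> E) : linear L -> L (c *: x) = c *: L x.
  move=> Ll; have L0 : L 0 = 0.
    by have := Ll (-1) 0 0; rewrite scaler0 addr0 scaleN1r addNr.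
  by have := Ll c x 0; rewrite L0 !addr0.
by rewrite !lZ // scalerBr.
Qed.

Lemma compact_bounded p T : cont_Cstar_seminorms p -> compact_op T ->
  exists2 M : R, 0 <= M & op_le p T M.
Proof.
move=> pS Tc; have [pC _] := pS.
have [S Sf hS] := compact_approx pS Tc ltr01.
have [_ [M M0 hM]] := finite_rank_bounded pC Sf.
exists (M + cabs (-1) * 1); first by rewrite addr_ge0 ?mulr_ge0 ?cabs_ge0.
have -> : T = S \+ (-1) *: (S \- T).
  apply/funext => x; rewrite /= -[((-1) *: (S \- T)) x]/((-1) *: (S x - T x)).
  by rewrite scaleN1r opprB addrC subrK.
by apply: op_leD => //; exact: op_leZ.
Qed.

End HilbertModuleFacts.

(** * Representations *)

Section OperatorNorm.
Context {R : realType} {H : hilbertType R}.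
Implicit Types (T : H -> H) (M : R).

Lemma opnorm_ge0 T : (0 <= opnorm T)%E.
Proof.
apply: (@le_trans _ _ (rnorm (T 0))%:E); first by rewrite lee_fin rnorm_ge0.
by apply: ereal_sup_ubound; exists 0 => //=; rewrite rnorm0.
Qed.

Lemma opnorm_leP T M : 0 <= M -> (forall c x, T (c *: x) = c *: T x) ->
  (opnorm T <= M%:E)%E <-> forall u, rnorm (T u) <= M * rnorm u.
Proof.
move=> M0 TZ; split=> [h x|h].
  have h1 y : rnorm y <= 1 -> rnorm (T y) <= M.
    by move=> y1; rewrite -lee_fin; apply: le_trans h; apply: ereal_sup_ubound; exists y.
  apply: (@le_eps _ _ _ M) => e e0.
  have t0 : 0 < rnorm x + e by rewrite ltr_wpDl // rnorm_ge0.
  have := h1 ((rnorm x + e)^-1%:C *: x).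
  rewrite TZ !rnormZ cabs_real ger0_norm ?invr_ge0 ?(ltW t0) //.
  by rewrite ![_^-1 * _]mulrC !ler_pdivrMr // mul1r lerDl (ltW e0) => /(_ isT); rewrite mulrDr.
apply: ge_ereal_sup => _ [x /= x1 <-]; rewrite lee_fin.
by apply: le_trans (h x) _; rewrite ler_piMr.
Qed.

End OperatorNorm.

(** * Seminorm bounds and cyclic subspaces of a representation *)

Section RepresentationBounds.
Context {R : realType} {A : locallyCstarType R}.
Variable phi : representation A.
Implicit Types (a b : A) (u v : phi) (c : R[i]).

Lemma repD a b u : rep_map phi (a + b) u = rep_map phi a u + rep_map phi b u.
Proof. by have := rep_linear 1 a b u; rewrite !scale1r. Qed.
Lemma rep0 u : rep_map phi 0 u = 0.
Proof. by apply: (addrI (rep_map phi 0 u)); rewrite -repD !addr0. Qed.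
Lemma repZ c a u : rep_map phi (c *: a) u = c *: rep_map phi a u.
Proof. by have := rep_linear c a 0 u; rewrite rep0 !addr0. Qed.
Lemma repN a u : rep_map phi (- a) u = - rep_map phi a u.
Proof. by rewrite -scaleN1r repZ scaleN1r. Qed.
Lemma repB a b u : rep_map phi (a - b) u = rep_map phi a u - rep_map phi b u.
Proof. by rewrite repD repN. Qed.

Lemma rep_star_l a u v : hdot (rep_map phi (star a) u) v = hdot u (rep_map phi a v).
Proof. by rewrite rep_star starK. Qed.

Lemma rep_bound a : exists2 M : R, 0 <= M & forall u, rnorm (rep_map phi a u) <= M * rnorm u.
Proof.
have fin : opnorm (rep_map phi a) \is a fin_num.
  by rewrite ge0_fin_numE ?opnorm_ge0 // rep_bounded.
exists (fine (opnorm (rep_map phi a))); first by rewrite fine_ge0 // opnorm_ge0.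
apply/opnorm_leP; first by rewrite fine_ge0 // opnorm_ge0.
  by move=> c x; exact: linearZ.
by rewrite fineK.
Qed.

Lemma rep_near0 (e : R) : 0 < e ->
  nbhs (0 : A) [set a | forall u, rnorm (rep_map phi a u) <= e * rnorm u].
Proof.
move=> e0.
have h0 := (ereal_cvg0P (nbhs_filter (0 : A)) (fun b => opnorm_ge0 (rep_map phi b \- rep_map phi 0)%R)).1
  (rep_continuous phi 0) e e0.
apply: (@filterS _ _ (nbhs_filter (0 : A)) _ _ _ h0) => a ha; apply/opnorm_leP; first exact: ltW.
  by move=> c x; exact: linearZ.
apply: le_trans ha; rewrite le_eqVlt; apply/orP; left; apply/eqP; congr (opnorm _).
by apply/funext => u; rewrite /= rep0 subr0.
Qed.

(** The topology of [A] is specified through filters, so the specification is applied to the filter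
    of seminorm balls: its convergence to [0] puts one ball inside the neighbourhood of
    [rep_near0]. *)
Lemma rep_seminorm_bound : exists (p : A -> R) (C : R), [/\ cont_Cstar_seminorms p, 0 <= C &
  forall a u, rnorm (rep_map phi a u) <= C * p a * rnorm u].
Proof.
pose D := [set pe : (A -> R) * R | cont_Cstar_seminorms pe.1 /\ 0 < pe.2].
pose F := filter_from D (fun pe => [set a | pe.1 a < pe.2]).
have FF : ProperFilter F.
  apply: filter_from_proper; last first.
    by move=> [p e] [/= [pC _] e0]; exists 0; rewrite /= (cseminorm0 pC).
  apply: filter_from_filter.
    by exists (fun=> 0, 1); split => //; exact: cseminorm_zero.
  move=> [p e] [q d] [/= pS e0] [/= qS d0].
  exists (fun a => Num.max (p a) (q a), Num.min e d).
    by split=> /=; [exact: cseminorm_max|rewrite lt_min e0].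
  by move=> a /=; rewrite gt_max !lt_min => /andP[/andP[-> _] /andP[_ ->]].
have F0 : F --> (0 : A).
  apply/topology_Cstar_seminorms => p pS; apply/cvgrPdist_lt => e e0; exists (p, e) => // a /=.
  have [pC _] := pS.
  by rewrite sub0r normrN ger0_norm // cseminorm_ge0.
have [[p e] [/= pS e0] h] := F0 _ (rep_near0 ltr01).
have [pC _] := pS.
(* The ball is open, so [a] is rescaled by some [t > p a]; [t = 2 p a] gives the factor [2], and for
   [p a = 0] every [t > 0] is allowed. *)
exists p, (2 / e); split=> // [|a u]; first by rewrite divr_ge0 // ltW.
have key (t : R) : 0 < t -> p a < t -> rnorm (rep_map phi a u) <= t / e * rnorm u.
  move=> t0 pt; have := h ((e / t)%:C *: a) _ u.
  rewrite repZ rnormZ cabs_real ger0_norm ?divr_ge0 ?(ltW e0) ?(ltW t0) // mul1r.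
  have -> : e / t = (t / e)^-1 by rewrite invf_div.
  rewrite [_^-1 * _]mulrC ler_pdivrMr ?divr_gt0 // [rnorm u * _]mulrC; apply => /=.
  rewrite (cseminormZ pC) cabs_real ger0_norm ?invr_ge0 ?divr_ge0 ?(ltW e0) ?(ltW t0) //.
  by rewrite invf_div mulrAC ltr_pdivrMr // ltr_pM2l.
have [pa0|pa0] := eqVneq (p a) 0.
  rewrite pa0 mulr0 mul0r; apply: (@le_eps _ _ _ (rnorm u / e)) => t t0.
  rewrite add0r; have := key t t0; rewrite pa0 => /(_ t0).
  by rewrite mulrC mulrA mulrAC [rnorm u / e * t]mulrC mulrA [t * _]mulrC mulrAC.
have pap : 0 < p a by rewrite lt_def pa0 cseminorm_ge0.
have := key (2 * p a); rewrite pmulr_rgt0 // => /(_ pap).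
by rewrite ltr_pMl // ltr1n => /(_ isT); rewrite [2 * p a / e]mulrAC.
Qed.

(** Such a [u] is orthogonal to every [phi a x], yet some [phi a x] comes arbitrarily close to
    it. *)
Lemma nondegenerate_inj u : nondegenerate phi -> (forall a, rep_map phi a u = 0) -> u = 0.
Proof.
move=> nd h; apply: rnorm_le0; apply: (@le_eps _ _ _ 1) => e e0; rewrite add0r mul1r.
have op : open [set y : phi | rnorm (u - y) < e].
  rewrite openE => y /= hy; apply/nbhs_rnormP; exists (e - rnorm (u - y)); first by rewrite subr_gt0.
  move=> z hz; have := rnormD (u - y) (y - z); rewrite addrA subrK /= => /le_lt_trans; apply.
  by rewrite -ltrBrDl.
have [|y [/= uy [a [x yE]]]] := nd _ _ op; first by exists u; rewrite /= subrr rnorm0.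
have o : hdot u y = 0 by rewrite yE -rep_star_l h hdot0l.
have := rnorm2B u y; rewrite o mulr0 subr0 => e1.
rewrite -(@ler_pXn2r _ 2) ?nnegrE ?rnorm_ge0 ?(ltW e0) //.
have : rnorm (u - y) ^+ 2 <= e ^+ 2 by rewrite ler_pXn2r ?nnegrE ?rnorm_ge0 ?(ltW e0) // ltW.
have := sqr_ge0 (rnorm y); lra.
Qed.

Definition orbit_clos u : set phi :=
  [set v | forall e : R, 0 < e -> exists a, rnorm (v - rep_map phi a u) < e].

Lemma orbit_closure_subspace u : subspace (orbit_clos u).
Proof.
split=> [d d0|c x y Mx My d d0]; first by exists 0; rewrite rep0 subrr rnorm0.
have C0 : 0 < cabs c + 1 by rewrite ltr_pwDr // cabs_ge0.
have [|a ha] := Mx (d / 2 / (cabs c + 1)); first by rewrite !divr_gt0.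
have [|b hb] := My (d / 2); first by rewrite divr_gt0.
exists (c *: a + b); rewrite rep_linear opprD addrACA -scalerBr.
apply: le_lt_trans (rnormD _ _) _; rewrite rnormZ.
have := rnorm_ge0 (x - rep_map phi a u); have := cabs_ge0 c.
by move: ha; rewrite ltr_pdivlMr // => h1 c0 r0; nra.
Qed.

Lemma orbit_closure_closed u : closed (orbit_clos u).
Proof.
apply/closed_rnormP => x hx d d0.
have [|m Mm xm] := hx (d / 2); first by rewrite divr_gt0.
have [|a ma] := Mm (d / 2); first by rewrite divr_gt0.
by exists a; have := rnormD (x - m) (m - rep_map phi a u); rewrite addrA subrK; lra.
Qed.

Lemma orbit_closure_invariant u a v : orbit_clos u v -> orbit_clos u (rep_map phi a v).
Proof.
move=> Mv d d0; have [K K0 hK] := rep_bound a.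
have K1 : 0 < K + 1 by rewrite ltr_wpDl.
have [|b hb] := Mv (d / (K + 1)); first by rewrite divr_gt0.
exists (amul a b); rewrite rep_mul -linearB; apply: le_lt_trans (hK _) _.
move: hb; rewrite ltr_pdivlMr //; have := rnorm_ge0 (v - rep_map phi b u); nra.
Qed.

(** If [m] is the projection of [u] on the orbit closure, then [n = phi a (u - m)] lies in the
    closure and [<n, n> = <u - m, phi a^* n> = 0]. So every [phi a] kills [u - m]. This replaces an
    approximate unit. *)
Lemma orbit_closure u : (forall v, (forall a, rep_map phi a v = 0) -> v = 0) ->
  orbit_clos u u.
Proof.
move=> inj; have Ms := orbit_closure_subspace u.
have Mu a : orbit_clos u (rep_map phi a u) by move=> d d0; exists a; rewrite subrr rnorm0.
have [m Mm hm] := orthogonal_projection u Ms (@orbit_closure_closed u).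
suff /eqP : u - m = 0 by rewrite subr_eq0 => /eqP um; move: Mm; rewrite -um.
apply: inj => a; set n := rep_map phi a (u - m).
have Mn : orbit_clos u n.
  by rewrite /n linearB; exact: (subspaceB Ms (Mu a) (orbit_closure_invariant a Mm)).
apply: rnorm_eq0; apply/eqP; rewrite -sqrf_eq0 rnorm2E.
by rewrite {1}/n rep_star hm //; exact: orbit_closure_invariant.
Qed.

(** [nondegenerate] speaks of the set of values and not of its span; the converse holds since the
    single vectors [phi a u] already approximate [u]. *)
Lemma nondegenerateP :
  nondegenerate phi <-> forall u, (forall a, rep_map phi a u = 0) -> u = 0.
Proof.
split=> [nd u|inj O [u Ou] Oo]; first exact: nondegenerate_inj.
have /nbhs_rnormP[e e0 he] : nbhs u O by exact: open_nbhs_nbhs.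
have [a ha] := orbit_closure u inj e0.
by exists (rep_map phi a u); split; [exact: he|exists a, u].
Qed.

End RepresentationBounds.

(** * Representations of the algebra of compact operators *)

Section CompactRepresentation.
Context {R : realType} {A B : locallyCstarType R} {E : hilbertModType A}.
Variable f : B -> E -> E.
Hypothesis fiso : iso_compact_op f.
Implicit Types (b : B) (x y : E).

Lemma iso_compact b : compact_op (f b).
Proof. by case: fiso => -[hf _ _] _ _ _ _; exact: hf. Qed.

Lemma iso_inj b b' : f b = f b' -> b = b'.
Proof. by case: fiso => -[_ hf _] _ _ _ _ h; apply: hf; rewrite ?inE. Qed.

Lemma iso_surj T : compact_op T -> exists b, f b = T.
Proof. by case: fiso => -[_ _ hf] _ _ _ _ /hf[b _ <-]; exists b. Qed.

Lemma iso_lin c b b' : f (c *: b + b') = c *: f b + f b'. Proof. by case: fiso. Qed.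
Lemma iso_mul b b' x : f (amul b b') x = f b (f b' x).
Proof. by case: fiso => _ _ [h _] _ _; rewrite h. Qed.
Lemma iso_adj b : is_adjoint (f b) (f (star b)).
Proof. by case: fiso => _ _ [_ h] _ _. Qed.

Lemma iso_linear b : linear (f b). Proof. by have [[]] := iso_compact b. Qed.

Lemma iso_add b b' x : f (b + b') x = f b x + f b' x.
Proof. by have := iso_lin 1 b b'; rewrite !scale1r => ->. Qed.
Lemma iso0 : f 0 = 0.
Proof.
apply/funext => x; apply: (addrI (f 0 x)).
by rewrite -iso_add addr0; exact/esym/addr0.
Qed.
Lemma iso_scale c b x : f (c *: b) x = c *: f b x.
Proof. by have := iso_lin c b 0; rewrite iso0 !addr0 => ->. Qed.

Lemma iso_bounded p b : cont_Cstar_seminorms p -> exists2 M : R, 0 <= M & op_le p (f b) M.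
Proof. by move=> pS; apply: compact_bounded => //; exact: iso_compact. Qed.

Lemma theta_adjoint x y : is_adjoint (theta y x) (theta x y).
Proof. by move=> z w; rewrite /theta inner_actl inner_act star_inner. Qed.

Lemma theta_compact x y : compact_op (theta y x).
Proof.
split.
  split; first by move=> c z w; rewrite /theta innerDr innerZr actDr actZr.
  by exists (theta x y); exact: theta_adjoint.
exists (globally [set theta y x]); split.
- exact: (@globally_properfilter _ _ (theta y x)).
- by move=> _ -> S [_]; apply; exists y, x.
- move=> p [pC _]; apply/ereal_cvg0P; first by move=> S; exact: op_seminorm_ge0.
  move=> e e0 _ /= ->; apply/op_seminorm_leP => //; rewrite ?(ltW e0) //.
    by move=> c z; rewrite /= !subrr scaler0.
  move=> z /=; rewrite subrr /module_norm inner0r (cseminorm0 pC) sqrtr0.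
  by rewrite mulr_ge0 ?sqrtr_ge0 // ltW.
Qed.

Lemma iso_theta x y : exists b, f b = theta y x.
Proof. exact/iso_surj/theta_compact. Qed.

(** Counterpart of [rep_seminorm_bound], through continuity of the inverse of [f]. That balls of
    operator seminorms form a filter base rests on [op_le_mono]: a bound for the maximum of two
    seminorms must imply a bound for each. *)
Lemma compact_rep_bound (psi : representation B) : exists (p : A -> R) (C : R),
  [/\ cont_Cstar_seminorms p, 0 <= C & forall b (M : R) (u : psi), 0 <= M -> op_le p (f b) M ->
    rnorm (rep_map psi b u) <= C * M * rnorm u].
Proof.
pose D := [set pe : (A -> R) * R | cont_Cstar_seminorms pe.1 /\ 0 < pe.2].
pose F := filter_from D (fun pe => [set b | op_le pe.1 (f b) pe.2]).
have FF : ProperFilter F.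
  apply: filter_from_proper; last first.
    move=> [p e] [/= [pC _] e0]; exists 0; rewrite /= iso0 => x.
    by rewrite /module_norm inner0r (cseminorm0 pC) sqrtr0 mulr_ge0 ?sqrtr_ge0 // ltW.
  apply: filter_from_filter.
    by exists (fun=> 0, 1); split => //; exact: cseminorm_zero.
  move=> [p e] [q d] [/= pS e0] [/= qS d0].
  have mS := cseminorm_max pS qS.
  exists (fun a => Num.max (p a) (q a), Num.min e d).
    by split=> /=; [exact: mS|rewrite lt_min e0].
  have [pC _] := pS; have [qC _] := qS; have [mC _] := mS.
  have m0 : 0 <= Num.min e d by rewrite le_min !ltW.
  move=> b /= hb; split => x.
    apply: le_trans (op_le_mono pC mC _ m0 (iso_adj b) hb x) _.
      by move=> a; rewrite le_max lexx.
    by rewrite ler_wpM2r ?module_norm_ge0 // ge_min lexx.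
  apply: le_trans (op_le_mono qC mC _ m0 (iso_adj b) hb x) _.
    by move=> a; rewrite le_max lexx orbT.
  by rewrite ler_wpM2r ?module_norm_ge0 // ge_min lexx orbT.
have F0 : F --> (0 : B).
  have [_ _ _ _ inv_cont] := fiso; apply: inv_cont => p pS; have [pC _] := pS.
  apply/ereal_cvg0P; first by move=> S; exact: op_seminorm_ge0.
  move=> e e0; exists (p, e) => // b /= hb; rewrite iso0.
  have -> : (f b \- 0)%R = f b by apply/funext => x; rewrite /= subr0.
  apply/op_seminorm_leP => //; first exact: ltW.
  by move=> c x; have := iso_linear b c x 0; rewrite !addr0 => ->;
    have := iso_linear b (-1) 0 0; rewrite scaler0 addr0 scaleN1r addNr => ->; rewrite addr0.
have [[p e] [/= pS e0] h] := F0 _ (rep_near0 psi ltr01).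
have [pC _] := pS.
exists p, e^-1; split=> // [|b M u M0 hM]; first by rewrite invr_ge0 ltW.
have key (t : R) : 0 < t -> M <= t -> rnorm (rep_map psi b u) <= t / e * rnorm u.
  move=> t0 Mt; have := h ((e / t)%:C *: b) _ u.
  rewrite repZ rnormZ cabs_real ger0_norm ?divr_ge0 ?(ltW e0) ?(ltW t0) // mul1r.
  have -> : e / t = (t / e)^-1 by rewrite invf_div.
  rewrite [_^-1 * _]mulrC ler_pdivrMr ?divr_gt0 // [rnorm u * _]mulrC; apply => /= x.
  rewrite iso_scale module_normZ // cabs_real ger0_norm ?invr_ge0 ?divr_ge0 ?(ltW t0) ?(ltW e0) //.
  rewrite invf_div mulrAC ler_pdivrMr // -mulrA ler_pM2l //.
  apply: le_trans (hM x) _; rewrite [leRHS]mulrC.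
  by rewrite ler_wpM2r ?module_norm_ge0.
(* [M] may be [0], so the rescaling uses [M + t]. *)
apply: (@le_eps _ _ _ (rnorm u / e)) => t t0.
have := key (M + t); rewrite ltr_wpDl // lerDl (ltW t0) => /(_ isT isT) /le_trans; apply.
by rewrite !mulrDl [e^-1 * M]mulrC lerD2l [t / e]mulrC mulrAC [_^-1 * _]mulrC.
Qed.

End CompactRepresentation.

(** * Positivity of the kernel induced by an algebra-valued form *)

Section KernelPositivity.
Context {R : realType} {C : locallyCstarType R} (phi : representation C).
Context {X : zmodType} (k : X -> X -> C) (r : X -> C -> X).
Hypothesis phi_inj : forall u : phi, (forall a, rep_map phi a u = 0) -> u = 0.
Hypothesis kDr : forall x y z, k x (y + z) = k x y + k x z.
Hypothesis kstar : forall x y, star (k x y) = k y x.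
Hypothesis kr : forall x y a, k x (r y a) = amul (k x y) a.
Hypothesis kpos : forall x (h : phi), 0 <= complex.Re (hdot (rep_map phi (k x x) h) h).

Let kDl x y z : k (x + y) z = k x z + k y z.
Proof. by rewrite -kstar kDr starD !kstar. Qed.

Let krl x y a : k (r x a) y = amul (star a) (k x y).
Proof. by rewrite -kstar kr starM kstar. Qed.

Let k0r x : k x 0 = 0.
Proof. by apply: (addrI (k x 0)); rewrite -kDr !addr0. Qed.

Let k0l x : k 0 x = 0.
Proof. by rewrite -kstar k0r star0. Qed.

Let Q n (x : nat -> X) (h g : nat -> phi) : R[i] :=
  \sum_(i < n) \sum_(j < n) hdot (rep_map phi (k (x j) (x i)) (h i)) (g j).

(** When all vectors lie in one orbit, the double sum collapses to the single element
    [z = sum_i r (x i) (a i)], and [kpos] applies to [k z z]. *)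
Let Q_orbit n (x : nat -> X) (a : nat -> C) (u : phi) :
  Q n x (fun i => rep_map phi (a i) u) (fun i => rep_map phi (a i) u) =
  hdot (rep_map phi (k (\sum_(i < n) r (x i) (a i)) (\sum_(i < n) r (x i) (a i))) u) u.
Proof.
have expand z : k z (\sum_(i < n) r (x i) (a i)) = \sum_(i < n) amul (k z (x i)) (a i).
  by elim/big_rec2: _ => [|i s t _ <-]; rewrite ?k0r ?kDr ?kr.
have expandl w : k (\sum_(j < n) r (x j) (a j)) w = \sum_(j < n) amul (star (a j)) (k (x j) w).
  by elim/big_rec2: _ => [|i s t _ <-]; rewrite ?k0l ?kDl ?krl.
have rep_sum (F : 'I_n -> C) v : rep_map phi (\sum_(i < n) F i) v = \sum_(i < n) rep_map phi (F i) v.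
  by elim/big_rec2: _ => [|i s t _ <-]; rewrite ?rep0 ?repD.
rewrite expand // rep_sum hdot_suml; apply: eq_bigr => i _.
rewrite rep_mul expandl rep_sum hdot_suml; apply: eq_bigr => j _.
by rewrite rep_mul rep_star_l.
Qed.

(* Positivity on a cyclic subspace, by approximation with [Q_orbit]; [Q_ge0] peels
   off cyclic subspaces one at a time. *)
Let Q_near n (x : nat -> X) (h : nat -> phi) (u : phi) :
  (forall i, orbit_clos u (h i)) -> 0 <= complex.Re (Q n x h h).
Proof.
move=> hM.
have /choice[K hK] (ij : nat * nat) : exists K : R, 0 <= K /\
    forall v, rnorm (rep_map phi (k (x ij.2) (x ij.1)) v) <= K * rnorm v.
  by have [K K0 hK] := rep_bound phi (k (x ij.2) (x ij.1)); exists K.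
(* Each entry is Lipschitz in its two vectors; the [+ 1] absorbs the displacement [d <= 1] of [g i]
   from [h i]. *)
pose B := \sum_(i < n) \sum_(j < n) K (val i, val j) * (rnorm (h i) + rnorm (h j) + 1).
apply: (@le_eps _ _ _ B) => e e0.
pose d := Num.min e 1; have d0 : 0 < d by rewrite lt_min e0 ltr01.
have d1 : d <= 1 by rewrite ge_min lexx orbT.
have de : d <= e by rewrite ge_min lexx.
have /choice[a ha] i := hM i d d0.
pose g i := rep_map phi (a i) u.
have hg : 0 <= complex.Re (Q n x g g) by rewrite Q_orbit kpos.
suff : cabs (Q n x g g - Q n x h h) <= B * d.
  move=> hB; have B0 : 0 <= B.
    apply: sumr_ge0 => i _; apply: sumr_ge0 => j _.
    by rewrite mulr_ge0 ?(hK _).1 // !addr_ge0 ?rnorm_ge0.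
  have := le_trans (ler_norm _) (le_trans (Re_le_cabs _) hB); rewrite ReB.
  have : B * d <= B * e by rewrite ler_wpM2l.
  lra.
rewrite /Q -sumrB /B mulr_suml; apply: le_trans (cabs_sum _ _) _; apply: ler_sum => i _.
rewrite -sumrB mulr_suml; apply: le_trans (cabs_sum _ _) _; apply: ler_sum => j _.
have [K0 hKij] := hK (val i, val j); move: (K _) K0 hKij => L L0 /= hL.
set T := rep_map phi _.
have -> : hdot (T (g i)) (g j) - hdot (T (h i)) (h j) =
    - (hdot (T (h i - g i)) (h j)) + - hdot (T (g i)) (h j - g j).
  by rewrite linearB hdotBl hdotBr; ring.
apply: le_trans (cabsD _ _) _; rewrite !cabsN.
apply: le_trans (lerD (hdot_le _ _) (hdot_le _ _)) _.
have b1 : rnorm (T (h i - g i)) <= L * d.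
  by apply: le_trans (hL _) _; rewrite ler_wpM2l // ltW.
have b2 : rnorm (T (g i)) <= L * (rnorm (h i) + 1).
  apply: le_trans (hL _) _; rewrite ler_wpM2l //.
  have := rnormD (- (h i - g i)) (h i); rewrite opprB subrK rnormB => /le_trans; apply.
  by rewrite addrC lerD2l (le_trans _ d1) // ltW // ha.
have b3 : rnorm (h j - g j) <= d by rewrite ltW // ha.
have c1 : rnorm (T (h i - g i)) * rnorm (h j) <= L * d * rnorm (h j).
  by rewrite ler_wpM2r ?rnorm_ge0.
have c2 : rnorm (T (g i)) * rnorm (h j - g j) <= L * (rnorm (h i) + 1) * d.
  by apply: ler_pM; rewrite ?rnorm_ge0.
lra.
Qed.

Let Q_ge0 n (x : nat -> X) (h : nat -> phi) : 0 <= complex.Re (Q n x h h).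
Proof.
elim: n x h => [|n IH] x h; first by rewrite /Q big_ord0.
pose u := h 0%N.
pose M := orbit_clos u.
have Ms : subspace M := orbit_closure_subspace u.
have Mc : closed M := @orbit_closure_closed _ _ phi u.
have Mi a v : M v -> M (rep_map phi a v) := @orbit_closure_invariant _ _ phi u a v.
have Mu : M u := orbit_closure u phi_inj.
have /choice[m hm] i : exists m, M m /\ forall y, M y -> hdot (h i - m) y = 0.
  by have [m Mm hm] := orthogonal_projection (h i) Ms Mc; exists m.
pose g i := h i - m i.
have hgm i : h i = m i + g i by rewrite addrC subrK.
(* [h 0] lies in its own orbit closure, so the complementary family has one vector fewer and the
   induction hypothesis applies. *)
have g0 : g 0%N = 0.
  have [M0 h0] := hm 0%N; apply: rnorm_eq0; apply/eqP; rewrite -sqrf_eq0 rnorm2E.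
  by rewrite h0 //; exact: (subspaceB Ms Mu M0).
(* The closure and its orthogonal complement are both invariant, so the form splits without cross
   terms. *)
have cross1 a i j : hdot (rep_map phi a (m i)) (g j) = 0.
  by rewrite hdotC (hm j).2 ?conjc0 //; exact: (Mi _ _ (hm i).1).
have cross2 a i j : hdot (rep_map phi a (g i)) (m j) = 0.
  by rewrite rep_star (hm i).2 //; exact: (Mi _ _ (hm j).1).
have -> : Q n.+1 x h h = Q n.+1 x m m + Q n.+1 x g g.
  rewrite /Q -big_split; apply: eq_bigr => i _ /=; rewrite -big_split; apply: eq_bigr => j _ /=.
  rewrite [in LHS](hgm i) [in LHS](hgm j) [rep_map _ _ (_ + _)]linearD hdotDl.
  by rewrite !(hdotDr (m j) (g j)) cross1 cross2 addr0 add0r.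
rewrite ReD addr_ge0 //; first by apply: (@Q_near _ _ _ u) => i; exact: (hm i).1.
have -> : Q n.+1 x g g = Q n (fun i => x i.+1) (fun i => g i.+1) (fun i => g i.+1); last exact: IH.
rewrite /Q big_ord_recl /= big1 ?add0r; last by move=> j _; rewrite g0 linear0 hdot0l.
by apply: eq_bigr => i _; rewrite big_ord_recl /= g0 hdot0r add0r.
Qed.

(** The arguments are reversed inside [k] because [hdot] is linear on the left. *)
Definition induced_kernel (s t : X * phi) : R[i] :=
  hdot (rep_map phi (k t.1 s.1) s.2) t.2.

Fact induced_kernel_herm s t : induced_kernel s t = (induced_kernel t s)^*%C.
Proof. by rewrite /induced_kernel rep_star kstar hdotC. Qed.

Fact induced_kernel_pos l : 0 <= complex.Re (kform induced_kernel l l).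
Proof.
pose d : R[i] * (X * phi) := (0, (0, 0)).
pose x i := (nth d l i).2.1; pose h i := (nth d l i).1 *: (nth d l i).2.2.
suff -> : kform induced_kernel l l = Q (size l) x h h by exact: Q_ge0.
rewrite /kform /Q (big_nth d) big_mkord; apply: eq_bigr => i _.
rewrite (big_nth d) big_mkord; apply: eq_bigr => j _.
by rewrite /induced_kernel /h [rep_map _ _ (_ *: _)]linearZ hdotZl hdotZr mulrA.
Qed.

Definition induced_psd := PsdKernel induced_kernel_herm induced_kernel_pos.

End KernelPositivity.

Lemma linear_scale {K : nzRingType} {V W : lmodType K} (T : V -> W) : linear T ->
  forall c x, T (c *: x) = c *: T x.
Proof.
move=> Tl c x; have T0 : T 0 = 0.
  by have := Tl (-1) 0 0; rewrite scaler0 addr0 scaleN1r addNr.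
by have := Tl c x 0; rewrite T0 !addr0.
Qed.

Section TotalFamilies.
Context {R : realType}.

Lemma total_eql {I : Type} {H : hilbertType R} (s : I -> H) (x y : H) :
  total s -> (forall i, hdot x (s i) = hdot y (s i)) -> x = y.
Proof. by move=> tot h; apply: (total_eq tot) => i; rewrite hdotC h -hdotC. Qed.

Lemma adj_bounded (H1 H2 : hilbertType R) (T : H1 -> H2) (T' : H2 -> H1) (M : R) : 0 <= M ->
  (forall u, rnorm (T u) <= M * rnorm u) ->
  (forall u v, hdot (T u) v = hdot u (T' v)) -> forall v, rnorm (T' v) <= M * rnorm v.
Proof.
move=> M0 Tb TT v; apply: le_sqr_factor; rewrite ?mulr_ge0 ?rnorm_ge0 //.
rewrite rnorm2E -TT; apply: le_trans (Re_hdot_le _ _) _.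
by rewrite mulrAC ler_wpM2r ?rnorm_ge0.
Qed.

Lemma total_ext {I : Type} (H1 H2 : hilbertType R) (s : I -> H1) (T S : H1 -> H2) (M K : R) :
  total s -> linear T -> linear S ->
  (forall u, rnorm (T u) <= M * rnorm u) -> (forall u, rnorm (S u) <= K * rnorm u) ->
  (forall i, T (s i) = S (s i)) -> forall u, T u = S u.
Proof.
move=> tot Tl Sl Tb Sb TS u.
have [T' TT] := bounded_adj Tl Tb; have [S' SS] := bounded_adj Sl Sb.
apply: eq_hdotl => v; rewrite TT SS; congr (hdot u _).
by apply: (total_eq tot) => i; rewrite -TT -SS TS.
Qed.

End TotalFamilies.

(** * Induction of representations along an algebra-valued form *)

Section InducedRepresentation.
Context {R : realType} {C D : locallyCstarType R} (phi : representation C).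
Context {X : zmodType} (k : X -> X -> C) (r : X -> C -> X) (l : D -> X -> X) (N : D -> R).
Hypothesis phi_inj : forall u : phi, (forall a, rep_map phi a u = 0) -> u = 0.
Hypothesis kDr : forall x y z, k x (y + z) = k x y + k x z.
Hypothesis kstar : forall x y, star (k x y) = k y x.
Hypothesis kr : forall x y a, k x (r y a) = amul (k x y) a.
Hypothesis kpos : forall x (h : phi), 0 <= complex.Re (hdot (rep_map phi (k x x) h) h).
Hypothesis kl_star : forall x y d, k (l d x) y = k x (l (star d) y).
Hypothesis kl_mul : forall x y d d', k x (l (amul d d') y) = k x (l d (l d' y)).
Hypothesis kl_lin : forall x y (c : R[i]) d d',
  k x (l (c *: d + d') y) = c *: k x (l d y) + k x (l d' y).
Hypothesis N_ge0 : forall d, 0 <= N d.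
Hypothesis N_mul : forall d d', N (amul d d') <= N d * N d'.
Hypothesis N_star : forall d, N (star d) <= N d.
Hypothesis N_cont : forall d (e : R), 0 < e -> \forall b \near d, N (b - d) <= e.
Hypothesis N_kernel : forall x y (h g : phi), exists2 K : R, 0 <= K & forall d,
  cabs (hdot (rep_map phi (k (l d x) (l d y)) h) g) <= K * N d ^+ 2.

(** Used in both directions. The action [l] is constrained only through [k], since equalities in the
    target space are tested on Gram matrices; the seminorm [N] supplies boundedness and
    continuity. *)
Lemma induced_representation : exists (psi : representation D)
    (tau : X -> phi -> psi) (tau' : X -> psi -> phi),
  [/\ forall x h u, hdot (tau x h) u = hdot h (tau' x u),
      forall x y h, tau' y (tau x h) = rep_map phi (k y x) h,
      forall x a h, tau x (rep_map phi a h) = tau (r x a) h,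
      forall d x h, rep_map psi d (tau x h) = tau (l d x) h &
      forall u, (forall x, tau' x u = 0) -> u = 0].
Proof.
have [H [j [jE jtot]]] := kolmogorov_decomposition (induced_psd phi_inj kDr kstar kr kpos).
have {}jE x y h g : hdot (j (x, h)) (j (y, g)) = hdot (rep_map phi (k y x) h) g by exact: jE.
have krl x y a : k (r x a) y = amul (star a) (k x y) by rewrite -kstar kr starM kstar.
have jl x (c : R[i]) h g : j (x, c *: h + g) = c *: j (x, h) + j (x, g).
  apply: (total_eql jtot) => -[y w].
  by rewrite hdotDl hdotZl !jE linearP hdotDl hdotZl.
have jb x : exists M : R, forall h, rnorm (j (x, h)) <= M * rnorm h.
  have [M M0 hM] := rep_bound phi (k x x); exists (M + 1) => h.
  rewrite -(@ler_pXn2r _ 2) ?nnegrE ?mulr_ge0 ?rnorm_ge0 ?addr_ge0 //.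
  rewrite rnorm2E jE; apply: le_trans (Re_hdot_le _ _) _.
  apply: le_trans (ler_wpM2r (rnorm_ge0 _) (hM h)) _.
  rewrite -mulrA -expr2 exprMn ler_wpM2r ?sqr_ge0 //.
  by rewrite sqrrD; have := sqr_ge0 M; lra.
have /choice[tau' tauE] x : exists T' : H -> phi, forall h u, hdot (j (x, h)) u = hdot h (T' u).
  by have [M hM] := jb x; exact: (@bounded_adj _ _ _ (fun h => j (x, h)) M (jl x) hM).
pose sh (g : X -> X) (s : X * phi) : X * phi := (g s.1, s.2).
pose js d s := j (sh (l d) s).
have js_adj d s t : hdot (js d s) (j t) = hdot (j s) (js (star d) t).
  case: s t => x h [y g]; rewrite /js /sh /= !jE.
  by rewrite kl_star starK.
have hdot_comb (s1 s2 : X * phi -> H) L L' : hdot (comb s1 L) (comb s2 L') =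
    \sum_(p <- L) \sum_(q <- L') p.1 * (q.1)^*%C * hdot (s1 p.2) (s2 q.2).
  rewrite hdot_suml; apply: eq_bigr => p _; rewrite hdot_sumr; apply: eq_bigr => q _.
  by rewrite hdotZl hdotZr mulrA.
(* A crude bound whose constant depends on the combination [L]; what matters for [js_bound] is its
   dependence on [d]. *)
have N_comb L : exists2 K : R, 0 <= K & forall d, rnorm (comb (js d) L) <= K * N d.
  have /choice[K hK] (st : (X * phi) * (X * phi)) : exists K : R, 0 <= K /\ forall d,
      cabs (hdot (js d st.1) (js d st.2)) <= K * N d ^+ 2.
    have [K K0 hK] := N_kernel st.2.1 st.1.1 st.1.2 st.2.2; exists K; split=> // d.
    by rewrite /js jE.
  pose B := \sum_(p <- L) \sum_(q <- L) cabs (p.1 * (q.1)^*%C) * K (p.2, q.2).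
  have B0 : 0 <= B.
    apply: sumr_ge0 => p _; apply: sumr_ge0 => q _.
    by rewrite mulr_ge0 ?cabs_ge0 ?(hK _).1.
  exists (Num.sqrt B) => [|d]; first exact: sqrtr_ge0.
  rewrite -(@ler_pXn2r _ 2) ?nnegrE ?mulr_ge0 ?rnorm_ge0 ?sqrtr_ge0 //.
  rewrite exprMn sqr_sqrtr // rnorm2E hdot_comb.
  apply: le_trans (ler_norm _) (le_trans (Re_le_cabs _) _).
  rewrite mulr_suml; apply: le_trans (cabs_sum _ _) _; apply: ler_sum => p _.
  rewrite mulr_suml; apply: le_trans (cabs_sum _ _) _; apply: ler_sum => q _.
  rewrite cabsM -mulrA ler_wpM2l ?cabs_ge0 //.
  exact: (hK (p.2, q.2)).2.
have jmul d d' x h : j (l (amul d d') x, h) = j (l d (l d' x), h).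
  by apply: (total_eql jtot) => -[y g]; rewrite !jE kl_mul.
have js_bound d L : rnorm (comb (js d) L) <= N d * rnorm (comb j L).
  (* [w] is self-adjoint for the kernel, so the norms of its iterates on a combination [v] are
     log-convex. [N_comb] gives them the rate [N w], hence [|w v| <= N w |v|] and
     [|d v|^2 = <v, w v> <= N d ^+ 2 |v|^2]. *)
  pose w := amul (star d) d.
  have ws : star w = w by rewrite starM starK.
  have kw y z : k y (l w z) = k (l w y) z by rewrite [RHS]kl_star ws.
  (* Products are known to act by composition only after [j], so the equality must be propagated
     through [l w]. *)
  have jw z z' h : j (z, h) = j (z', h) -> j (l w z, h) = j (l w z', h).
    move=> e; apply: (total_eql jtot) => -[y g].
    by rewrite !jE (kw y z) (kw y z') -!jE e.
  pose ji n s := j (sh (iter n (l w)) s).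
  (* [wp n] is the power of [w] with exponent [n + 1], as [D] has no unit to serve as exponent
     [0]. *)
  pose wp n := iter n (amul w) w.
  have ji_wp n s : ji n.+1 s = js (wp n) s.
    case: s => x h; elim: n => [|n IH] //.
    rewrite /js /sh /= jmul; exact: jw IH.
  have a_sq n : rnorm (comb (ji n.+1) L) ^+ 2 <= rnorm (comb (ji n) L) * rnorm (comb (ji n.+2) L).
    apply: le_trans (Re_hdot_le _ _); rewrite rnorm2E !hdot_comb.
    rewrite le_eqVlt; apply/orP; left; apply/eqP; congr (complex.Re _).
    apply: eq_bigr => p _; apply: eq_bigr => q _; congr (_ * _).
    by rewrite /ji /sh /= !jE kw.
  have [K K0 hK] := N_comb L.
  have Nwp n : N (wp n) <= N w ^+ n.+1.
    elim: n => [|n IH]; first by rewrite expr1.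
    by rewrite exprS; apply: le_trans (N_mul _ _) _; rewrite ler_wpM2l.
  have := @logconvex_growth R (fun n => rnorm (comb (ji n) L)) (K + rnorm (comb (ji 0%N) L)) (N w).
  move=> /(_ (N_ge0 _) (fun _ => rnorm_ge0 _) a_sq) gr.
  have {}gr : rnorm (comb (ji 1%N) L) <= N w * rnorm (comb (ji 0%N) L).
    apply: gr => -[|n]; first by rewrite !mulr1 lerDr.
    have -> : comb (ji n.+1) L = comb (js (wp n)) L by apply: eq_bigr => p _; rewrite ji_wp.
    apply: le_trans (hK _) _; apply: le_trans (ler_wpM2l K0 (Nwp n)) _.
    rewrite ler_wpM2r ?exprn_ge0 //; apply: (@le_trans _ _ (K + rnorm (comb (ji 0%N) L))).
      by rewrite lerDl rnorm_ge0.
    by rewrite ler_peMr ?addr_ge0 ?rnorm_ge0 // ler1n.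
  have ji0 : comb (ji 0%N) L = comb j L by apply: eq_bigr => -[c [x h]] _.
  rewrite -(@ler_pXn2r _ 2) ?nnegrE ?mulr_ge0 ?rnorm_ge0 ?N_ge0 //.
  have -> : rnorm (comb (js d) L) ^+ 2 = complex.Re (hdot (comb (ji 0%N) L) (comb (ji 1%N) L)).
    rewrite rnorm2E !hdot_comb; congr (complex.Re _).
    apply: eq_bigr => p _; apply: eq_bigr => q _; congr (_ * _).
    by rewrite /ji /js /sh /= !jE kl_star -kl_mul kw.
  apply: le_trans (Re_hdot_le _ _) _; rewrite -ji0.
  apply: le_trans (ler_wpM2l (rnorm_ge0 _) gr) _.
  rewrite mulrCA exprMn -expr2 ler_wpM2r ?sqr_ge0 //.
  by apply: le_trans (N_mul _ _) _; rewrite expr2 ler_wpM2r.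
have /choice[T hT] d := @total_extension R _ H H j (js d) (N d) jtot (js_bound d).
have Tl d : linear (T d) by case: (hT d).
have Tj d x h : T d (j (x, h)) = j (l d x, h) by case: (hT d) => _ -> _.
have Tb d u : rnorm (T d u) <= N d * rnorm u by case: (hT d).
pose TL d : {linear H -> H} := HB.pack_for {linear H -> H} (T d)
  (GRing.isLinear.Build _ _ _ _ (T d) (Tl d)).
have TLin (c : R[i]) a b x : TL (c *: a + b) x = c *: TL a x + TL b x.
  pose S u := c *: T a u + T b u.
  have Sl : linear S.
    move=> e u v; rewrite /S !Tl !scalerDr !scalerA addrACA [c * e]mulrC.
    by [].
  have Sb u : rnorm (S u) <= (cabs c * N a + N b) * rnorm u.
    apply: le_trans (rnormD _ _) _; rewrite rnormZ mulrDl lerD // -mulrA.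
    by rewrite ler_wpM2l ?cabs_ge0.
  apply: (total_ext jtot (Tl _) Sl (Tb _) Sb) => -[y h].
  rewrite /S !Tj; apply: (total_eql jtot) => -[z g].
  by rewrite hdotDl hdotZl !jE kl_lin rep_linear hdotDl hdotZl.
have TMul a b x : TL (amul a b) x = TL a (TL b x).
  have Sl : linear (T a \o T b) by move=> e u v; rewrite /= !Tl.
  have Sb u : rnorm ((T a \o T b) u) <= (N a * N b) * rnorm u.
    by apply: le_trans (Tb _ _) _; rewrite -mulrA ler_wpM2l.
  apply: (total_ext jtot (Tl _) Sl (Tb _) Sb) => -[y h].
  rewrite /= !Tj; apply: (total_eql jtot) => -[z g].
  by rewrite !jE kl_mul.
have TStar a x y : hdot (TL a x) y = hdot x (TL (star a) y).
  have [T' TT] := bounded_adj (Tl a) (Tb a).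
  rewrite /= TT; congr (hdot x _).
  have T'l : linear T' := linear_adj (hdot_adjC TT).
  have T'b := adj_bounded (N_ge0 a) (Tb a) TT.
  apply: (total_ext jtot T'l (Tl _) T'b (Tb _)) => -[z g].
  by apply: (total_eq jtot) => -[w h]; rewrite -TT /= !Tj !jE kl_star starK.
have TZ d (c : R[i]) u : T d (c *: u) = c *: T d u := linear_scale (Tl d) c u.
have TBound a : (opnorm (TL a) < +oo)%E.
  apply: (@le_lt_trans _ _ (N a)%:E); last exact: ltry.
  by apply/(opnorm_leP (N_ge0 a) (TZ a)); exact: Tb.
have TCont a : opnorm (TL b \- TL a) @[b --> a] --> 0%E.
  apply/(ereal_cvg0P (nbhs_filter a) (fun b => opnorm_ge0 (TL b \- TL a)%R)) => e e0.
  have hN : nbhs a [set b | N (b - a) <= e] by exact: N_cont.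
  apply: (@filterS _ (nbhs a) (nbhs_filter a) _ _ _ hN) => b /= hb.
  apply/opnorm_leP; first exact: ltW.
    by move=> c x; rewrite /= !TZ scalerBr.
  move=> u /=; have -> : T b u - T a u = T (b - a) u.
    by have := TLin (-1) a b u; rewrite !scaleN1r [- a + b]addrC [- TL a u + _]addrC => /esym.
  by apply: le_trans (Tb _ _) _; rewrite ler_wpM2r ?rnorm_ge0.
exists (Rep TBound TLin TMul TStar TCont), (fun x h => j (x, h)), tau'; split => //=.
- move=> x y h; apply: eq_hdotl => g; rewrite (hdot_adjC (tauE y)) jE.
  by [].
- move=> x a h; apply: (total_eql jtot) => -[y g].
  by rewrite !jE kr rep_mul.
- move=> u hu; apply: jtot => -[x h]; by rewrite tauE hu hdot0r.
Qed.

End InducedRepresentation.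

(** * Linked representations *)

Section LinkedRepresentations.
Context {R : realType} {A B : locallyCstarType R} {E : hilbertModType A}.
Variable f : B -> E -> E.
Hypothesis fiso : iso_compact_op f.
Implicit Types (a : A) (b : B) (x y z w : E).

(* A representation of the imprimitivity bimodule [E]: [tau x] is a bounded
   operator with adjoint [tau' x], and both inner products are recovered from
   compositions of these operators. *)
Definition linked (phi : representation A) (psi : representation B) : Prop :=
  exists (tau : E -> phi -> psi) (tau' : E -> psi -> phi),
  [/\ forall x h u, hdot (tau x h) u = hdot h (tau' x u),
      forall x y h, tau' y (tau x h) = rep_map phi (inner y x) h &
      forall x y b u, f b = theta y x -> tau y (tau' x u) = rep_map psi b u].

Let f_star b x y : f b = theta y x -> f (star b) = theta x y.
Proof.
move=> fb; apply/funext => z; apply: eq_innerr => w.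
by rewrite -(iso_adj fiso) fb theta_adjoint.
Qed.

Section FromA.
Variable phi : representation A.
Hypothesis phi_nd : nondegenerate phi.

(** [induced_representation] for the form [inner], with [B] acting through [f] and [N b] the
    operator seminorm of [f b]. *)
Lemma linked_of_source : exists2 psi : representation B, nondegenerate psi & linked phi psi.
Proof.
have inj := (nondegenerateP phi).1 phi_nd.
have [p [C [pS C0 hC]]] := rep_seminorm_bound phi; have [pC _] := pS.
have fZ b : forall c x, f b (c *: x) = c *: f b x := linear_scale (iso_linear fiso b).
pose N b := fine (op_seminorm p (f b)).
have Nfin b : op_seminorm p (f b) \is a fin_num.
  have [M M0 hM] := iso_bounded fiso b pS.
  rewrite ge0_fin_numE ?op_seminorm_ge0 //; apply: (@le_lt_trans _ _ M%:E); last exact: ltry.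
  by apply/op_seminorm_leP.
have N0 b : 0 <= N b by rewrite fine_ge0 // op_seminorm_ge0.
have Nle b (M : R) : 0 <= M -> op_le p (f b) M -> N b <= M.
  by move=> M0 /(op_seminorm_leP pC M0 (fZ b)); rewrite -lee_fin fineK.
have Nop b : op_le p (f b) (N b).
  by apply/(op_seminorm_leP pC (N0 b) (fZ b)); rewrite fineK.
have [|||||||||||||psi [tau [tau' [adj tt tr tl tot]]]] :=
  @induced_representation R A B phi E (@inner _ _ E) (@act _ _ E) f N.
- exact: inj.
- exact: innerDr.
- exact: star_inner.
- exact: inner_act.
- move=> x h; have [a ->] := inner_positive x.
  by rewrite rep_mul rep_star_l hdot_rnorm /= sqr_ge0.
- by move=> x y b; exact: iso_adj.
- by move=> x y b b'; rewrite iso_mul.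
- by move=> x y c b b'; rewrite iso_lin // -innerZr -innerDr.
- exact: N0.
- move=> b b'; apply: Nle; first by rewrite mulr_ge0.
  by move=> x; rewrite iso_mul //; exact: (op_le_comp (N0 b) (Nop b) (Nop b') x).
- by move=> b; apply: Nle => //; exact: (op_le_adj pC (N0 b) (iso_adj fiso b) (Nop b)).
- move=> b e e0; have [_ _ _ fc _] := fiso.
  have := (ereal_cvg0P (@fmap_filter _ _ f (nbhs b) (nbhs_filter b))
    (fun S => op_seminorm_ge0 pC (S \- f b)%R)).1 (fc b p pS) e e0.
  apply: (@filterS _ (nbhs b) (nbhs_filter b)) => b' /= h.
  rewrite -lee_fin fineK // (_ : f (b' - b) = (f b' \- f b)%R) //.
  apply/funext => x /=; rewrite iso_add // -scaleN1r iso_scale // scaleN1r.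
  by [].
- move=> x y h g.
  exists (C * (module_norm p x * module_norm p y) * rnorm h * rnorm g).
    by rewrite !mulr_ge0 ?rnorm_ge0 ?module_norm_ge0.
  move=> b; apply: le_trans (hdot_le _ _) _.
  apply: le_trans (ler_wpM2r (rnorm_ge0 _) (hC _ _)) _.
  rewrite [leRHS]mulrAC ler_wpM2r ?rnorm_ge0 // [leRHS]mulrAC ler_wpM2r ?rnorm_ge0 //.
  rewrite -mulrA ler_wpM2l //; apply: le_trans (inner_le pC _ _) _.
  apply: le_trans (ler_pM _ _ (Nop b x) (Nop b y)) _; rewrite ?module_norm_ge0 //.
  by rewrite mulrACA -expr2 mulrC.
have tz x u : (forall h, hdot u (tau x h) = 0) -> tau' x u = 0.
  by move=> h; apply: eq_hdotl => v; rewrite hdot0l (hdot_adjC (adj x)).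
exists psi; last first.
  exists tau, tau'; split=> // x y b u fb.
  apply/eqP; rewrite -subr_eq0; apply/eqP/tot => z; apply: tz => h.
  rewrite hdotBl adj (hdot_adjC (adj x)) rep_star tt tr tl.
  by rewrite (f_star fb) /theta subrr.
(* The square of the norm of [tau' x u] is [<psi b u, u>] for the [b] with [f b = theta x x], and
   [psi b u = 0]. *)
apply/nondegenerateP => u hu; apply: (tot) => x; apply: rnorm_eq0; apply/eqP.
have [b fb] := iso_theta fiso x x.
rewrite -sqrf_eq0 rnorm2E -adj.
have -> : tau x (tau' x u) = rep_map psi b u; last by rewrite hu hdot0l.
apply/eqP; rewrite -subr_eq0; apply/eqP/tot => z; apply: tz => h.
by rewrite hdotBl adj (hdot_adjC (adj x)) rep_star tt tr tl (f_star fb) /theta subrr.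
Qed.

End FromA.

Section FromB.
Variable psi : representation B.
Hypothesis psi_nd : nondegenerate psi.

(* For [|w| <= 1], the powers of [1 - psi (theta w w)] grow at most linearly, as
   [1 - theta w w] is a contraction of [E]; so [1 - psi (theta w w)] is a
   contraction by log-convexity. *)
Lemma theta_rep_ge0 b z (u : psi) : f b = theta z z ->
  0 <= complex.Re (hdot (rep_map psi b u) u).
Proof.
have [p [C [pS C0 hC]]] := compact_rep_bound fiso psi; have [pC _] := pS.
have unit_case b' w : module_norm p w <= 1 -> f b' = theta w w ->
    0 <= complex.Re (hdot (rep_map psi b' u) u).
  move=> w1 fb; have [a ga] := inner_positive w.
  have g1 : p (amul (star a) a) <= 1.
    by rewrite -ga -module_norm2 // expr_le1 ?module_norm_ge0.
  (* On [<x, x>] this map acts as multiplication by [1 - <w, w>] from both sides, and each side is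
     contractive by [cseminorm_one_sub]. *)
  have contr x : module_norm p (x - act x (inner w w)) <= module_norm p x.
    rewrite ler_sqrt ?cseminorm_ge0 //.
    have right (d : A) : p (d - amul d (inner w w)) <= p d.
      rewrite -(cseminorm_star pC) starB starM star_inner -[leRHS](cseminorm_star pC) ga.
      exact: (cseminorm_one_sub pC g1).
    pose v := inner x x - amul (inner x x) (inner w w).
    have -> : inner (x - act x (inner w w)) (x - act x (inner w w)) = v - amul (inner w w) v.
      rewrite innerBr inner_act !innerBl !inner_actl star_inner /v amulBl amulBr amulA.
      by rewrite !opprB addrACA [RHS]addrACA [- amul (inner w w) _ - _]addrC.
    by apply: (le_trans _ (right (inner x x))); rewrite -/v ga; exact: (cseminorm_one_sub pC g1).
  pose S v := v - rep_map psi b' v.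
  have b's : star b' = b' by apply: (iso_inj fiso); rewrite (f_star fb).
  have Sadj v v' : hdot (S v) v' = hdot v (S v').
    by rewrite hdotBl hdotBr rep_star b's.
  (* [xs n = w (1 - <w, w>)^n], so [theta (xs n) w] is [theta w w] times the [n]-th power of
     [1 - theta w w]. The bound [C] on its image, uniform in [n], bounds the increments of the
     powers of [S]. *)
  pose xs n := iter n (fun x => x - act x (inner w w)) w.
  have xs_norm n : module_norm p (xs n) <= 1.
    by elim: n => [|n IH] //; exact: (le_trans (contr (xs n)) IH).
  have /choice[bs fbs] n := iso_theta fiso w (xs n).
  have bsS n v : rep_map psi (bs n) v = rep_map psi b' (iter n S v).
    elim: n v => [|n IH] v; first by congr (rep_map psi _ v); apply: (iso_inj fiso); rewrite fb fbs.
    rewrite iterSr -IH /S linearB /= -rep_mul -repB; congr (rep_map psi _ v).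
    apply: (iso_inj fiso); apply/funext => y.
    rewrite fbs -scaleN1r iso_add // iso_scale // iso_mul // !fbs fb /theta /= actBl scaleN1r.
    by rewrite inner_act actA.
  have SC v n : rnorm (iter n S v) <= (1 + n%:R * C) * rnorm v.
    elim: n => [|n IH]; first by rewrite mul0r addr0 mul1r.
    have -> : iter n.+1 S v = iter n S v - rep_map psi (bs n) v by rewrite bsS.
    apply: le_trans (rnormD _ _) _; rewrite rnormN.
    have h1 : rnorm (rep_map psi (bs n) v) <= C * 1 * rnorm v.
      apply: hC => // y; rewrite fbs; apply: le_trans (op_le_theta pC _ _ _) _.
      by rewrite ler_wpM2r ?module_norm_ge0 // mulr_ile1 ?module_norm_ge0.
    by rewrite -natr1; lra.
  have contrS : rnorm (S u) <= rnorm u.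
    have := @logconvex_growth R (fun n => rnorm (iter n S u)) ((1 + C) * rnorm u) 1 ler01.
    move=> /(_ (fun _ => rnorm_ge0 _)); rewrite mul1r; apply => n.
      by rewrite rnorm2E /= Sadj; exact: Re_hdot_le.
    rewrite expr1n mulr1; apply: le_trans (SC u n) _.
    rewrite mulrAC ler_wpM2r ?rnorm_ge0 // -natr1.
    have : 0 <= n%:R :> R by []. lra.
  (* Expanding the left-hand side leaves [|psi b' u|^2 <= 2 Re <psi b' u, u>]. *)
  have : rnorm (S u) ^+ 2 <= rnorm u ^+ 2 by rewrite ler_pXn2r ?nnegrE ?rnorm_ge0.
  rewrite rnorm2B hdotC Re_conjc; have := sqr_ge0 (rnorm (rep_map psi b' u)); lra.
move=> fb; pose t := (module_norm p z + 1)^-1.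
have t0 : 0 < t by rewrite invr_gt0 ltr_wpDl ?module_norm_ge0.
have := unit_case ((t * t)%:C *: b) (t%:C *: z).
rewrite module_normZ // cabs_real ger0_norm ?(ltW t0) // repZ hdotZl ReZ.
rewrite pmulr_rge0 ?mulr_gt0 //; apply.
  by rewrite mulrC ler_pdivrMr ?mul1r ?lerDl // ltr_wpDl ?module_norm_ge0.
apply/funext => x; rewrite iso_scale // fb /theta innerZl actZr actZl scalerA.
by rewrite conjc_real -rmorphM.
Qed.

(** [induced_representation] for the conjugate module of [E]: the form is the preimage of
    [theta y x] under [f], [B] acts on the right by [f (star b)] and [A] on the left by [star a].
    The operators [sig x] so obtained play the part of [tau' x]. *)
Lemma linked_of_target : exists2 phi : representation A, nondegenerate phi & linked phi psi.
Proof.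
have inj := (nondegenerateP psi).1 psi_nd.
have [p [C [pS C0 hC]]] := compact_rep_bound fiso psi; have [pC pcont] := pS.
have /choice[kk hkk] (yx : E * E) := iso_theta fiso yx.2 yx.1.
pose k y x := kk (y, x); have fk y x : f (k y x) = theta y x by exact: hkk.
have fI b b' : (forall z, f b z = f b' z) -> b = b'.
  by move=> h; apply: (iso_inj fiso); apply/funext.
have [|||||||||||||phi [sig [sig' [adj ss sr sl tot]]]] :=
  @induced_representation R B A psi E k (fun x b => f (star b) x) (fun a x => act x (star a)) p.
- exact: inj.
- by move=> x y z; apply: fI => w; rewrite iso_add // !fk /theta innerDl actDr.
- by move=> x y; apply: fI => w; rewrite (f_star (fk x y)) fk.
- move=> x y b; apply: fI => w; rewrite iso_mul // !fk /theta.
  by rewrite (iso_adj fiso) starK.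
- by move=> x h; apply: theta_rep_ge0 (fk x x).
- by move=> x y a; apply: fI => w; rewrite !fk /theta inner_actl starK actA.
- by move=> x y a a'; rewrite starM actA.
- move=> x y c a a'; apply: fI => w; rewrite iso_add // iso_scale // !fk /theta.
  by rewrite starD starZ actDr actZr innerDl innerZl conjcK actDr actZr.
- exact: cseminorm_ge0.
- exact: cseminormM.
- by move=> a; rewrite (cseminorm_star pC).
- move=> a e e0.
  have U0 : nbhs (0 : A) [set d : A | p d <= e].
    have : p d @[d --> (0 : A)] --> p 0 := pcont 0; rewrite (cseminorm0 pC) => /cvgrPdist_le /(_ e e0).
    apply: (@filterS _ (nbhs (0 : A)) (nbhs_filter (0 : A))) => d /=.
    by rewrite sub0r normrN ger0_norm // cseminorm_ge0.
  apply: (@filterS _ (nbhs a) (nbhs_filter a) _ _ _ (nbhsT a U0)) => _ [d /= hd <-].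
  by rewrite addrC addKr.
- move=> x y h g.
  exists (C * (module_norm p x * module_norm p y) * rnorm h * rnorm g).
    by rewrite !mulr_ge0 ?rnorm_ge0 ?module_norm_ge0.
  move=> a; apply: le_trans (hdot_le _ _) _.
  rewrite [leRHS]mulrAC ler_wpM2r ?rnorm_ge0 //.
  have := hC (k (act x (star a)) (act y (star a))) (module_norm p x * module_norm p y * p a ^+ 2) h.
  rewrite !mulr_ge0 ?module_norm_ge0 ?(cseminorm_ge0 pC) // => /(_ isT) h1.
  apply: le_trans (h1 _) _; last by rewrite le_eqVlt; apply/orP; left; apply/eqP; ring.
  move=> z; rewrite fk; apply: le_trans (op_le_theta pC _ _ _) _.
  rewrite ler_wpM2r ?module_norm_ge0 // expr2 mulrACA.
  apply: ler_pM; rewrite ?module_norm_ge0 // -(cseminorm_star pC); exact: module_norm_act.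
have tz x u : (forall h, hdot u (sig x h) = 0) -> sig' x u = 0.
  by move=> h; apply: eq_hdotl => v; rewrite hdot0l (hdot_adjC (adj x)).
have key x y u : sig y (sig' x u) = rep_map phi (inner y x) u.
  apply/eqP; rewrite -subr_eq0; apply/eqP/(tot) => z; apply: tz => h.
  rewrite hdotBl adj (hdot_adjC (adj x)) rep_star ss sr sl.
  by rewrite (f_star (fk y z)) star_inner /theta star_inner subrr.
exists phi.
  apply/nondegenerateP => u hu; apply: (tot) => x; apply: rnorm_eq0; apply/eqP.
  by rewrite -sqrf_eq0 rnorm2E -adj key hu hdot0l.
exists sig', sig; split => //.
- by move=> x h u; rewrite (hdot_adjC (adj x)).
- move=> x y b u fb; rewrite ss; congr (rep_map psi _ u).
  by apply: (iso_inj fiso); rewrite fk fb.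
Qed.

End FromB.

End LinkedRepresentations.

(** * Isometries determined by Gram matrices *)

Section Isometries.
Context {R : realType}.

Lemma total_isometry {I : Type} (H1 H2 : hilbertType R) (s1 : I -> H1) (s2 : I -> H2) :
  total s1 -> (forall i j, hdot (s2 i) (s2 j) = hdot (s1 i) (s1 j)) ->
  exists V : H1 -> H2, [/\ linear V, forall i, V (s1 i) = s2 i &
    forall x y, hdot (V x) (V y) = hdot x y].
Proof.
move=> tot gram.
have nrm l : rnorm (comb s2 l) = rnorm (comb s1 l).
  apply/eqP; rewrite -(@eqrXn2 _ 2) ?rnorm_ge0 // !rnorm2E !hdot_suml; apply/eqP.
  congr (complex.Re _); apply: eq_bigr => p _; rewrite !hdot_sumr; apply: eq_bigr => q _.
  by rewrite !hdotZl !hdotZr gram.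
have [|V [Vl Vs Vb]] := @total_extension R I H1 H2 s1 s2 1 tot.
  by move=> l; rewrite nrm mul1r.
exists V; split=> // x y.
have [V' VV] := bounded_adj Vl Vb.
have V'l := linear_adj (hdot_adjC VV); have V'b := adj_bounded ler01 Vb VV.
(* Inner products are recovered from [V' V = id], which is checked on the total family. *)
suff VV1 : forall u, V' (V u) = u by rewrite VV VV1.
apply: (total_ext (T := V' \o V) (S := id) (M := 1) (K := 1) tot) => //.
- by move=> c u v; rewrite /= Vl V'l.
- by move=> u; apply: le_trans (V'b _) _; rewrite !mul1r; have := Vb u; rewrite mul1r.
- by move=> u; rewrite mul1r.
- by move=> i; apply: (total_eq tot) => j; rewrite -VV !Vs gram.
Qed.

Lemma isometry_rnorm (H1 H2 : hilbertType R) (V : H1 -> H2) :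
  (forall x y, hdot (V x) (V y) = hdot x y) -> forall x, rnorm (V x) = rnorm x.
Proof.
move=> h x; apply/eqP; rewrite -(@eqrXn2 _ 2) ?rnorm_ge0 //.
by rewrite !rnorm2E h.
Qed.

Lemma total_unitary {I : Type} (H1 H2 : hilbertType R) (s1 : I -> H1) (s2 : I -> H2) :
  total s1 -> total s2 -> (forall i j, hdot (s2 i) (s2 j) = hdot (s1 i) (s1 j)) ->
  exists V : H1 -> H2, unitary V /\ forall i, V (s1 i) = s2 i.
Proof.
move=> tot1 tot2 gram.
have [V [Vl Vs Vi]] := total_isometry tot1 gram.
have [W [Wl Ws Wi]] := total_isometry tot2 (fun i j => esym (gram i j)).
exists V; split=> //; split=> // y _; exists (W y) => //.
apply: (total_ext (T := V \o W) (S := id) (M := 1) (K := 1) tot2) => //.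
- by move=> c u v; rewrite /= Wl Vl.
- by move=> u; rewrite /= (isometry_rnorm Vi) (isometry_rnorm Wi) mul1r.
- by move=> u; rewrite mul1r.
- by move=> i; rewrite /= Ws Vs.
Qed.

End Isometries.

Section FiniteSums.
Context {R : realType} {I : choiceType}.
Implicit Types (a : I -> R) (s : seq I).

Lemma esum_ge_seq a s : (forall i, 0 <= a i) -> uniq s ->
  ((\sum_(i <- s) a i)%:E <= \esum_(i in [set: I]) (a i)%:E)%E.
Proof.
move=> a0 us; apply: esum_ge; exists [set` s] => //.
by rewrite -sumEFin fsbig_seq.
Qed.

Lemma esum_le_seq a (C : \bar R) : (forall i, 0 <= a i) ->
  (forall s, uniq s -> ((\sum_(i <- s) a i)%:E <= C)%E) ->
  (\esum_(i in [set: I]) (a i)%:E <= C)%E.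
Proof.
move=> a0 h; apply: ge_ereal_sup => _ [X [Xf _] <-].
have [s us ->] : exists2 s : seq I, uniq s & X = [set` s].
  have /finite_seqP[r ->] := Xf; exists (undup r); first exact: undup_uniq.
  by apply/funext => i; rewrite /= mem_undup.
by rewrite -fsbig_seq // sumEFin; exact: h.
Qed.

End FiniteSums.

(** * Hilbert sums of orthogonal ranges *)

Section OrthogonalIsometries.
Context {R : realType} {I : choiceType} (H : hilbertType R) (Hs : I -> hilbertType R).
Variables (Z : forall i, Hs i -> H) (W : forall i, H -> Hs i).
Arguments Z : clear implicits.
Arguments W : clear implicits.
Hypothesis Wlin : forall i, linear (W i).
Hypothesis ZW : forall i y u, hdot (Z i y) u = hdot y (W i u).
Hypothesis WZ : forall i y, W i (Z i y) = y.
Hypothesis WZ0 : forall i j y, i != j -> W i (Z j y) = 0.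
Hypothesis Wtotal : forall u, (forall i, W i u = 0) -> u = 0.

Let X (y : forall i, Hs i) (s : seq I) : H := \sum_(i <- s) Z i (y i).
Let P (y : forall i, Hs i) (s : seq I) : R := \sum_(i <- s) rnorm (y i) ^+ 2.

Let WX y s j : uniq s -> W j (X y s) = if j \in s then y j else 0.
Proof.
have W0 : W j 0 = 0 by have := Wlin j (-1) 0 0; rewrite scaler0 addr0 scaleN1r addNr.
have WD u v : W j (u + v) = W j u + W j v by have := Wlin j 1 u v; rewrite !scale1r.
elim: s => [|i s IH] /=; first by rewrite /X big_nil W0.
move=> /andP[iNs us]; rewrite /X big_cons WD IH // inE.
have [->|ji] /= := eqVneq j i; first by rewrite WZ (negbTE iNs) addr0.
by rewrite WZ0 // add0r.
Qed.

Let hdotX u y s : hdot (X y s) u = \sum_(i <- s) hdot (y i) (W i u).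
Proof. by rewrite hdot_suml; apply: eq_bigr => i _; rewrite ZW. Qed.

Let normX y s : uniq s -> rnorm (X y s) ^+ 2 = P y s.
Proof.
move=> us; rewrite rnorm2E hdotX Re_sum [in RHS]/P big_seq [RHS]big_seq.
by apply: eq_bigr => i iins; rewrite WX // iins rnorm2E.
Qed.

Let XB y s t : uniq s -> uniq t -> {subset s <= t} ->
  rnorm (X y t - X y s) ^+ 2 = P y t - P y s.
Proof.
move=> us ut st; pose q := [seq i <- t | i \notin s].
have pt : perm_eq t (s ++ q).
  apply: uniq_perm => //.
    rewrite cat_uniq us filter_uniq // andbT; apply/hasPn => i.
    by rewrite mem_filter => /andP[].
  move=> i; rewrite mem_cat mem_filter; case: (boolP (i \in s)) => //= /st ->.
  by [].
have -> : X y t = X y s + X y q by rewrite /X (perm_big _ pt) big_cat.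
have -> : P y t = P y s + P y q by rewrite /P (perm_big _ pt) big_cat.
by rewrite addrAC subrr add0r normX ?filter_uniq // addrAC subrr add0r.
Qed.

(** Finite sums whose weight is close to the supremum form a Cauchy sequence, since enlarging the
    index set moves the sum by at most the missing weight. *)
Lemma orthogonal_sum_ex (y : forall i, Hs i) :
  (\esum_(i in [set: I]) (rnorm (y i) ^+ 2)%:E < +oo)%E ->
  exists2 x, forall i, W i x = y i &
    (\esum_(i in [set: I]) (rnorm (y i) ^+ 2)%:E = (rnorm x ^+ 2)%:E)%E.
Proof.
have a0 i : 0 <= rnorm (y i) ^+ 2 by exact: sqr_ge0.
set Se := \esum_(i in _) _ => Sfin.
have Se0 : (0 <= Se)%E by apply: esum_ge0 => i _; rewrite lee_fin.
have SE : Se \is a fin_num by rewrite ge0_fin_numE.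
pose S := fine Se; have SeE : Se = S%:E by rewrite fineK.
have PS s : uniq s -> P y s <= S.
  by move=> us; rewrite -lee_fin -SeE; exact: (esum_ge_seq a0 us).
have n0 n : 0 < n.+1%:R^-1 :> R by rewrite invr_gt0 ltr0n.
have /choice[s hs] (n : nat) : exists s, uniq s /\ S - n.+1%:R^-1 < P y s.
  apply: contrapT => /forallNP h.
  have : (Se <= (S - n.+1%:R^-1)%:E)%E.
    apply: esum_le_seq => // s us; rewrite lee_fin leNgt; apply/negP => hs.
    by apply: (h s).
  by rewrite SeE lee_fin; have := n0 n; move: (n.+1%:R^-1) => e; lra.
have XP s1 s2 (e : R) : uniq s1 -> uniq s2 -> S - e < P y s1 -> {subset s1 <= s2} ->
    rnorm (X y s2 - X y s1) ^+ 2 <= e.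
  by move=> u1 u2 h st; rewrite XB //; have := PS _ u2; lra.
have XC n m : rnorm (X y (s n) - X y (s m)) <= Num.sqrt n.+1%:R^-1 + Num.sqrt m.+1%:R^-1.
  (* The chosen index sets are not nested, so both sums are compared with the one over their
     union. *)
  pose r := undup (s n ++ s m); have ur : uniq r := undup_uniq _.
  have [[un hn] [um hm]] := (hs n, hs m).
  have b1 : rnorm (X y r - X y (s n)) <= Num.sqrt n.+1%:R^-1.
    rewrite -(@ler_pXn2r _ 2) ?nnegrE ?rnorm_ge0 ?sqrtr_ge0 // sqr_sqrtr ?(ltW (n0 _)) //.
    by apply: XP => // i ii; rewrite mem_undup mem_cat ii.
  have b2 : rnorm (X y r - X y (s m)) <= Num.sqrt m.+1%:R^-1.
    rewrite -(@ler_pXn2r _ 2) ?nnegrE ?rnorm_ge0 ?sqrtr_ge0 // sqr_sqrtr ?(ltW (n0 _)) //.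
    by apply: XP => // i ii; rewrite mem_undup mem_cat ii orbT.
  have := rnormD (- (X y r - X y (s n))) (X y r - X y (s m)).
  rewrite rnormN opprB addrA subrK => /le_trans; apply; exact: lerD.
have sq_small (e : R) : 0 < e -> exists M, forall n, (M <= n)%N -> Num.sqrt n.+1%:R^-1 < e.
  move=> e0; have [|M hM] := @inv_succ_lt R (e ^+ 2); first by rewrite exprn_gt0.
  exists M => n /hM h; rewrite -(@ltr_pXn2r _ 2) ?nnegrE ?sqrtr_ge0 ?(ltW e0) //.
  by rewrite sqr_sqrtr ?(ltW (n0 _)).
have [e e0|x hx] := hilbert_complete (u := fun n => X y (s n)).
  have [|M hM] := sq_small (e / 2); first by rewrite divr_gt0.
  exists M => n m Mn Mm; apply: le_lt_trans (XC n m) _.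
  by have := hM n Mn; have := hM m Mm; lra.
exists x => [j|].
  have Wb u : rnorm (W j u) <= 1 * rnorm u.
    rewrite mul1r; apply: le_sqr_factor; rewrite ?rnorm_ge0 //.
    rewrite rnorm2E -ZW; apply: le_trans (Re_hdot_le _ _) _; rewrite mulrC ler_wpM2l ?rnorm_ge0 //.
    apply: le_sqr_factor; rewrite ?rnorm_ge0 //.
    rewrite rnorm2E ZW WZ; apply: le_trans (Re_hdot_le _ _) _.
    have : rnorm (W j u) ^+ 2 = rnorm (Z j (W j u)) ^+ 2 by rewrite !rnorm2E ZW WZ.
    move=> /eqP; rewrite eqrXn2 ?rnorm_ge0 // => /eqP ->; exact: lexx.
  apply/eqP; rewrite -subr_eq0; apply/eqP/rnorm_le0.
  apply: (@le_eps _ _ _ 2) => e e0; rewrite add0r.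
  have [M1 h1] := hx e e0; have [M2 h2] := sq_small e e0.
  pose n := maxn M1 M2; have {}h1 := h1 n (leq_maxl _ _); have {}h2 := h2 n (leq_maxr _ _).
  have [un hn] := hs n.
  have WB u v : W j (u - v) = W j u - W j v.
    by have := Wlin j (-1) v u; rewrite !scaleN1r [- v + u]addrC [- W j v + _]addrC.
  have b1 : rnorm (W j x - W j (X y (s n))) <= e.
    by rewrite -WB; apply: le_trans (Wb _) _; rewrite mul1r ltW.
  have b2 : rnorm (W j (X y (s n)) - y j) <= Num.sqrt n.+1%:R^-1.
    rewrite WX //; case: ifPn => js; first by rewrite subrr rnorm0 sqrtr_ge0.
    rewrite sub0r rnormN -(@ler_pXn2r _ 2) ?nnegrE ?rnorm_ge0 ?sqrtr_ge0 //.
    rewrite sqr_sqrtr ?(ltW (n0 _)) //.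
    (* An index outside [s n] has weight below [1 / (n + 1)], since adding it cannot exceed [S]. *)
    have := PS (j :: s n); rewrite /= js un => /(_ isT); rewrite /P big_cons.
    by move: hn; rewrite /P; move: (n.+1%:R^-1) => d; lra.
  have := rnormD (W j x - W j (X y (s n))) (W j (X y (s n)) - y j).
  by rewrite addrA subrK; move: h2 b2; move: (Num.sqrt _) => d; lra.
rewrite SeE; congr (_%:E); apply/le_anti/andP; split.
  apply: (@le_eps _ _ _ (2 * rnorm x + 2)) => e e0.
  pose d := Num.min e 1; have d0 : 0 < d by rewrite lt_min e0 ltr01.
  have d1 : d <= 1 by rewrite ge_min lexx orbT.
  have de : d <= e by rewrite ge_min lexx.
  have [M1 h1] := hx d d0; have [M2 h2] := inv_succ_lt d0.
  pose n := maxn M1 M2; have {}h1 := h1 n (leq_maxl _ _); have {}h2 := h2 n (leq_maxr _ _).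
  have [un hn] := hs n; rewrite -normX // in hn.
  have b1 : rnorm (X y (s n)) <= rnorm x + d.
    have := rnormD (- (x - X y (s n))) x; rewrite rnormN opprB subrK.
    by move=> /le_trans; apply; rewrite addrC lerD2l ltW.
  have b2 : rnorm (X y (s n)) ^+ 2 <= (rnorm x + d) ^+ 2.
    by rewrite ler_pXn2r ?nnegrE ?addr_ge0 ?rnorm_ge0 ?(ltW d0).
  have b3 : rnorm x * d <= rnorm x * e by rewrite ler_wpM2l ?rnorm_ge0.
  have b4 : d * d <= d by rewrite ler_piMr // ltW.
  by move: (n.+1%:R^-1) h2 hn => c; rewrite sqrrD in b2; lra.
apply: (@le_eps _ _ _ (2 * rnorm x + 1)) => e e0.
have [M1 h1] := hx e e0; have {}h1 := h1 M1 (leqnn _); have [un hn] := hs M1.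
have := PS _ un; rewrite -normX // => b1.
have b2 : rnorm x <= rnorm (X y (s M1)) + e.
  have := rnormD (x - X y (s M1)) (X y (s M1)); rewrite subrK => /le_trans; apply.
  by rewrite addrC lerD2l ltW.
have [b3|b3] := leP (rnorm x) e.
  have : rnorm x ^+ 2 <= rnorm x * e by rewrite expr2 ler_wpM2l ?rnorm_ge0.
  have := le_trans (sqr_ge0 _) b1; have : 0 <= rnorm x * e by rewrite mulr_ge0 ?rnorm_ge0 ?ltW.
  lra.
have : (rnorm x - e) ^+ 2 <= rnorm (X y (s M1)) ^+ 2.
  by rewrite ler_pXn2r ?nnegrE ?rnorm_ge0 ?subr_ge0 ?(ltW b3) // lerBlDr.
have := sqr_ge0 e; rewrite sqrrB; lra.
Qed.

(** Bessel's inequality makes the coordinates of [u] square summable; the vector with these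
    coordinates given by [orthogonal_sum_ex] equals [u] by totality. *)
Lemma orthogonal_parseval u :
  (\esum_(i in [set: I]) (rnorm (W i u) ^+ 2)%:E = (rnorm u ^+ 2)%:E)%E.
Proof.
pose y i := W i u.
have bessel : (\esum_(i in [set: I]) (rnorm (y i) ^+ 2)%:E <= (rnorm u ^+ 2)%:E)%E.
  apply: esum_le_seq => [i|s us]; first exact: sqr_ge0.
  rewrite lee_fin; have := sqr_ge0 (rnorm (u - X y s)).
  rewrite rnorm2B normX // hdotC Re_conjc hdotX Re_sum.
  rewrite (eq_bigr (fun i => rnorm (y i) ^+ 2)) => [|i _]; last by rewrite rnorm2E.
  by rewrite /P; lra.
have [|x xy ->] := @orthogonal_sum_ex y; first exact: le_lt_trans bessel (ltry _).
suff -> : u = x by [].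
apply/eqP; rewrite -subr_eq0; apply/eqP/Wtotal => i.
have := Wlin i (-1) x u; rewrite !scaleN1r [- x + u]addrC => ->; rewrite xy /y.
by rewrite addNr.
Qed.

End OrthogonalIsometries.

(** * Consequences of a link between two representations *)

Section LinkCalculus.
Context {R : realType} {A B : locallyCstarType R} {E : hilbertModType A}.
Variable f : B -> E -> E.
Hypothesis fiso : iso_compact_op f.
Hypothesis fullE : full E.
Variables (phi : representation A) (psi : representation B).
Hypotheses (phi_nd : nondegenerate phi) (psi_nd : nondegenerate psi).
Variables (tau : E -> phi -> psi) (tau' : E -> psi -> phi).
Hypothesis adj : forall x h u, hdot (tau x h) u = hdot h (tau' x u).
Hypothesis tt : forall x y h, tau' y (tau x h) = rep_map phi (inner y x) h.
Hypothesis tt' : forall x y b u, f b = theta y x -> tau y (tau' x u) = rep_map psi b u.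
Implicit Types (a : A) (b : B) (x y z : E) (h : phi) (u : psi).

Lemma link_linear x : linear (tau x).
Proof. exact: (linear_adj (adj x)). Qed.

Lemma link_linear' x : linear (tau' x).
Proof. exact: (linear_adj (hdot_adjC (adj x))). Qed.

Let tauB x h g : tau x (h - g) = tau x h - tau x g.
Proof.
by have := link_linear x (-1) g h; rewrite !scaleN1r [- g + h]addrC [- _ + tau x h]addrC.
Qed.

Let tau'B x u v : tau' x (u - v) = tau' x u - tau' x v.
Proof.
by have := link_linear' x (-1) v u; rewrite !scaleN1r [- v + u]addrC [- _ + tau' x u]addrC.
Qed.

(** This is where fullness of [E] enters: the elements that kill [h] contain a two-sided ideal with
    all inner products in it, hence a dense set. *)
Lemma link_inj h : (forall x, tau x h = 0) -> h = 0.
Proof.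
move=> th; apply: (nondegenerate_inj phi_nd) => a.
(* [phi a h = 0] alone defines a left ideal; the condition on [amul a c] makes it two-sided. Inner
   products belong to it because [<x, y> c = <x, y c>]. *)
pose J := [set a | rep_map phi a h = 0 /\ forall c, rep_map phi (amul a c) h = 0].
have t'0 y : tau' y 0 = 0 by have := tau'B y 0 0; rewrite !subr0 subrr.
have Jideal : two_sided_ideal J.
  split; [split|].
  - by split=> [|c]; rewrite ?amul0l rep0.
  - move=> c d e [d0 dc] [e0 ec]; split=> [|k].
      by rewrite rep_linear d0 e0 scaler0 addr0.
    by rewrite amulDl amulZl rep_linear dc ec scaler0 addr0.
  - move=> c d [d0 dc]; split; split=> [|k].
    + by rewrite rep_mul d0 linear0.
    + by rewrite -amulA rep_mul dc linear0.
    + exact: dc.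
    + by rewrite -amulA dc.
have Jinner : [set a | exists x y, a = inner x y] `<=` J.
  move=> _ [x [y ->]]; split=> [|c]; first by rewrite -tt th t'0.
  by rewrite -inner_act -tt th t'0.
apply: rnorm_le0; apply: (@le_eps _ _ _ (rnorm h)) => e e0; rewrite add0r.
have := nbhsT a (rep_near0 phi e0); rewrite nbhsE => -[V [Vo Va] hV].
have [c [Vc Jc]] := fullE (ex_intro _ a Va) Vo.
have [c0 _] : J c by exact: (smallest_sub Jideal Jinner Jc).
have [d hd dc] := hV c Vc; have {}dc : c = a + d by rewrite -dc.
have := hd h; rewrite mulrC; have -> : d = c - a by rewrite dc addrAC subrr add0r.
by rewrite repB c0 sub0r rnormN mulrC.
Qed.

(** [u] is killed by [psi b] when [f b] has rank one, hence when [f b] has finite rank, hence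
    always, by approximation and [compact_rep_bound]. *)
Lemma link_inj' u : (forall x, tau' x u = 0) -> u = 0.
Proof.
move=> tu; apply: (nondegenerate_inj psi_nd) => b.
have t0 y : tau y 0 = 0 by have := tauB y 0 0; rewrite !subr0 subrr.
pose S0 := [set S | exists2 b, f b = S & rep_map psi b u = 0].
have S0s : subspace S0.
  split; first by exists 0; [exact: (iso0 fiso)|rewrite rep0].
  move=> c _ _ [b1 <- b10] [b2 <- b20]; exists (c *: b1 + b2); first exact: iso_lin.
  by rewrite rep_linear b10 b20 scaler0 addr0.
have S0t : [set T : E -> E | exists y x : E, T = theta y x] `<=` S0.
  move=> _ [y [x ->]]; have [b0 fb] := iso_theta fiso x y; exists b0 => //.
  by rewrite -(tt' u fb) tu t0.
have [p [C [pS C0 hC]]] := compact_rep_bound fiso psi.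
apply: rnorm_le0; apply: (@le_eps _ _ _ (C * rnorm u)) => e e0; rewrite add0r.
have [S Sfr hS] := compact_approx pS (iso_compact fiso b) e0.
have [b0 fb0 b0u] : S0 S by exact: (smallest_sub S0s S0t Sfr).
have := hC (b0 - b) e u (ltW e0).
rewrite repB b0u sub0r rnormN mulrAC; apply=> x.
by have := hS x; rewrite -fb0 /= (iso_add fiso) -[- b]scaleN1r (iso_scale fiso) scaleN1r.
Qed.

(** [linked] asks for no intertwining with the action of [A]; it follows from the inner product
    relations, tested against the jointly injective [tau']. *)
Lemma link_act x a h : tau x (rep_map phi a h) = tau (act x a) h.
Proof.
apply/eqP; rewrite -subr_eq0; apply/eqP/link_inj' => y.
by rewrite tau'B !tt inner_act rep_mul subrr.
Qed.

Lemma link_act' x a u : rep_map phi a (tau' x u) = tau' (act x (star a)) u.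
Proof. by apply: eq_hdotr => h; rewrite -rep_star_l -!adj link_act. Qed.

(** For the adjoints, and tested against [tau z], this becomes [theta z x \o f (star b) = theta z (f
    b x)]. *)
Lemma link_op x b h : rep_map psi b (tau x h) = tau (f b x) h.
Proof.
apply: eq_hdotl => v; rewrite rep_star !adj; congr (hdot h _).
apply/eqP; rewrite -subr_eq0; apply/eqP/link_inj => z.
have [b0 fb0] := iso_theta fiso x z.
rewrite tauB (tt' _ fb0) -rep_mul (@tt' (f b x) z (amul b0 (star b))) ?subrr //.
apply/funext => w; rewrite (iso_mul fiso) fb0 /theta; congr (act z _).
by rewrite (iso_adj fiso).
Qed.

Lemma link_op' x b u : tau' x (rep_map psi b u) = tau' (f (star b) x) u.
Proof. by apply: eq_hdotr => h; rewrite -!adj -rep_star_l link_op. Qed.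

Lemma link_bound x : exists2 M : R, 0 <= M & forall h, rnorm (tau x h) <= M * rnorm h.
Proof.
have [M M0 hM] := rep_bound phi (inner x x).
exists (Num.sqrt M) => [|h]; first exact: sqrtr_ge0.
rewrite -(@ler_pXn2r _ 2) ?nnegrE ?mulr_ge0 ?sqrtr_ge0 ?rnorm_ge0 //.
rewrite rnorm2E adj tt exprMn sqr_sqrtr // expr2 mulrA mulrC.
by apply: le_trans (Re_hdot_le _ _) _; rewrite ler_wpM2l ?rnorm_ge0.
Qed.

Lemma link_bound' x : exists2 M : R, 0 <= M & forall u, rnorm (tau' x u) <= M * rnorm u.
Proof. by have [M M0 hM] := link_bound x; exists M => //; exact: (adj_bounded M0 hM (adj x)). Qed.

Lemma link_total : total (fun xh : E * phi => tau xh.1 xh.2).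
Proof.
move=> u hu; apply: link_inj' => x; apply: eq_hdotr => h.
by rewrite -adj (hu (x, h)) hdot0r.
Qed.

Lemma link_total' : total (fun xu : E * psi => tau' xu.1 xu.2).
Proof.
move=> h hh; apply: link_inj => x; apply: eq_hdotr => u; rewrite hdot0r.
by rewrite -(hdot_adjC (adj x)) (hh (x, u)).
Qed.

End LinkCalculus.

(** * The correspondence *)

Section UnitaryEquivalence.
Context {R : realType}.

Lemma unitary_inverse (H1 H2 : hilbertType R) (U : H1 -> H2) : unitary U ->
  exists V : H2 -> H1, [/\ unitary V, cancel U V & cancel V U].
Proof.
move=> [Ul Us Ui].
have /choice[V UV] y : exists x, U x = y by have [x _ <-] := Us y I; exists x.
have Uinj x y : U x = U y -> x = y.
  by move=> h; apply: eq_hdotl => z; rewrite -!Ui h.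
have VU : cancel U V by move=> x; apply: Uinj; rewrite UV.
exists V; split => //; split.
- by move=> c x y; apply: Uinj; rewrite Ul !UV.
- by move=> x _; exists (U x).
- by move=> x y; rewrite -Ui !UV.
Qed.

Context {A : locallyCstarType R}.
Implicit Types phi : representation A.

Lemma equiv_refl phi : unitarily_equivalent phi phi.
Proof. by exists id; split=> //; split=> // x _; exists x. Qed.

Lemma equiv_sym phi1 phi2 : unitarily_equivalent phi1 phi2 -> unitarily_equivalent phi2 phi1.
Proof.
move=> [U [/unitary_inverse[V [Vu UV VU]] Uphi]]; exists V; split=> // a x.
by rewrite -[x in LHS]VU -Uphi UV.
Qed.

Lemma equiv_trans phi1 phi2 phi3 : unitarily_equivalent phi1 phi2 ->
  unitarily_equivalent phi2 phi3 -> unitarily_equivalent phi1 phi3.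
Proof.
move=> [U [[Ul Us Ui] Uphi]] [V [[Vl Vs Vi] Vphi]]; exists (V \o U); split; [split|].
- by move=> c x y; rewrite /= Ul Vl.
- by move=> z _; have [y _ <-] := Vs z I; have [x _ <-] := Us y I; exists x.
- by move=> x y; rewrite /= Vi Ui.
- by move=> a x; rewrite /= Uphi Vphi.
Qed.

Lemma equiv_nondegenerate phi1 phi2 : unitarily_equivalent phi1 phi2 ->
  nondegenerate phi1 -> nondegenerate phi2.
Proof.
move=> /equiv_sym[U [[_ _ Ui] Uphi]] nd; apply/nondegenerateP => u hu.
have V0 : U 0 = 0 by apply: rnorm_eq0; rewrite (isometry_rnorm Ui) rnorm0.
have : U u = 0 by apply: (nondegenerate_inj nd) => a; rewrite -Uphi hu.
by move=> Uu; apply: rnorm_eq0; rewrite -(isometry_rnorm Ui) Uu rnorm0.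
Qed.

Lemma total_equivalence {I : Type} phi1 phi2 (s1 : I -> phi1) (s2 : I -> phi2)
    (r : A -> I -> I) : total s1 -> total s2 ->
  (forall i j, hdot (s2 i) (s2 j) = hdot (s1 i) (s1 j)) ->
  (forall a i, rep_map phi1 a (s1 i) = s1 (r a i)) ->
  (forall a i, rep_map phi2 a (s2 i) = s2 (r a i)) -> unitarily_equivalent phi1 phi2.
Proof.
move=> t1 t2 gram r1 r2; have [U [Uu Us]] := total_unitary t1 t2 gram.
have [Ul _ Ui] := Uu; exists U; split=> // a x.
apply: (total_eq t2) => i.
by rewrite -[in RHS]rep_star_l r2 -!Us !Ui -r1 rep_star_l.
Qed.

End UnitaryEquivalence.

Lemma closed_subspace_total {R : realType} {I : Type} (H : hilbertType R) (s : I -> H)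
    (M : set H) : subspace M -> closed M -> total s -> (forall i, M (s i)) -> M = setT.
Proof.
move=> Ms Mc tot hs; apply/seteqP; split=> // u _.
have [m Mm hm] := orthogonal_projection u Ms Mc.
suff /eqP : u - m = 0 by rewrite subr_eq0 => /eqP ->.
by apply: tot => i; rewrite hdotC hm ?conjc0.
Qed.

Section LinkInvariance.
Context {R : realType} {A B : locallyCstarType R} {E : hilbertModType A}.
Variable f : B -> E -> E.
Hypothesis fiso : iso_compact_op f.
Hypothesis fullE : full E.
Implicit Types (phi : representation A) (psi : representation B).

Lemma linked_equiv phi phi' psi psi' : unitarily_equivalent phi phi' ->
  unitarily_equivalent psi psi' -> linked f phi psi -> linked f phi' psi'.
Proof.
move=> [U [/[dup] Uu /unitary_inverse[V [Vu UV VU]] Uphi]].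
move=> [S [/[dup] Su /unitary_inverse[T [Tu ST TS]] Spsi]].
have [[_ _ Ui] [_ _ Si]] := (Uu, Su).
move=> [tau [tau' [adj tt tt']]].
exists (fun x h => S (tau x (V h))), (fun x u => U (tau' x (T u))); split.
- by move=> x h u; rewrite -{1}(TS u) Si adj -Ui VU.
- by move=> x y h; rewrite ST tt Uphi VU.
- by move=> x y b u fb; rewrite UV (tt' _ _ _ _ fb) Spsi TS.
Qed.

Lemma linked_unique_target phi psi psi' :
  nondegenerate phi -> nondegenerate psi -> nondegenerate psi' ->
  linked f phi psi -> linked f phi psi' -> unitarily_equivalent psi psi'.
Proof.
move=> phi_nd psi_nd psi_nd' [t [t' [adj tt tt']]] [s [s' [sadj ss ss']]].
apply: (total_equivalence (s1 := fun xh : E * phi => t xh.1 xh.2)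
  (s2 := fun xh : E * phi => s xh.1 xh.2) (r := fun b xh => (f b xh.1, xh.2))).
- exact: (link_total fiso psi_nd adj tt').
- exact: (link_total fiso psi_nd' sadj ss').
- by move=> [x h] [y g] /=; rewrite adj sadj tt ss.
- by move=> b [x h] /=; rewrite (link_op fiso fullE phi_nd adj tt tt').
- by move=> b [x h] /=; rewrite (link_op fiso fullE phi_nd sadj ss ss').
Qed.

Lemma linked_unique_source phi phi' psi :
  nondegenerate phi -> nondegenerate phi' -> nondegenerate psi ->
  linked f phi psi -> linked f phi' psi -> unitarily_equivalent phi phi'.
Proof.
move=> phi_nd phi_nd' psi_nd [t [t' [adj tt tt']]] [s [s' [sadj ss ss']]].
apply: (total_equivalence (s1 := fun xu : E * psi => t' xu.1 xu.2)
  (s2 := fun xu : E * psi => s' xu.1 xu.2) (r := fun a xu => (act xu.1 (star a), xu.2))).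
- exact: (link_total' fullE phi_nd adj tt).
- exact: (link_total' fullE phi_nd' sadj ss).
- move=> [x u] [y v] /=; have [b fb] := iso_theta fiso x y.
  by rewrite -adj -sadj (tt' _ _ _ _ fb) (ss' _ _ _ _ fb).
- by move=> a [x u] /=; rewrite (link_act' fiso psi_nd adj tt tt').
- by move=> a [x u] /=; rewrite (link_act' fiso psi_nd sadj ss ss').
Qed.

End LinkInvariance.

(** * Transfer of irreducibility *)

Section Irreducibility.
Context {R : realType} {A B : locallyCstarType R} {X : Type}.
Variables (phi : representation A) (psi : representation B).
Variables (tau : X -> phi -> psi) (tau' : X -> psi -> phi).

(** An invariant [M] pulls back to the invariant set [N] of all [h] with every [tau x h] in [M]. If
    [N] is zero, [M] is killed by all [tau']; if it is everything, [M] contains a total family. The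
    abstract form lets [tau] and [tau'] exchange roles. *)
Lemma irreducible_transfer :
  (forall x, linear (tau x)) ->
  (forall x, exists2 M : R, 0 <= M & forall h, rnorm (tau x h) <= M * rnorm h) ->
  (forall x a, exists y, forall h, tau x (rep_map phi a h) = tau y h) ->
  (forall x y, exists b, forall u, tau x (tau' y u) = rep_map psi b u) ->
  (forall h, (forall x, tau x h = 0) -> h = 0) ->
  (forall u, (forall x, tau' x u = 0) -> u = 0) ->
  total (fun xh : X * phi => tau xh.1 xh.2) ->
  irreducible phi -> irreducible psi.
Proof.
move=> tl tb ta tt' inj inj' tot [[h0 h0n] irr]; split.
  apply: contrapT => /forallNP u0; move/eqP: h0n; apply; apply: inj => x.
  by apply/eqP/negPn/negP/u0.
move=> M [M0 Ml] Mc Mb.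
have t0 x : tau x 0 = 0 by rewrite -(scale0r 0) (linear_scale (tl x)) scale0r.
pose N := [set h | forall x, M (tau x h)].
have [||a h Nh x|N0|NT] := irr N.
- by split=> [x|c h g Nh Ng x]; rewrite ?t0 // tl; exact: Ml.
- apply/closed_rnormP => h hN x; apply: (closed_rnormP M).1 => // e e0.
  have [K K0 hK] := tb x; have [|g Ng hg] := hN (e / (K + 1)).
    by rewrite divr_gt0 // ltr_wpDl.
  exists (tau x g) => //; have -> : tau x h - tau x g = tau x (h - g).
    by have := tl x (-1) g h; rewrite !scaleN1r [- g + h]addrC [- _ + tau x h]addrC.
  apply: le_lt_trans (hK _) _; move: hg; rewrite ltr_pdivlMr ?ltr_wpDl // => hg.
  by have := rnorm_ge0 (h - g); lra.
- by have [y ->] := ta x a.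
- left; apply/seteqP; split=> u /= => [Mu|-> //].
  apply: inj' => y; have : N (tau' y u) by move=> x; have [b ->] := tt' x y; exact: Mb.
  by rewrite N0.
- right; apply: closed_subspace_total Mc tot _ => // -[x h] /=.
  by have : N h by rewrite NT.
Qed.

End Irreducibility.

(** * Transfer of direct sums *)

Section DirectSumEmbeddings.
Context {R : realType} {I : choiceType} (H : hilbertType R) (Hs : I -> hilbertType R).
Variable U : forall i, H -> Hs i.
Arguments U : clear implicits.
Hypothesis Ulin : forall i, linear (U i).
Hypothesis Unorm : forall x,
  (\esum_(i in [set: I]) (rnorm (U i x) ^+ 2)%:E = (rnorm x ^+ 2)%:E)%E.
Hypothesis Usurj : forall y : (forall i, Hs i),
  (\esum_(i in [set: I]) (rnorm (y i) ^+ 2)%:E < +oo)%E ->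
  exists x, forall i, U i x = y i.

Let esum_at j (c : R) : 0 <= c ->
  (\esum_(i in [set: I]) (if i == j then c else 0)%:E = c%:E)%E.
Proof.
move=> c0; rewrite -(@esum_set1 _ _ j (fun=> c%:E)) ?lee_fin // [RHS]esum_mkcond.
apply: eq_esum => i _; rewrite in_set1; case: (i == j) => //.
Qed.

(** [is_direct_sum] provides coordinates only. [V j y] is the vector with the single nonzero
    coordinate [y]; that [V j] is adjoint to [U j] follows by polarization from [Unorm]. *)
Lemma direct_sum_embeddings : exists V : forall i, Hs i -> H,
  [/\ forall j y z, hdot (V j y) z = hdot y (U j z),
      forall j y, U j (V j y) = y &
      forall i j y, i != j -> U i (V j y) = 0].
Proof.
have ex j y : exists x, U j x = y /\ forall i, i != j -> U i x = 0.
  pose w := @dfwith I (fun i => Hs i) (fun=> 0) j y.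
  have [|x xw] := Usurj (y := w); last first.
    exists x; split; first by rewrite xw /w dfwithin.
    by move=> i ij; rewrite xw /w dfwithout // eq_sym.
  rewrite (eq_esum (b := fun i => (if i == j then rnorm y ^+ 2 else 0)%:E)).
    by rewrite esum_at ?sqr_ge0 // ltry.
  move=> i _; have [->|ij] := eqVneq i j; first by rewrite /w dfwithin.
  by rewrite /w dfwithout 1?eq_sym // rnorm0 expr0n.
have key j x z : (forall i, i != j -> U i x = 0) -> hdot x z = hdot (U j x) (U j z).
  move=> x0.
  have UD i u v : U i (u + v) = U i u + U i v by have := Ulin i 1 u v; rewrite !scale1r.
  have nx : rnorm x ^+ 2 = rnorm (U j x) ^+ 2.
    apply: EFin_inj; rewrite -Unorm -(esum_at j) ?sqr_ge0 //; apply: eq_esum => i _.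
    by have [->|ij] := eqVneq i j; rewrite // x0 // rnorm0 expr0n.
  have reE u : complex.Re (hdot x u) = complex.Re (hdot (U j x) (U j u)).
    (* [x + u] and [u] have the same coordinates away from [j], so comparing the two sums isolates
       the inner product at [j]. *)
    have : rnorm (x + u) ^+ 2 + rnorm (U j u) ^+ 2 = rnorm u ^+ 2 + rnorm (U j x + U j u) ^+ 2.
      apply: EFin_inj; rewrite !EFinD -!Unorm.
      rewrite -(esum_at j (c := rnorm (U j u) ^+ 2)) ?sqr_ge0 //.
      rewrite -(esum_at j (c := rnorm (U j x + U j u) ^+ 2)) ?sqr_ge0 //.
      rewrite -!esumD;
        try (by move=> i _; rewrite lee_fin ?sqr_ge0 //; case: ifP => // _; rewrite sqr_ge0).
      apply: eq_esum => i _; rewrite -!EFinD UD; congr (_%:E).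
      by have [->|ij] := eqVneq i j; [rewrite addrC|rewrite x0 // add0r !addr0].
    by rewrite !rnorm2D nx; lra.
  (* The real part at [i z] supplies the imaginary part at [z]. *)
  have imE := reE ('i%C *: z); have UZ := linear_scale (Ulin j).
  have {}reE := reE z; move: imE; rewrite UZ !hdotZr !conj_i.
  case: (hdot x z) reE => p q; case: (hdot _ _) => p' q' /= -> h.
  by congr (_ +i* _)%C; lra.
have /choice[V hV] (jy : {j : I & Hs j}) := ex (projT1 jy) (projT2 jy).
exists (fun j y => V (existT _ j y)); split=> [j y z|j y|i j y].
- by have [V1 V2] := hV (existT _ j y); rewrite (key j) // V1.
- by have [] := hV (existT _ j y).
- by have [_ h] := hV (existT _ j y); exact: h.
Qed.

End DirectSumEmbeddings.

Section DirectSumTransfer.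
Context {R : realType} {A B : locallyCstarType R} {E : hilbertModType A}.
Variable f : B -> E -> E.
Hypothesis fiso : iso_compact_op f.
Hypothesis fullE : full E.

(** The vectors [t x y] of [psi_ i] and [tau x (V i y)] of [psi] have the same Gram matrix, which
    embeds each [psi_ i] isometrically in [psi]. *)
Lemma linked_direct_sum (I : choiceType) (phi : representation A)
    (phi_ : I -> representation A) (psi : representation B) (psi_ : I -> representation B) :
  nondegenerate phi -> (forall i, nondegenerate (phi_ i)) ->
  nondegenerate psi -> (forall i, nondegenerate (psi_ i)) ->
  linked f phi psi -> (forall i, linked f (phi_ i) (psi_ i)) ->
  is_direct_sum phi phi_ -> is_direct_sum psi psi_.
Proof.
move=> phi_nd phi_nd_ psi_nd psi_nd_ [tau [tau' [adj tt tt']]] lk.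
move=> [U [Ulin Unorm Usurj Uphi]].
have [V [Vadj UV UV0]] := direct_sum_embeddings Ulin Unorm Usurj.
have Zex i : exists ZW : (psi_ i -> psi) * (psi -> psi_ i),
  [/\ forall y u, hdot (ZW.1 y) u = hdot y (ZW.2 u),
      forall y, ZW.2 (ZW.1 y) = y,
      forall b y, ZW.1 (rep_map (psi_ i) b y) = rep_map psi b (ZW.1 y) &
      exists2 t : E -> phi_ i -> psi_ i, total (fun xy => t xy.1 xy.2) &
        forall x y, ZW.1 (t x y) = tau x (V i y)].
  have [t [t' [sadj ss ss']]] := lk i.
  have ttot := link_total fiso (psi_nd_ i) sadj ss'.
  have [|Z [Zlin Zs Ziso]] := total_isometry (s2 := fun xy => tau xy.1 (V i xy.2)) ttot.
    move=> [x y] [x' y'] /=.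
    by rewrite adj sadj tt ss Vadj Uphi UV.
  have Zn y : rnorm (Z y) <= 1 * rnorm y by rewrite (isometry_rnorm Ziso) mul1r.
  have [W ZW] := bounded_adj Zlin Zn.
  exists (Z, W); split => //=.
  - by move=> y; apply: eq_hdotr => v; rewrite -ZW Ziso.
  - move=> b; have [M M0 hM] := rep_bound psi b; have [K K0 hK] := rep_bound (psi_ i) b.
    apply: (total_ext (M := K) (K := M) ttot).
    + by move=> c u v; rewrite linearP Zlin.
    + by move=> c u v; rewrite Zlin linearP.
    + by move=> u; rewrite (isometry_rnorm Ziso).
    + by move=> u; rewrite -[in leRHS](isometry_rnorm Ziso).
    + move=> [x y]; rewrite (link_op fiso fullE (phi_nd_ i) sadj ss ss') /=.
      by rewrite (Zs (x, y)) (Zs (_, y)) (link_op fiso fullE phi_nd adj tt tt').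
  - by exists t => // x y; rewrite (Zs (x, y)).
pose ZW i := sval (cid (Zex i)).
have hZ i := svalP (cid (Zex i)); rewrite -/(ZW _) in hZ.
pose Z i := (ZW i).1; pose W i := (ZW i).2.
have ZWadj i y u : hdot (Z i y) u = hdot y (W i u) by have [h _ _ _] := hZ i; exact: h.
have WZ i y : W i (Z i y) = y by have [_ h _ _] := hZ i; exact: h.
have Wlin i : linear (W i) := linear_adj (hdot_adjC (ZWadj i)).
(* Generators of different summands are orthogonal: [U] intertwines the action of [A], and at one
   index it kills the range of [V] at another. *)
have WZ0 i j y : i != j -> W i (Z j y) = 0.
  move=> ij; have [_ _ _ [ti toti hi]] := hZ i; have [_ _ _ [tj totj hj]] := hZ j.
  have h0 x v x' v' : hdot (Z i (ti x v)) (Z j (tj x' v')) = 0.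
    by rewrite /Z hi hj adj tt Vadj Uphi UV0 // linear0 hdot0r.
  apply: toti => -[x v] /=; rewrite -ZWadj -(hdot_adjC (ZWadj j)).
  have -> : W j (Z i (ti x v)) = 0; last by rewrite hdot0l.
  by apply: totj => -[x' v'] /=; rewrite -ZWadj hdotC h0 conjc0.
(* If all [W i u] vanish, so do all coordinates of [tau' x u], and [Unorm] gives [tau' x u = 0]. *)
have Wtot u : (forall i, W i u = 0) -> u = 0.
  move=> Wu; apply: (link_inj' fiso psi_nd adj tt') => x.
  apply: rnorm_eq0; apply/eqP; rewrite -sqrf_eq0; apply/eqP/EFin_inj; rewrite -Unorm.
  apply: esum1 => i _; suff -> : U i (tau' x u) = 0 by rewrite rnorm0 expr0n.
  apply: eq_hdotr => y; rewrite -Vadj -adj hdot0r.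
  by have [_ _ _ [t _ h]] := hZ i; rewrite -h ZWadj Wu hdot0r.
exists W; split => //.
- exact: (orthogonal_parseval Wlin ZWadj WZ WZ0 Wtot).
- by move=> y /(orthogonal_sum_ex Wlin ZWadj WZ WZ0)[x hx _]; exists x.
- move=> b u i; apply: eq_hdotr => v; rewrite -ZWadj -rep_star_l -[RHS]rep_star_l -ZWadj.
  by have [_ _ h _] := hZ i; rewrite /Z h.
Qed.

End DirectSumTransfer.

(** * Correspondence between classes *)

Section ClassCorrespondence.
Context {R : realType} {A B : locallyCstarType R}.

Lemma class_ext (X Y : nondegenerate_class A) :
  (forall phi : representation A, sval X phi <-> sval Y phi) -> X = Y.
Proof.
case: X Y => [X hX] [Y hY] /= h.
have E : X = Y by apply/funext => phi; apply/propext; exact: h.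
by subst Y; congr exist; exact: Prop_irrelevance.
Qed.

Lemma class_equiv (X : nondegenerate_class A) phi phi' :
  sval X phi -> sval X phi' <-> unitarily_equivalent phi phi'.
Proof.
have [phi0 [_ ->]] := svalP X; move=> h; split=> [h'|].
  exact: equiv_trans (equiv_sym h) h'.
exact: equiv_trans h.
Qed.

Lemma class_nondegenerate (X : nondegenerate_class A) phi : sval X phi -> nondegenerate phi.
Proof. by have [phi0 [nd ->]] := svalP X; move=> h; exact: equiv_nondegenerate h nd. Qed.

Variable L : representation A -> representation B -> Prop.
Hypothesis L_source : forall phi, nondegenerate phi -> exists2 psi, nondegenerate psi & L phi psi.
Hypothesis L_equiv : forall phi phi' psi psi', unitarily_equivalent phi phi' ->
  unitarily_equivalent psi psi' -> L phi psi -> L phi' psi'.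
Hypothesis L_unique : forall phi psi psi', nondegenerate phi -> nondegenerate psi ->
  nondegenerate psi' -> L phi psi -> L phi psi' -> unitarily_equivalent psi psi'.

(** [L] is abstract so that the map can be built in either direction. A link survives adding a zero
    summand to [psi], hence nondegeneracy is part of the description of [Phi X]. *)
Lemma class_map : exists Phi : nondegenerate_class A -> nondegenerate_class B,
  forall X psi, sval (Phi X) psi <->
    nondegenerate psi /\ exists2 phi, sval X phi & L phi psi.
Proof.
pose P (X : nondegenerate_class A) psi := nondegenerate psi /\ exists2 phi, sval X phi & L phi psi.
have Pclass X : exists psi, nondegenerate psi /\ P X = unitarily_equivalent psi.
  case: X => X hX; have [phi [nd Xphi]] := hX; have [psi psi_nd lk] := L_source nd.
  exists psi; split=> //; apply/funext => psi'; apply/propext; rewrite /P /= Xphi.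
  split=> [[psi_nd' [phi' hphi lk']]|h].
    apply: (L_unique nd psi_nd psi_nd' lk).
    exact: L_equiv (equiv_sym hphi) (equiv_refl _) lk'.
  split; first exact: equiv_nondegenerate h psi_nd.
  by exists phi; [exact: equiv_refl|exact: L_equiv (equiv_refl _) h lk].
by exists (fun X => exist _ (P X) (Pclass X)).
Qed.

End ClassCorrespondence.

Theorem theorem4p4 (R : realType) (A B : locallyCstarType R) :
  strongly_Morita_equivalent A B ->
  exists Phi : nondegenerate_class A -> nondegenerate_class B,
    [/\ bijective Phi, preserves_direct_sums Phi & preserves_irreducibility Phi].
Proof.
move=> [E [fullE [f fiso]]].
have Leq phi phi' psi psi' : unitarily_equivalent phi phi' ->
    unitarily_equivalent psi psi' -> linked f phi psi -> linked f phi' psi'.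
  exact: linked_equiv.
have [Phi PhiE] := class_map (linked_of_source fiso) Leq (linked_unique_target fiso fullE).
(* [Psi] comes from the same relation with its sides exchanged, so the inverse laws reduce to
   uniqueness of source and target. *)
have [Psi PsiE] := @class_map R B A (fun psi phi => linked f phi psi)
  (linked_of_target fiso) (fun _ _ _ _ h1 h2 => Leq _ _ _ _ h2 h1)
  (fun psi phi phi' nd nd1 nd2 l1 l2 => linked_unique_source fiso fullE nd1 nd2 nd l1 l2).
have PhiL X phi psi : sval X phi -> sval (Phi X) psi ->
    [/\ nondegenerate phi, nondegenerate psi & linked f phi psi].
  move=> Xphi /[dup] /class_nondegenerate psi_nd /PhiE[_ [phi' Xphi' lk]]; split=> //.
    exact: class_nondegenerate Xphi.
  by apply: Leq lk; [exact/(class_equiv _ Xphi')|exact: equiv_refl].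
exists Phi; split.
- exists Psi => X; apply: class_ext => phi; split.
  + move=> /PsiE[nd [psi /PhiE[psi_nd [phi' Xphi' lk]] lk']]; apply/(class_equiv _ Xphi').
    exact: (linked_unique_source fiso fullE (class_nondegenerate Xphi') nd psi_nd).
  + move=> Xphi; have nd := class_nondegenerate Xphi; apply/PsiE; split=> //.
    have [psi psi_nd lk] := linked_of_source fiso nd; exists psi => //.
    by apply/PhiE; split=> //; exists phi.
  + move=> /PhiE[nd [psi /PsiE[psi_nd [phi' Xphi' lk]] lk']]; apply/(class_equiv _ Xphi').
    exact: (linked_unique_target fiso fullE psi_nd (class_nondegenerate Xphi') nd).
  + move=> Xphi; have nd := class_nondegenerate Xphi; apply/PhiE; split=> //.
    have [psi psi_nd lk] := linked_of_target fiso nd; exists psi => //.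
    by apply/PsiE; split=> //; exists phi.
- move=> I phi phi_ psi psi_ X X_ Xphi X_phi Ypsi Y_psi.
  have [nd nd' lk] := PhiL _ _ _ Xphi Ypsi.
  have lk_ i := PhiL _ _ _ (X_phi i) (Y_psi i).
  apply: (linked_direct_sum fiso fullE nd _ nd' _ lk) => i; by have [] := lk_ i.
- move=> X phi psi Xphi Ypsi.
  have [nd nd' [tau [tau' [adj tt tt']]]] := PhiL _ _ _ Xphi Ypsi; split.
  + apply: (irreducible_transfer (tau := tau) (tau' := tau')).
    * by move=> x; exact: (link_linear adj).
    * exact: (link_bound adj tt).
    * by move=> x a; exists (act x a) => h; exact: (link_act fiso nd' adj tt tt').
    * by move=> x y; have [b fb] := iso_theta fiso y x; exists b => u; exact: tt'.
    * by move=> h; exact: (link_inj fullE nd adj tt).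
    * by move=> u; exact: (link_inj' fiso nd' adj tt').
    * exact: (link_total fiso nd' adj tt').
  + apply: (irreducible_transfer (tau := tau') (tau' := tau)).
    * by move=> x; exact: (link_linear' adj).
    * exact: (link_bound' adj tt).
    * by move=> x b; exists (f (star b) x) => u; exact: (link_op' fiso fullE nd adj tt tt').
    * by move=> x y; exists (inner x y) => h; exact: tt.
    * by move=> u; exact: (link_inj' fiso nd' adj tt').
    * by move=> h; exact: (link_inj fullE nd adj tt).
    * exact: (link_total' fullE nd adj tt).
Qed.
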